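(* Assume (P) and $(\mathrm E_s)$ (see context). For radial $(\eta,s)$ with $(\eta,\eta-s/f'(\rho_0))\in X^{\rm rad}$, the following are equivalent: (i) $(\eta,\eta-s/f'(\rho_0))\in\overline{\operatorname{Ran}B}$; (ii) $I_\eta(R)=0$ and $s(r)=f'(\rho_0(r))\dfrac{\rho_0'(r)}{4\pi r^2\rho_0(r)}I_\eta(r)$; (iii) $\delta\mathcal C_g[\eta,s]=0$ for every $g\in\mathscr G_0$.
   Context: Newton operator: $((-\Delta)^{-1}h)(x)=\frac1{4\pi}\int_{\mathbb R^3}\frac{h(y)}{|x-y|}dy$, $V_h=-4\pi(-\Delta)^{-1}h$. Hypothesis (P). $P\in C^3(\mathbb R\times(0,\infty))\cap C^1(\mathbb R\times[0,\infty))$, $P=P(S,\rho)$, $P(S,0)=0$, and $P_\rho>0$, $P_S>0$ for $\rho>0$. There are $\gamma_0\in(6/5,2)$, $\alpha_0>0$ such that for every compact interval $J\subset\mathbb R$ there is $K\in C^2(J)$ with $\inf_JK>0$ and $\partial_S^j\partial_\rho^k(P(S,\rho)-K(S)\rho^{\gamma_0})=O_J(\rho^{\gamma_0-k+\alpha_0})$ as $\rho\downarrow0$, uniformly in $S\in J$, for $j+k\le2$; and $|\partial_S^j\partial_\rho^kP(S,\rho)|\le C_J\rho^{\gamma_0-k}$ for $j+k=3$, $0<\rho\le1$, $S\in J$. Hypothesis $(\mathrm E_s)$. $(\rho_0(r),S_0(r),0)$, $r=|x|$, is a compactly supported radial equilibrium of the Euler–Poisson system: $\operatorname{supp}\rho_0=\overline{B_R}$,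 $B_R=\{x\in\mathbb R^3:|x|<R\}$, $\nabla P(S_0,\rho_0)+\rho_0\nabla V_{\rho_0}=0$ in $B_R$, with mass $M=4\pi\int_0^Rr^2\rho_0\,dr>0$; $\rho_0\in C^2([0,R))\cap C^1([0,R])$, $\rho_0(0)>0$, $\rho_0'<0$ on $(0,R)$, $\rho_0(R)=0$. There is $f\in C^1([0,\rho_0(0)])\cap C^2((0,\rho_0(0)))$ with $S_0=f(\rho_0)$; with $\widetilde P(\rho)=P(f(\rho),\rho)$ one has $\widetilde P'(\rho_0)=P_\rho(S_0,\rho_0)+P_S(S_0,\rho_0)f'(\rho_0)>0$. The Schwarzschild coefficient $\mathfrak G(r)=-P_S(S_0,\rho_0)f'(\rho_0)/\rho_0$ satisfies $\mathfrak G>0$ for a.e. $0<r<R$, $\mathfrak G^{-1}\in L^1_{\rm loc}(B_R)$, $0<\mathfrak G(r)\le C\rho_0^{\gamma_0-1}(r)$ for $r$ near $R$, and $\lim_{\rho\downarrow0}\widetilde P'(\rho)/\rho^{\gamma_0-1}=\gamma_0K(f(0))>0$. (These imply $S_0$ is strictly increasing on $(0,R)$.) Notation. $w_1=\Psi''(\rho_0)=\widetilde P'(\rho_0)/\rho_0$, $w_2=\mathfrak G$, $a_0=\nabla\rho_0/\rho_0$. $L^2_w(B_R)$ has norm squared $\int_{B_R}w|h|^2dx$. $X_1=L^2_{w_1}(B_R)$, $X_2=L^2_{w_2}(B_R)$, $X=X_1\times X_2$. $Bq=(-\operatorname{div}q,-\operatorname{div}q+a_0\cdot q)$ in distributions on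 $B_R$, $D(B)=\{q\in L^2_{1/\rho_0}(B_R;\mathbb R^3):-\operatorname{div}q\in X_1,-\operatorname{div}q+a_0\cdot q\in X_2\}$; closures are in $X$. Superscript rad denotes spherically symmetric elements. $I_\eta(r)=4\pi\int_0^rs^2\eta(s)ds$ (here $s$ is the integration variable). Linearized entropy Casimirs. $J_0=S_0((0,R))$. $\mathscr G_0$ is the class of $g\in C^1(\mathbb R)$ such that $\operatorname{supp}(g'|_{J_0})\Subset J_0$ (constants included). For the Casimir $\mathcal C_g(\rho,S)=\int_{\mathbb R^3}\rho g(S)dx$, $$\delta\mathcal C_g[\eta,s]=\int_{B_R}[g(S_0)\eta+\rho_0g'(S_0)s]\,dx.$$ *)

(* Defs.v *)
From HB Require Import structures.
From mathcomp Require Import all_boot all_order all_algebra.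
From mathcomp Require Import all_classical all_reals all_analysis.
Set Implicit Arguments.
Unset Strict Implicit.
Unset Printing Implicit Defensive.
Import Order.TTheory GRing.Theory Num.Theory.
Import numFieldNormedType.Exports.
Local Open Scope classical_set_scope.
Local Open Scope ring_scope.

Section RelativeDerivatives.
Context {R : realType}.
Implicit Types (A : set R) (f : R -> R) (P : R -> R -> R).

(* Derivative relative to a set: two-sided at interior points of [A],
   one-sided at the endpoints of an interval. *)
Definition derivable_in A f (x : R) : Prop :=
  cvg ((fun y => (f y - f x) / (y - x)) @ within A x^').

Definition derive_in A f (x : R) : R :=
  lim ((fun y => (f y - f x) / (y - x)) @ within A x^').

Fixpoint Cn_in (n : nat) A f : Prop :=
  {within A, continuous f} /\
  if n is n'.+1 then
    (forall x, A x -> derivable_in A f x) /\ Cn_in n' A (derive_in A f)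
  else True.

(* Functions P(S, rho) live on rho >= 0: the partial derivative in rho is
   one-sided at rho = 0; the one in S is taken relative to [A]. *)
Definition partialS A P (S rho : R) : R := derive_in A (P ^~ rho) S.
Definition partialrho P (S rho : R) : R := derive_in `[0, +oo[ (P S) rho.

(* C^n on (whole line) x A, for [A] a subset of `[0, +oo[. *)
Fixpoint Cn_in2 (n : nat) A P : Prop :=
  {within [set: R] `*` A, continuous (fun p : R * R => P p.1 p.2)} /\
  if n is n'.+1 then
    [/\ forall S rho : R, A rho -> derivable_in setT (P ^~ rho) S,
        forall S rho : R, A rho -> derivable_in `[0, +oo[ (P S) rho,
        Cn_in2 n' A (partialS setT P)
      & Cn_in2 n' A (partialrho P)]
  else True.

End RelativeDerivatives.

Section Space.
Context {R : realType}.

(* The library norm of a product is the sup norm, hence [dot] and [enorm]. *)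
Local Notation R3 := (R * R * R)%type.

Definition mu3 :=
  ((@lebesgue_measure R \x @lebesgue_measure R) \x @lebesgue_measure R)%E.

Definition dot (x y : R3) : R :=
  x.1.1 * y.1.1 + x.1.2 * y.1.2 + x.2 * y.2.
Definition enorm (x : R3) : R := Num.sqrt (dot x x).
Definition eball (r : R) : set R3 := [set x | enorm x < r].

Definition e3 (i : 'I_3) : R3 :=
  ((i == 0 :> nat)%:R, (i == 1%N :> nat)%:R, (i == 2%N :> nat)%:R).

Definition partial (i : 'I_3) (u : R3 -> R) (x : R3) : R :=
  'D_(e3 i) u x.
Definition has_grad (u : R3 -> R) (x : R3) : Prop :=
  forall i, derivable u x (e3 i).
Definition grad (u : R3 -> R) (x : R3) : R3 :=
  (partial 0 u x, partial 1 u x, partial 2 u x).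

Definition smooth (phi : R3 -> R) : Prop :=
  forall l : seq 'I_3,
    continuous (foldr partial phi l) /\
    forall x, has_grad (foldr partial phi l) x.

Definition test_fun (U : set R3) (phi : R3 -> R) : Prop :=
  [/\ smooth phi, compact (closure [set x | phi x != 0])
    & closure [set x | phi x != 0] `<=` U].

Definition L1loc (U : set R3) (h : R3 -> R) : Prop :=
  forall K, compact K -> K `<=` U -> mu3.-integrable K (EFin \o h).

Definition normsq d (T : measurableType d) (mu : set T -> \bar R)
    (U : set T) (w h : T -> R) : \bar R :=
  \int[mu]_(x in U) (w x * h x ^+ 2)%:E.

Definition L2 d (T : measurableType d) (mu : set T -> \bar R)
    (U : set T) (w h : T -> R) : Prop :=
  measurable_fun U h /\ (normsq mu U w h < +oo)%E.

Definition L2vec d (T : measurableType d) (mu : set T -> \bar R)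
    (U : set T) (w : T -> R) (q : T -> R3) : Prop :=
  [/\ measurable_fun U (fun x => (q x).1.1),
      measurable_fun U (fun x => (q x).1.2),
      measurable_fun U (fun x => (q x).2)
    & (\int[mu]_(x in U) (w x * dot (q x) (q x))%:E < +oo)%E].

Definition newton (h : R3 -> R) (x : R3) : R :=
  (4 * pi)^-1 * \int[mu3]_(y in setT) (h y / enorm (x - y)).

Definition potential (h : R3 -> R) (x : R3) : R :=
  - (4 * pi) * newton h x.

End Space.

Section PressureLaw.
Context {R : realType}.

(* [K] is the coefficient attached to the compact interval [a, b]. *)
Definition leading_coeff (P : R -> R -> R) (gamma0 alpha0 a b : R)
    (K : R -> R) : Prop :=
  [/\ Cn_in 2 `[a, b] K, 0 < inf (K @` `[a, b]) &
    forall j k : nat, (j + k <= 2)%N ->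
      exists C delta : R, 0 < delta /\
        forall S rho : R, a <= S <= b -> 0 < rho < delta ->
        `| iter j (partialS `[a, b])
             (iter k partialrho (fun S rho => P S rho - K S * rho `^ gamma0))
             S rho |
        <= C * rho `^ (gamma0 - k%:R + alpha0)].

Record pressure_law (P : R -> R -> R) (gamma0 alpha0 : R) : Prop := {
  pl_C3 : Cn_in2 3 `]0, +oo[ P;
  pl_C1 : Cn_in2 1 `[0, +oo[ P;
  pl_vacuum : forall S : R, P S 0 = 0;
  pl_rho_pos : forall S rho : R, 0 < rho -> 0 < partialrho P S rho;
  pl_S_pos : forall S rho : R, 0 < rho -> 0 < partialS setT P S rho;
  pl_gamma0 : 6 / 5 < gamma0 < 2;
  pl_alpha0 : 0 < alpha0;
  pl_leading : forall a b : R, a < b ->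
    exists K, leading_coeff P gamma0 alpha0 a b K;
  pl_third : forall a b : R, a < b -> exists C : R,
    forall j k : nat, (j + k = 3)%N -> forall S rho : R, a <= S <= b ->
    0 < rho <= 1 ->
    `| iter j (partialS setT) (iter k partialrho P) S rho |
    <= C * rho `^ (gamma0 - k%:R)
}.

End PressureLaw.

Section Equilibrium.
Context {R : realType}.
Local Notation R3 := (R * R * R)%type.
Variables (P : R -> R -> R) (gamma0 alpha0 : R).
(* Radial functions are given by their profiles on [0, Rs). *)
Variables (rho0 S0 f : R -> R) (Rs : R).

Definition df (rho : R) : R := derive_in `[0, rho0 0] f rho.
Definition drho0 (r : R) : R := derive_in `[0, Rs] rho0 r.
Definition Ptilde (rho : R) : R := P (f rho) rho.
Definition dPtilde (rho : R) : R := derive_in `[0, rho0 0] Ptilde rho.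

Definition schwarzschild (r : R) : R :=
  - partialS setT P (S0 r) (rho0 r) * df (rho0 r) / rho0 r.

Record equilibrium : Prop := {
  eq_Rs : 0 < Rs;
  eq_supp : closure [set x : R3 | rho0 (enorm x) != 0]
            = closure (eball Rs);
  eq_balance : forall x : R3, eball Rs x ->
    let p y := P (S0 (enorm y)) (rho0 (enorm y)) in
    let V := potential (fun y => rho0 (enorm y)) in
    [/\ has_grad p x, has_grad V x
      & grad p x + rho0 (enorm x) *: grad V x = 0];
  eq_mass : 0 < 4 * pi * \int[lebesgue_measure]_(r in `[0, Rs])
                           (r ^+ 2 * rho0 r);
  eq_rho0_C2 : Cn_in 2 `[0, Rs[ rho0;
  eq_rho0_C1 : Cn_in 1 `[0, Rs] rho0;
  eq_rho0_center : 0 < rho0 0;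
  eq_rho0_decr : forall r : R, 0 < r < Rs -> drho0 r < 0;
  eq_rho0_boundary : rho0 Rs = 0;
  eq_f_C1 : Cn_in 1 `[0, rho0 0] f;
  eq_f_C2 : Cn_in 2 `]0, rho0 0[ f;
  eq_S0 : forall r : R, 0 <= r < Rs -> S0 r = f (rho0 r);
  eq_dPtilde : forall r : R, 0 <= r < Rs ->
    dPtilde (rho0 r) = partialrho P (S0 r) (rho0 r)
                       + partialS setT P (S0 r) (rho0 r) * df (rho0 r)
    /\ 0 < dPtilde (rho0 r);
  eq_schw_pos : {ae lebesgue_measure,
    forall r : R, 0 < r < Rs -> 0 < schwarzschild r};
  eq_schw_inv : L1loc (eball Rs) (fun x => (schwarzschild (enorm x))^-1);
  eq_schw_bound : exists C : R, \forall r \near Rs^'-,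
    0 < schwarzschild r <= C * rho0 r `^ (gamma0 - 1);
  eq_dPtilde_vacuum : forall (a b : R) (K : R -> R), a < b -> a <= f 0 <= b ->
    leading_coeff P gamma0 alpha0 a b K ->
    0 < gamma0 * K (f 0) /\
    dPtilde rho / rho `^ (gamma0 - 1) @[rho --> 0^'+] --> gamma0 * K (f 0)
}.

Definition w1 (x : R3) : R := dPtilde (rho0 (enorm x)) / rho0 (enorm x).
Definition w2 (x : R3) : R := schwarzschild (enorm x).

Definition a0 (x : R3) : R3 :=
  (rho0 (enorm x))^-1 *: grad (fun y => rho0 (enorm y)) x.

Definition in_X (h1 h2 : R3 -> R) : Prop :=
  L2 mu3 (eball Rs) w1 h1 /\ L2 mu3 (eball Rs) w2 h2.

Definition normsqX (h1 h2 : R3 -> R) : \bar R :=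
  (normsq mu3 (eball Rs) w1 h1 + normsq mu3 (eball Rs) w2 h2)%E.

(* The distributions - div q and - div q + a0 . q, paired with phi. *)
Definition B1 (q : R3 -> R3) (phi : R3 -> R) : R :=
  \int[mu3]_(x in eball Rs) dot (q x) (grad phi x).
Definition B2 (q : R3 -> R3) (phi : R3 -> R) : R :=
  B1 q phi + \int[mu3]_(x in eball Rs) (dot (a0 x) (q x) * phi x).

Definition represents (h : R3 -> R)
    (T : (R3 -> R) -> R) : Prop :=
  L1loc (eball Rs) h /\
  forall phi, test_fun (eball Rs) phi ->
    T phi = \int[mu3]_(x in eball Rs) (h x * phi x).

(* q is in D(B) and B q = (h1, h2) *)
Definition B_graph (q : R3 -> R3) (h1 h2 : R3 -> R) :
    Prop :=
  [/\ L2vec mu3 (eball Rs) (fun x => (rho0 (enorm x))^-1) q, in_X h1 h2,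
      represents h1 (B1 q) & represents h2 (B2 q)].

Definition in_closure_RanB (h1 h2 : R3 -> R) : Prop :=
  in_X h1 h2 /\
  forall eps : R, 0 < eps -> exists q k1 k2, B_graph q k1 k2 /\
    (normsqX (fun x => (h1 x - k1 x)%R) (fun x => (h2 x - k2 x)%R)
     < (eps ^+ 2)%:E)%E.

Definition enclosed (eta : R -> R) (r : R) : R :=
  4 * pi * \int[lebesgue_measure]_(t in `[0, r]) (t ^+ 2 * eta t).

(* The second X-component attached to a perturbation (eta, s); df vanishes
   only on a null set of radii. *)
Definition omega2 (eta s : R -> R) (r : R) : R := eta r - s r / df (rho0 r).

Definition J0 : set R := S0 @` `]0, Rs[.

Definition casimir_class (g : R -> R) : Prop :=
  [/\ forall t, derivable g t 1, continuous (derive1 g),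
      compact (closure [set t | J0 t /\ derive1 g t != 0])
    & closure [set t | J0 t /\ derive1 g t != 0] `<=` J0].

Definition dcasimir (g eta s : R -> R) : R :=
  \int[mu3]_(x in eball Rs)
    (g (S0 (enorm x)) * eta (enorm x)
     + rho0 (enorm x) * derive1 g (S0 (enorm x)) * s (enorm x)).

End Equilibrium.

(* Main.v *)
Require Import Defs.
From HB Require Import structures.
From mathcomp Require Import all_boot all_order all_algebra.
From mathcomp Require Import all_classical all_reals all_analysis.
From mathcomp Require Import measurable_realfun.
From mathcomp Require Import ring lra.

(** For a radial pair (eta, s) write om = eta - s/f'(rho0) for its second
    component in X, N(r) for the integral of t^2 eta over [0,r], and H(r) for the
    integral of a function on space over the ball of radius r.  As
    I_eta = 4 pi N and f'(rho0) < 0 almost everywhere, the formula for s reads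
    om = eta - rho0'/(rho0 r^2) N, and the condition at the boundary N(Rs) = 0.

    From the closure of the range to the formula.  Let B q = (k1, k2), and let H
    be the mass of k1.  Radial test functions only see q.x, and the divergence
    theorem reads: the integral of q.x over the shell a < |x| < b is minus that
    of t H(t) over [a,b] ([flux]).  Subtracting the two equations, the integral
    of k2 - k1 over the shell is that of a0.q, hence minus that of rho0'/rho0 H
    over [a,b] ([jump_identity], [flux_weighted]).  Moreover H(Rs) = 0
    ([mass_zero]): q is square integrable with weight 1/rho0 and rho0 vanishes
    linearly at the boundary, so no mass can flow out.  Convergence in X implies
    L1 convergence of the first component on the ball and of the second on
    smaller balls, so these identities pass to the closure; for a radial pair
    they hold on every shell, and therefore pointwise almost everywhere.

    From the formula to the closure.  The field -N(r) x/r^3 has divergence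
    -eta and solves B q = (eta, om) formally, but need not lie in the domain.
    It is replaced by -trunc_n(N(r)) x/r^3, where trunc_n is a smooth
    approximation of the identity that vanishes near 0.  Since N vanishes at 0 and
    at Rs, this field has compact support in the punctured ball, and by the chain
    rule its image has first component trunc_n'(N) eta, with no term coming from
    a cutoff.  It converges to eta off the set N = 0, and on that set eta
    vanishes almost everywhere ([primitive_zero_ae]).  Domination is immediate in
    X1, and in X2 it follows from w2 <= C w1 ([schwarzschild_le_w1]).

    Casimirs.  The function g(S0) is constant near the boundary, and the layer
    formula [integral_layer] (integration by parts in the radius) turns the
    linearized Casimir into a positive multiple of g(S0(b)) N(Rs) plus the
    integral over [a,b] of g'(S0) times a defect which vanishes exactly when the
    formula for s holds ([dcasimirE]).  The constant g gives N(Rs) = 0; and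
    because S0 is strictly increasing, bumps for g' give the integral of the
    defect over every interval.

    The integrals over shells and balls are reduced to the line by polar
    coordinates ([polar_coordinates]), and the fluxes are computed with
    smooth functions of |x|^2 as test functions ([radial_test_fun]). *)

Set Implicit Arguments.
Unset Strict Implicit.
Unset Printing Implicit Defensive.
Import Order.TTheory GRing.Theory Num.Theory.
Import numFieldNormedType.Exports.
Local Open Scope classical_set_scope.
Local Open Scope ring_scope.

(** * Lebesgue measure, norm and balls in space *)
Lemma sigma_finite_product d1 d2 (T1 : measurableType d1)
    (T2 : measurableType d2) (R : realType)
    (m1 : {sigma_finite_measure set T1 -> \bar R})
    (m2 : {sigma_finite_measure set T2 -> \bar R}) :
  sigma_finite setT (m1 \x m2)%E.
Proof.
have /sigma_finiteP[A [TA ndA Aoo]] := sigma_finiteT m1.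
have /sigma_finiteP[B [TB ndB Boo]] := sigma_finiteT m2.
exists (fun n => A n `*` B n) => [|n].
  apply/esym; rewrite -subTset => -[x y] _.
  have [i _ Aix] : (\bigcup_i A i) x by rewrite -TA.
  have [j _ Bjy] : (\bigcup_j B j) y by rewrite -TB.
  exists (maxn i j) => //; split => /=.
    exact: (subsetPset _ _ (ndA _ _ (leq_maxl i j))).
  exact: (subsetPset _ _ (ndB _ _ (leq_maxr i j))).
have [mA Ay] := Aoo n; have [mB By] := Boo n; split; first exact: measurableX.
by rewrite product_measure1E// lte_mul_pinfty// ge0_fin_numE.
Qed.

(** Naming the planar factor makes room for a sigma-finite structure on it, from
    which [mu3] inherits its own. *)
Definition mu2 (R : realType) :=
  (@lebesgue_measure R \x @lebesgue_measure R)%E.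
HB.instance Definition _ (R : realType) :=
  Measure.copy (@mu2 R) (@lebesgue_measure R \x @lebesgue_measure R)%E.
HB.instance Definition _ (R : realType) :=
  @Measure_isSigmaFinite.Build _ _ _ (@mu2 R)
    (sigma_finite_product (@lebesgue_measure R) (@lebesgue_measure R)).
HB.instance Definition _ (R : realType) :=
  Measure.copy (@mu3 R) (@mu2 R \x @lebesgue_measure R)%E.
HB.instance Definition _ (R : realType) :=
  @Measure_isSigmaFinite.Build _ _ _ (@mu3 R)
    (sigma_finite_product (@mu2 R) (@lebesgue_measure R)).

Section SpaceMeasurability.
Context {R : realType}.
Local Notation R3 := (R * R * R)%type.
Local Notation mu := (@lebesgue_measure R).

(** An open set is the countable union of the cubes with rational centre and
    radius 1/(n+1) that it contains; cubes are measurable for the product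
    sigma-algebra. *)
Lemma open_measurable3 (U : set R3) : open U -> measurable U.
Proof.
move=> oU.
pose box (c : rat * rat * rat * nat) : set R3 :=
  ball (ratr c.1.1.1 : R) (c.2.+1%:R^-1) `*` ball (ratr c.1.1.2 : R) (c.2.+1%:R^-1)
  `*` ball (ratr c.1.2 : R) (c.2.+1%:R^-1).
pose F c := if pselect (box c `<=` U) then box c else set0.
have -> : U = \bigcup_c F c.
  apply/seteqP; split => [[[x y] z] Ux|x [c _]]; last first.
    by rewrite /F; case: pselect => // bU /bU.
  have [e /= e0 exU] : exists2 e : R, 0 < e & ball ((x, y), z) e `<=` U.
    by have /nbhs_ballP[e e0 eU] := open_nbhs_nbhs (conj oU Ux); exists e.
  have [n nlt] : exists n : nat, n.+1%:R^-1 < e / 2.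
    have e20 : 0 < e / 2 by rewrite divr_gt0.
    exists (Num.truncn (e / 2)^-1).
    by rewrite invf_plt ?posrE// truncnS_gt.
  have rd (w : R) : exists p : rat, ball (ratr p : R) n.+1%:R^-1 w.
    have [] := @dense_rat R (ball w n.+1%:R^-1).
    - by exists w; exact: ballxx.
    - exact: ball_open.
    - by move=> p [wp [r _ rp]]; exists r; rewrite rp; exact: ball_sym.
  have [p px] := rd x; have [q qy] := rd y; have [r rz] := rd z.
  have bU : box (p, q, r, n) `<=` U; last first.
    by exists (p, q, r, n) => //; rewrite /F; case: pselect.
  move=> [[x' y'] z'] [[/= px' qy'] rz']; apply: exU.
  have tri (w w' v : R) : ball w n.+1%:R^-1 v -> ball w n.+1%:R^-1 w' -> ball v e w'.
    move=> wv ww'; apply: (@le_ball _ _ _ (n.+1%:R^-1 + n.+1%:R^-1)).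
      by rewrite ltW// [ltRHS](splitr e) ltrD.
    by apply: ball_triangle ww'; exact: ball_sym.
  by split; [split|]; [exact: tri px px'|exact: tri qy qy'|exact: tri rz rz'].
have mb (w e : R) : measurable (ball w e) by apply: open_measurable; exact: ball_open.
apply: countable_bigcupT_measurable => // c; rewrite /F.
case: pselect => [bU|nbU]; rewrite //=; apply: measurableX; last exact: mb.
by apply: measurableX; exact: mb.
Qed.

Lemma continuous_measurable3 (u : R3 -> R) :
  continuous u -> measurable_fun setT u.
Proof.
move=> cu; apply: (measurability _ (RGenOpens.measurableE R)).
move=> _ [_ [a [b ->] <-]]; rewrite setTI; apply: open_measurable3.
by apply: open_comp => [x _|]; [exact: cu|exact: interval_open].
Qed.

Lemma continuous_X1 : continuous (fun x : R3 => x.1.1).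
Proof. by move=> x; apply: continuous_comp; exact: cvg_fst. Qed.

Lemma continuous_X2 : continuous (fun x : R3 => x.1.2).
Proof. by move=> x; apply: continuous_comp; [exact: cvg_fst|exact: cvg_snd]. Qed.

Lemma continuous_X3 : continuous (fun x : R3 => x.2).
Proof. by move=> x; exact: cvg_snd. Qed.

Lemma continuous_sqnorm : continuous (fun x : R3 => dot x x).
Proof.
move=> x; apply: cvgD; first apply: cvgD.
- by apply: cvgM; exact: continuous_X1.
- by apply: cvgM; exact: continuous_X2.
- by apply: cvgM; exact: continuous_X3.
Qed.

Lemma continuous_enorm : continuous (@enorm R).
Proof.
move=> x; apply: (@continuous_comp _ _ _ (fun x => dot x x) Num.sqrt).
  exact: continuous_sqnorm.
exact: sqrt_continuous.
Qed.

Lemma measurable_enorm : measurable_fun setT (@enorm R).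
Proof. exact: continuous_measurable3 continuous_enorm. Qed.

Lemma dot_ge0 (x : R3) : 0 <= dot x x.
Proof. by rewrite /dot -!expr2 !addr_ge0 ?sqr_ge0. Qed.

Lemma enorm_ge0 (x : R3) : 0 <= enorm x.
Proof. exact: sqrtr_ge0. Qed.

Lemma enorm_sqr (x : R3) : enorm x ^+ 2 = dot x x.
Proof. by rewrite sqr_sqrtr// dot_ge0. Qed.

Lemma enormZ (a : R) (x : R3) : 0 <= a -> enorm (a *: x) = a * enorm x.
Proof.
move=> a0; have dotZ : dot (a *: x) (a *: x) = a ^+ 2 * dot x x.
  rewrite /dot /GRing.scale/= /GRing.scale/=; ring.
by rewrite /enorm dotZ sqrtrM ?sqr_ge0// sqrtr_sqr ger0_norm.
Qed.
End SpaceMeasurability.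

Section Balls.
Context {R : realType}.
Local Notation R3 := (R * R * R)%type.
Local Notation mu := (@lebesgue_measure R).

Lemma normr_coord_le (x : R3) :
  [/\ `|x.1.1| <= enorm x, `|x.1.2| <= enorm x & `|x.2| <= enorm x].
Proof.
have le_sqrt (a b : R) : 0 <= b -> a ^+ 2 <= b -> `|a| <= Num.sqrt b.
  by move=> b0 ab; rewrite -(sqrtr_sqr a) ler_wsqrtr.
split; apply: le_sqrt; rewrite ?dot_ge0// /dot -!expr2;
  have := sqr_ge0 x.1.1; have := sqr_ge0 x.1.2; have := sqr_ge0 x.2; lra.
Qed.

Lemma closed_cball (r : R) : closed [set x : R3 | enorm x <= r].
Proof.
apply: (@closed_comp _ _ (@enorm R) [set t | t <= r]); last exact: closed_le.
by move=> x _; exact: continuous_enorm.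
Qed.

Lemma compact_cball (r : R) : compact [set x : R3 | enorm x <= r].
Proof.
apply: (@subclosed_compact _ _ ((`[-r, r] `*` `[-r, r]) `*` `[-r, r])%classic).
- exact: closed_cball.
- apply: compact_setX; last exact: segment_compact.
  by apply: compact_setX; exact: segment_compact.
- move=> x /= xr; have [x1 x2 x3] := normr_coord_le x.
  by rewrite !in_itv/= -!ler_norml !(le_trans _ xr).
Qed.

Lemma measurable_cball (r : R) : measurable [set x : R3 | enorm x <= r].
Proof.
rewrite -[X in measurable X]setTI.
have -> : [set x : R3 | enorm x <= r] = @enorm R @^-1` `]-oo, r].
  by apply/seteqP; split => x /=; rewrite in_itv.
exact: measurable_enorm.
Qed.

Lemma measurable_eball (r : R) : measurable (@eball R r).
Proof.
rewrite -[X in measurable X]setTI.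
have -> : @eball R r = @enorm R @^-1` `]-oo, r[.
  by apply/seteqP; split => x /=; rewrite in_itv.
exact: measurable_enorm.
Qed.

Lemma mu3_box (a b c d e f : R) :
  mu3 ((`[a, b] `*` `[c, d]) `*` `[e, f])%classic =
  (mu `[a, b]%classic * mu `[c, d]%classic * mu `[e, f]%classic)%E.
Proof.
have box2 : mu2 (`[a, b] `*` `[c, d])%classic =
    (mu `[a, b]%classic * mu `[c, d]%classic)%E by exact: product_measure1E.
rewrite -box2; apply: (product_measure1E (@mu2 R) mu) => //.
exact: measurableX.
Qed.

Lemma mu3_cball_fin (r : R) : (mu3 [set x : R3 | (enorm x <= r)%R] < +oo)%E.
Proof.
apply: (@le_lt_trans _ _ (mu3 ((`[-r, r] `*` `[-r, r]) `*` `[-r, r])%classic)).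
  apply: le_measure; rewrite ?inE.
  - exact: measurable_cball.
  - by apply: measurableX => //; exact: measurableX.
  - move=> x /= xr; have [x1 x2 x3] := normr_coord_le x.
    by rewrite !in_itv/= -!ler_norml !(le_trans _ xr).
rewrite mu3_box !lebesgue_measure_itv/=; case: ifPn => _; last by rewrite !mul0e.
by rewrite -!EFinD -!EFinM ltry.
Qed.

Lemma mu3_eball_fin (r : R) : (mu3 (@eball R r) < +oo)%E.
Proof.
apply: le_lt_trans (mu3_cball_fin r); apply: le_measure; rewrite ?inE.
- exact: measurable_eball.
- exact: measurable_cball.
- by move=> x /ltW.
Qed.
End Balls.

(** * Scaling and polar coordinates *)
Section Scaling.
Context {R : realType}.
Local Notation R3 := (R * R * R)%type.
Local Notation mu := (@lebesgue_measure R).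

(** Uniqueness of Lebesgue measure: the dilated measure, multiplied by a, has the
    same values on intervals. *)
Lemma integral_scale1 (a : R) (F : R -> \bar R) : 0 < a ->
  measurable_fun setT F -> (forall x, 0 <= F x)%E ->
  (\int[mu]_x F (a * x)%R = (a^-1)%:E * \int[mu]_x F x)%E.
Proof.
move=> a0 mF F0.
pose phi (x : measurableTypeR R) : measurableTypeR R := (a * x)%R.
have mphi : measurable_fun setT phi by exact: mulrl_measurable.
have muE A : measurable A ->
    mu A = mscale (NngNum (ltW a0)) (pushforward mu phi) A.
  move=> mA; apply: lebesgue_measure_unique mA => _ [[b c] _ <-].
  have preE : phi @^-1` `]b, c]%classic = `](b / a), (c / a)]%classic.
    by apply/seteqP; split => x /=; rewrite !in_itv/= /phi;
      rewrite ltr_pdivrMr// ler_pdivlMr// ![x * a]mulrC.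
  transitivity (a%:E * mu `](b / a)%R, (c / a)%R]%classic)%E; last by rewrite -preE.
  rewrite !lebesgue_measure_itv/= !lte_fin ltr_pM2r ?invr_gt0//.
  case: ifPn => _; last by rewrite mule0.
  by rewrite -!EFinD -EFinM; congr EFin; field; rewrite gt_eqF.
have E1 : (\int[mu]_x F (a * x)%R = \int[pushforward mu phi]_x F x)%E.
  by rewrite ge0_integral_pushforward.
have E2 : (\int[mu]_x F x =
    \int[mscale (NngNum (ltW a0)) (pushforward mu phi)]_x F x)%E.
  by move=> mphi'; apply: eq_measure_integral => A mA _; exact: muE.
rewrite E1 (E2 mphi) ge0_integral_mscale// muleA -EFinM.
by rewrite mulVf ?mul1e// gt_eqF.
Qed.

(** By Tonelli, factors of scaling multiply over products; applied twice this
    passes from the line to space. *)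
Lemma integral_scale_product d1 d2 (T1 : measurableType d1)
    (T2 : measurableType d2) (m1 : {sigma_finite_measure set T1 -> \bar R})
    (m2 : {sigma_finite_measure set T2 -> \bar R})
    (phi1 : T1 -> T1) (phi2 : T2 -> T2) (c1 c2 : R) :
  0 <= c1 -> 0 <= c2 -> measurable_fun setT phi1 -> measurable_fun setT phi2 ->
  (forall F : T1 -> \bar R, measurable_fun setT F -> (forall x, 0 <= F x)%E ->
    \int[m1]_x F (phi1 x) = c1%:E * \int[m1]_x F x)%E ->
  (forall F : T2 -> \bar R, measurable_fun setT F -> (forall x, 0 <= F x)%E ->
    \int[m2]_x F (phi2 x) = c2%:E * \int[m2]_x F x)%E ->
  forall F : T1 * T2 -> \bar R, measurable_fun setT F -> (forall x, 0 <= F x)%E ->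
    (\int[m1 \x m2]_x F (phi1 x.1, phi2 x.2) =
     (c1 * c2)%:E * \int[m1 \x m2]_x F x)%E.
Proof.
move=> c10 c20 mphi1 mphi2 E1 E2 F mF F0.
have mphi : measurable_fun setT (fun x : T1 * T2 => (phi1 x.1, phi2 x.2)).
  by apply: measurable_fun_pair; apply: measurableT_comp.
have mpair x : measurable_fun setT (fun y : T2 => F (x, y)).
  by apply: measurableT_comp => //; exact: pair1_measurable.
rewrite (fubini_tonelli1 (m1 := m1) (m2 := m2) (fun x => F (phi1 x.1, phi2 x.2)))//; last first.
  exact: measurableT_comp mphi.
rewrite (fubini_tonelli1 (m1 := m1) (m2 := m2) F)// /fubini_F/=.
have mG : measurable_fun setT (fun x => \int[m2]_y F (x, y))%E.
  exact: (measurable_fun_fubini_tonelli_F (m2 := m2)).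
under eq_integral do rewrite (E2 (fun y => F (_, y)))//.
rewrite ge0_integralZl//; last 2 first.
- exact: (measurableT_comp mG mphi1).
- by move=> x _; apply: integral_ge0.
rewrite (E1 (fun x => \int[m2]_y F (x, y))%E)//.
  by rewrite muleA -EFinM mulrC.
by move=> x; apply: integral_ge0.
Qed.

Lemma integral_scale3 (a : R) (F : R3 -> \bar R) : 0 < a ->
  measurable_fun setT F -> (forall x, 0 <= F x)%E ->
  (\int[mu3]_x F (a *: x)%R = (a ^- 3)%:E * \int[mu3]_x F x)%E.
Proof.
move=> a0 mF F0.
have ai : 0 <= a^-1 by rewrite invr_ge0 ltW.
have mphi : measurable_fun setT (fun x : measurableTypeR R => (a * x)%R : measurableTypeR R).
  exact: mulrl_measurable.
have mphi2 : measurable_fun setT (fun x : measurableTypeR R * measurableTypeR R =>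
    (a * x.1, a * x.2) : measurableTypeR R * measurableTypeR R).
  by apply: measurable_fun_pair; apply: measurableT_comp.
have S1 := fun G => @integral_scale1 a G a0.
have S2 := integral_scale_product ai ai mphi mphi S1 S1.
have := integral_scale_product (m1 := @mu2 R) (mulr_ge0 ai ai) ai mphi2 mphi S2 S1 mF F0.
have -> : a^-1 * a^-1 * a^-1 = a ^- 3 by field; rewrite gt_eqF.
by move=> <-.
Qed.
End Scaling.

Section Polar.
Context {R : realType}.
Local Notation R3 := (R * R * R)%type.
Local Notation mu := (@lebesgue_measure R).

Lemma set0_box : [set (0 : R3)] = ((`[0, 0] `*` `[0, 0]) `*` `[0, 0])%classic.
Proof.
apply/seteqP; split => [x -> /=|[[a b] c] /=]; first by rewrite !in_itv/= !lexx.
by rewrite !in_itv/= => -[[/le_anti <- /le_anti <-] /le_anti <-].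
Qed.

Lemma measurable_set0 : measurable [set (0 : R3)].
Proof. by rewrite set0_box; apply: measurableX => //; exact: measurableX. Qed.

Lemma mu3_set0 : mu3 [set (0 : R3)] = 0%E.
Proof. by rewrite set0_box mu3_box !lebesgue_measure_itv/= ltxx !mule0. Qed.

Lemma measurable_scale (a : R) : measurable_fun setT (fun x : R3 => a *: x).
Proof.
have m1 : measurable_fun setT (fun x : R3 => x.1.1).
  exact: continuous_measurable3 continuous_X1.
have m2 : measurable_fun setT (fun x : R3 => x.1.2).
  exact: continuous_measurable3 continuous_X2.
by do 2?apply: measurable_fun_pair; apply: measurable_funM.
Qed.

Lemma enorm_eq0 (x : R3) : enorm x = 0 -> x = 0.
Proof.
move: x => [[a b] c] x0; have [/=] := normr_coord_le (a, b, c).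
rewrite x0 !normr_le0 => /eqP -> /eqP -> /eqP -> //.
Qed.

Lemma measurable_natb d (T : measurableType d) (D : set T) (b : T -> bool) :
  measurable_fun D b -> measurable_fun D (fun x => (b x)%:R : R).
Proof. exact: (@measurableT_comp _ _ _ _ _ _ (fun c : bool => c%:R : R)). Qed.

Lemma measurable_inv : measurable_fun setT (@GRing.inv R).
Proof.
have -> : @GRing.inv R = fun x => x * (x ^+ 2) `^ (-1).
  apply/funext => x; rewrite powR_inv1 ?sqr_ge0//.
  have [->|x0] := eqVneq x 0; first by rewrite invr0 mul0r.
  by field.
apply: measurable_funM => //.
by apply: (@measurableT_comp _ _ _ _ _ _ (@powR R ^~ (-1))); [exact: measurable_powR|exact: measurable_funX].
Qed.

Let shell (x : R3) : R := ((1 <= enorm x <= 2)%R)%:R.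

Let mE : measurable_fun setT (@enorm R) := measurable_enorm.

Let shell_meas : measurable_fun setT shell.
Proof.
apply: measurable_natb.
by apply: measurable_and; apply: measurable_fun_ler => //; exact: mE.
Qed.

Let shell_int := (\int[mu3]_x (shell x * enorm x ^- 4)%:E)%E.

Let shell_int_fin : (0 < shell_int < +oo)%E.
Proof.
have mI : measurable_fun setT (fun x => (shell x * enorm x ^- 4)%:E).
  apply/measurable_EFinP/measurable_funM; first exact: shell_meas.
  by apply: (measurableT_comp measurable_inv); exact: measurable_funX.
have I0 x : 0 <= shell x * enorm x ^- 4.
  by rewrite mulr_ge0// invr_ge0 exprn_ge0// enorm_ge0.
apply/andP; split; last first.
  apply: le_lt_trans (mu3_cball_fin (2 : R)).
  rewrite -[leRHS]mul1e -integral_cst; last exact: measurable_cball.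
  rewrite [leRHS]integral_mkcond; apply: ge0_le_integral => //.
  - by move=> x _; rewrite lee_fin.
  - apply/(measurable_restrictT _ _).1 => //; exact: measurable_cball.
  - move=> x _; rewrite patchE /shell mem_setE.
    case: (boolP (1 <= enorm x <= 2)) => [/andP[x1 x2]|_]; last first.
      by rewrite mul0r; case: ifP => _; rewrite lee_fin.
    rewrite ifT// lee_fin mul1r invf_le1 ?exprn_ege1// exprn_gt0//.
    exact: lt_le_trans x1.
pose Q : set R3 := ((`[3/4, 1] `*` `[3/4, 1]) `*` `[3/4, 1])%classic.
have mQ : measurable Q by apply: measurableX => //; exact: measurableX.
apply: (@lt_le_trans _ _ (\int[mu3]_(x in Q) (2 ^- 4 : R)%:E)%E).
  rewrite integral_cst// [X in (_ * X)%E](_ : _ = (4^-1 * 4^-1 * 4^-1)%:E); last first.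
    rewrite [LHS]mu3_box !lebesgue_measure_itv/= !lte_fin ifT; last by lra.
    by rewrite -EFinB -!EFinM; congr (_%:E); field.
  by rewrite -EFinM lte_fin !mulr_gt0// ?invr_gt0 ?exprn_gt0.
rewrite integral_mkcond; apply: ge0_le_integral => //.
- by move=> x _; rewrite patchE; case: ifP => // _; rewrite lee_fin invr_ge0.
- by apply/(measurable_restrictT _ _).1.
- move=> x _; rewrite patchE; case: ifP => [|_]; last by rewrite lee_fin.
  rewrite inE /Q/= !in_itv/= => -[[/andP[a1 a2] /andP[b1 b2]] /andP[c1 c2]].
  have x2 : 1 <= dot x x <= 4 by rewrite /dot; nra.
  have x1 : 1 <= enorm x <= 2.
    by have := enorm_sqr x; have := enorm_ge0 x; move: (enorm x) => e; nra.
  rewrite lee_fin /shell x1 mul1r lef_pV2 ?posrE ?exprn_gt0//; last first.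
    by case/andP : x1 => x1 _; exact: lt_le_trans x1.
  by case/andP : x1 => x11 x12; apply: lerXn2r => //; rewrite nnegrE ?enorm_ge0.
Qed.

(** Integrate F(|x|)/|x| over the pairs (x, t) with |x|/2 <= t <= |x|.
    Integrating in t first gives half of the integral of F(|x|).  Integrating in
    x first, the substitution x = t y separates t from y: the integral over the
    fixed shell 1 <= |y| <= 2 is that of F(t|y|)/|y| times t^2, and a second
    scaling t |y| -> t leaves twice the integral of |y|^-4 over that shell as the
    constant.  No surface measure is involved. *)
Lemma polar_coordinates : exists2 C : R, 0 < C &
  forall F : R -> \bar R, measurable_fun setT F -> (forall t, 0 <= F t)%E ->
  (\int[mu3]_x F (enorm x) =
   C%:E * \int[mu]_(t in `[0%R, +oo[) ((t ^+ 2)%:E * F t))%E.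
Proof.
have /andP[c0 coo] := shell_int_fin.
have cE : shell_int = (fine shell_int)%:E by rewrite fineK// ge0_fin_numE// ltW.
exists (2 * fine shell_int); first by rewrite mulr_gt0// fine_gt0// c0.
move=> F mF F0.
pose w (t : R) : R := (0 < t)%R%:R * t ^+ 2.
have w0 t : 0 <= w t by rewrite mulr_ge0// sqr_ge0.
have mw : measurable_fun setT w.
  apply: measurable_funM; last exact: measurable_funX.
  by apply: measurable_natb; exact: measurable_fun_ltr.
pose K (t : R) : \bar R := ((w t)%:E * F t)%E.
have K0 t : (0 <= K t)%E by rewrite mule_ge0// lee_fin.
have mK : measurable_fun setT K.
  by apply: emeasurable_funM => //; exact/measurable_EFinP.
have -> : (\int[mu]_(t in `[0%R, +oo[) ((t ^+ 2)%:E * F t) = \int[mu]_t K t)%E.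
  rewrite integral_mkcond; apply: eq_integral => t _; rewrite patchE /K /w.
  case: ifPn; rewrite ?inE ?notin_setE/= in_itv/= andbT.
    rewrite le_eqVlt => /predU1P[<-|->]; last by rewrite mul1r.
    by rewrite ltxx mul0r expr0n/= !mul0e.
  by move=> /negP; rewrite -ltNge => t0; rewrite ltNge ltW// mul0r mul0e.
pose in_shell (x : R3) (t : R) : R := (enorm x / 2 <= t <= enorm x)%R%:R.
pose H (p : R3 * R) : \bar R :=
  (F (enorm p.1) * ((enorm p.1)^-1 * in_shell p.1 p.2)%:E)%E.
have mN : measurable_fun setT (fun p : R3 * R => enorm p.1).
  exact: measurableT_comp mE measurable_fst.
have mS : measurable_fun setT (fun p : R3 * R => in_shell p.1 p.2).
  apply: measurable_natb; apply: measurable_and; apply: measurable_fun_ler => //.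
  exact: measurable_funM.
have mS1 x : measurable_fun setT (in_shell x).
  by apply: measurable_natb; apply: measurable_and; exact: measurable_fun_ler.
have mH : measurable_fun setT H.
  apply: emeasurable_funM; first exact: measurableT_comp mF mN.
  apply/measurable_EFinP/measurable_funM => //.
  exact: measurableT_comp measurable_inv mN.
have H0 p : (0 <= H p)%E.
  by rewrite mule_ge0// lee_fin mulr_ge0// invr_ge0 enorm_ge0.
have := fubini_tonelli (m1 := @mu3 R) (m2 := mu) H mH H0.
have -> : (\int[mu3]_x \int[mu]_t H (x, t) =
    2^-1%:E * \int[mu3]_x F (enorm x))%E.
  rewrite -ge0_integralZl//; last exact: measurableT_comp mF mE.
  apply: ae_eq_integral => //.
  - exact: (measurable_fun_fubini_tonelli_F (m2 := mu)).
  - by apply: emeasurable_funM => //; exact: measurableT_comp mF mE.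
  exists [set 0]; split; [exact: measurable_set0|exact: mu3_set0|].
  move=> x /= /not_implyP[_ +]; apply: contra_notP => x0.
  have {x0} x0 : 0 < enorm x.
    by rewrite lt_def enorm_ge0 andbT; apply/eqP => /enorm_eq0.
  rewrite /H/= ge0_integralZl//; last 2 first.
  - by apply/measurable_EFinP/measurable_funM => //; exact: mS1.
  - by move=> t _; rewrite lee_fin mulr_ge0// invr_ge0 ltW.
  rewrite muleC; congr (_ * _)%E.
  under eq_integral do rewrite EFinM.
  rewrite ge0_integralZl//; last 3 first.
  - by apply/measurable_EFinP; exact: mS1.
  - by move=> t _; rewrite lee_fin.
  - by rewrite lee_fin invr_ge0 ltW.
  have -> : (\int[mu]_t (in_shell x t)%:E = mu `[(enorm x / 2)%R, enorm x]%classic)%E.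
    rewrite -[RHS]mul1e -integral_cst// integral_mkcond; apply: eq_integral => t _.
    by rewrite patchE/= /in_shell mem_setE in_itv/=; case: ifP.
  rewrite lebesgue_measure_itv/= lte_fin ifT; last by lra.
  by rewrite -EFinB -EFinM; congr EFin; field; rewrite gt_eqF.
have -> : (\int[mu]_t \int[mu3]_x H (x, t) = shell_int * \int[mu]_t K t)%E.
  pose L (p : R3 * R) :=
    (((w p.2)%:E * F (p.2 * enorm p.1)%R) * ((enorm p.1)^-1 * shell p.1)%:E)%E.
  have L0 p : (0 <= L p)%E.
    by rewrite !mule_ge0// lee_fin// mulr_ge0// invr_ge0 enorm_ge0.
  have mL : measurable_fun setT L.
    apply: emeasurable_funM.
      apply: emeasurable_funM.
        by apply/measurable_EFinP; exact: measurableT_comp mw measurable_snd.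
      by apply: measurableT_comp mF _; exact: measurable_funM.
    apply/measurable_EFinP/measurable_funM.
      exact: measurableT_comp measurable_inv mN.
    exact: measurableT_comp shell_meas measurable_fst.
  transitivity (\int[mu]_t \int[mu3]_x L (x, t))%E.
    apply: eq_integral => t _.
    have [t0|t0] := leP t 0.
      rewrite !integral0_eq// => x _; rewrite /L /H/=.
        by rewrite /w ltNge t0 mul0r !mul0e.
      rewrite /in_shell; case: (eqVneq (enorm x) 0) => [->|x0].
        by rewrite invr0 mul0r mule0.
      rewrite lt_geF ?mulr0 ?mule0// (le_lt_trans t0)// divr_gt0//.
      by rewrite lt_def x0 enorm_ge0.
    have mHt : measurable_fun setT (fun x => H (x, t)).
      by apply: measurableT_comp mH _; exact: pair2_measurable.
    have := @integral_scale3 R t (fun x => H (x, t)) t0 mHt (fun x => H0 _).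
    move=> /(congr1 (fun z => (t ^+ 3)%:E * z)%E).
    rewrite muleA -EFinM mulfV ?mul1e; last by rewrite expf_neq0 ?gt_eqF.
    have mHts : measurable_fun setT (fun x : R3 => H (t *: x, t)).
      exact: (measurableT_comp mHt (measurable_scale t)).
    move=> <-; rewrite -ge0_integralZl//; last first.
    - by rewrite lee_fin exprn_ge0 ?ltW.
    apply: eq_integral => x _; rewrite /H /L/= enormZ; last exact: ltW.
    rewrite muleCA -EFinM [in RHS](muleC (w t)%:E) -muleA -EFinM; congr (_ * _%:E)%E.
    have -> : in_shell (t *: x) t = shell x.
      have eq_shell : (t * enorm x / 2 <= t <= t * enorm x) = (1 <= enorm x <= 2).
        by rewrite andbC ler_pMr// -mulrA ger_pMr// ler_pdivrMr// mul1r.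
      by rewrite /in_shell /shell enormZ; [rewrite eq_shell|exact: ltW].
    rewrite /w t0 mul1r invfM; move: (enorm x)^-1 => e.
    by field; rewrite gt_eqF.
  rewrite -(fubini_tonelli (m1 := @mu3 R) (m2 := mu) L mL L0).
  rewrite -ge0_integralZr//; last 3 first.
  - apply/measurable_EFinP/measurable_funM => //.
    apply: (measurableT_comp measurable_inv); exact: measurable_funX.
  - by move=> x _; rewrite lee_fin mulr_ge0// invr_ge0 exprn_ge0// enorm_ge0.
  - by apply: integral_ge0.
  apply: eq_integral => x _; rewrite /L/=.
  have [x1|x1] := boolP (1 <= enorm x <= 2); last first.
    rewrite /shell (negbTE x1) mul0r mul0e integral0_eq// => t _.
    by rewrite mulr0 mule0.
  have x0 : 0 < enorm x by case/andP : x1 => x1 _; exact: lt_le_trans x1.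
  transitivity (\int[mu]_t ((enorm x ^- 3 * shell x)%:E * K (enorm x * t)%R))%E.
    apply: eq_integral => t _; rewrite /K [X in F X]mulrC.
    rewrite muleAC -EFinM [RHS]muleA -EFinM; congr (_%:E * _)%E.
    rewrite /w pmulr_rgt0//; field; rewrite gt_eqF//.
  rewrite ge0_integralZl//; last 2 first.
  - by apply: (measurableT_comp mK); exact: mulrl_measurable.
  - by rewrite lee_fin mulr_ge0// invr_ge0 exprn_ge0// ltW.
  rewrite integral_scale1// muleA -EFinM; congr (_%:E * _)%E.
  by field; rewrite gt_eqF.
by rewrite cE => E; rewrite EFinM -muleA -E muleA -EFinM divff ?mul1e.
Qed.
End Polar.

Section RadialIntegrals.
Context {R : realType}.
Local Notation R3 := (R * R * R)%type.
Local Notation mu := (@lebesgue_measure R).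

(** The area of the unit sphere, known here as a positive factor only. *)
Definition sphere_const : R := s2val (cid2 (@polar_coordinates R)).

Lemma sphere_const_gt0 : 0 < sphere_const.
Proof. by rewrite /sphere_const; case: cid2. Qed.

Lemma polarE (F : R -> \bar R) :
  measurable_fun setT F -> (forall t, 0 <= F t)%E ->
  (\int[mu3]_x F (enorm x) =
   sphere_const%:E * \int[mu]_(t in `[0%R, +oo[) ((t ^+ 2)%:E * F t))%E.
Proof. by rewrite /sphere_const; case: cid2 => C /= C0 CP; exact: CP. Qed.

Lemma eball_itv (r : R) (x : R3) : eball r x <-> `[0, r[%classic (enorm x).
Proof. by rewrite /= in_itv/= enorm_ge0. Qed.

Lemma measurable_radial d (T : measurableType d) (r : R) (f : R -> T) :
  measurable_fun `[0, r[ f -> measurable_fun (@eball R r) (fun x => f (enorm x)).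
Proof.
move=> mf; apply: (@measurable_comp _ _ _ _ _ _ `[0, r[%classic) => //.
- by move=> _ [x xr <-]; exact/eball_itv.
- by apply: measurable_funTS; exact: measurable_enorm.
Qed.

Lemma restrict_radial (r : R) (F : R -> \bar R) :
  (F \o @enorm R) \_ (eball r) = (F \_ `[0, r[) \o @enorm R.
Proof.
apply/funext => x; rewrite /= !patchE.
have -> : (x \in @eball R r) = (enorm x \in `[0, r[%classic).
  by apply/idP/idP; rewrite !inE => /eball_itv.
by [].
Qed.

Lemma ge0_integral_radial (r : R) (F : R -> \bar R) :
  measurable_fun `[0, r[ F -> (forall t, (0 <= t < r)%R -> (0 <= F t)%E) ->
  (\int[mu3]_(x in eball r) F (enorm x) =
   sphere_const%:E * \int[mu]_(t in `[0%R, r[) ((t ^+ 2)%:E * F t))%E.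
Proof.
move=> mF F0; rewrite integral_mkcond restrict_radial polarE; last 2 first.
- exact/(measurable_restrictT _ _).1.
- move=> t; rewrite patchE; case: ifPn => //.
  by rewrite inE/= in_itv/=; exact: F0.
congr (_ * _)%E; rewrite integral_mkcond [RHS]integral_mkcond.
apply: eq_integral => t _; rewrite !patchE !mem_setE !in_itv/= andbT.
by case: (0 <= t); case: (t < r); rewrite /= ?mule0.
Qed.

Lemma measurable_sqr_fun (r : R) (f : R -> R) :
  measurable_fun `[0, r[ f -> measurable_fun `[0, r[ (fun t => t ^+ 2 * f t).
Proof. by move=> mf; apply: measurable_funM => //; exact: measurable_funX. Qed.

Lemma integrable_radial (r : R) (f : R -> R) : measurable_fun `[0, r[ f ->
  mu3.-integrable (eball r) (fun x => (f (enorm x))%:E) <->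
  mu.-integrable `[0, r[ (fun t => (t ^+ 2 * f t)%:E).
Proof.
move=> mf.
have mfe : measurable_fun `[0, r[ (fun t => `|(f t)%:E|%E).
  by apply: measurableT_comp => //; exact/measurable_EFinP.
have E : (\int[mu3]_(x in eball r) `|(f (enorm x))%:E| =
   sphere_const%:E * \int[mu]_(t in `[0%R, r[) `|(t ^+ 2 * f t)%:E|)%E.
  rewrite (ge0_integral_radial (F := fun t => `|(f t)%:E|%E))//.
  congr (_ * _)%E; apply: eq_integral => t _.
  by rewrite /= -EFinM normrM (ger0_norm (sqr_ge0 _)).
have k0 := sphere_const_gt0.
split=> /integrableP[_ fy]; apply/integrableP; split.
- by apply/measurable_EFinP; exact: measurable_sqr_fun.
- move: fy; rewrite E; have : (0 <= \int[mu]_(t in `[0%R, r[) `|(t ^+ 2 * f t)%:E|)%E.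
    exact: integral_ge0.
  by case: (\int[mu]_(t in _) _)%E => [a| |]// _; rewrite ?ltry// gt0_muley// lte_fin.
- by apply/measurable_EFinP; exact: measurable_radial.
- by rewrite E lte_mul_pinfty// lee_fin ltW.
Qed.

(** Polar coordinates for the positive and the negative part. *)
Lemma Rintegral_radial (r : R) (f : R -> R) : measurable_fun `[0, r[ f ->
  mu.-integrable `[0, r[ (fun t => (t ^+ 2 * f t)%:E) ->
  \int[mu3]_(x in eball r) f (enorm x) =
  sphere_const * \int[mu]_(t in `[0, r[) (t ^+ 2 * f t).
Proof.
move=> mf intf.
have mfe : measurable_fun `[0, r[ (EFin \o f) by exact/measurable_EFinP.
pose g (t : R) : \bar R := (t ^+ 2 * f t)%:E.
have Ep t : g^\+%E t = ((t ^+ 2)%:E * (EFin \o f)^\+%E t)%E.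
  by rewrite /g !funeposE EFinM maxe_pMr ?mule0 ?lee_fin ?sqr_ge0.
have En t : g^\-%E t = ((t ^+ 2)%:E * (EFin \o f)^\-%E t)%E.
  by rewrite /g !funenegE EFinM -muleN maxe_pMr ?mule0 ?lee_fin ?sqr_ge0.
have Ip : (\int[mu3]_(x in eball r) (EFin \o (f \o @enorm R))^\+%E x =
    sphere_const%:E * \int[mu]_(t in `[0%R, r[) g^\+%E t)%E.
  under [in RHS]eq_integral do rewrite Ep.
  rewrite (funepos_comp (EFin \o f) (@enorm R)).
  exact: (ge0_integral_radial (measurable_funepos mfe) (fun t _ => funepos_ge0 _ t)).
have In : (\int[mu3]_(x in eball r) (EFin \o (f \o @enorm R))^\-%E x =
    sphere_const%:E * \int[mu]_(t in `[0%R, r[) g^\-%E t)%E.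
  under [in RHS]eq_integral do rewrite En.
  rewrite (funeneg_comp (EFin \o f) (@enorm R)).
  exact: (ge0_integral_radial (measurable_funeneg mfe) (fun t _ => funeneg_ge0 _ t)).
rewrite /Rintegral -[sphere_const]/(fine sphere_const%:E) -fineM//; last first.
  exact: integrable_fin_num.
have ig : mu.-integrable `[0, r[ g := intf.
have -> : (\int[mu]_(t in `[0%R, r[) (t ^+ 2 * f t)%:E =
    \int[mu]_(t in `[0%R, r[) g^\+%E t - \int[mu]_(t in `[0%R, r[) g^\-%E t)%E.
  exact: integralE.
rewrite muleBr//; last first.
  by apply: fin_num_adde_defr; apply: integrable_fin_num => //; exact: integrable_funepos.
by congr fine; rewrite -Ip -In -integralE.
Qed.

(** The origin is excluded because the profile is constrained at positive radii
    only. *)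
Lemma ae_radial (r : R) (p : R -> Prop) :
  {ae mu, forall t, 0 < t < r -> p t} ->
  {ae mu3, forall x : R3, eball r x -> x != 0 -> p (enorm x)}.
Proof.
move=> [N [mN N0 pN]].
exists (@enorm R @^-1` N); split.
- by rewrite -[X in measurable X]setTI; exact: measurable_enorm.
- rewrite -[LHS]mul1e -integral_cst; last first.
    by rewrite -[X in measurable X]setTI; exact: measurable_enorm.
  rewrite integral_mkcond.
  have mF : measurable_fun setT ((fun=> 1%:E) \_ N : R -> \bar R).
    by apply/(measurable_restrictT _ _).1.
  have -> : ((cst 1%:E) \_ (@enorm R @^-1` N) = ((fun=> 1%:E) \_ N) \o @enorm R :> (R3 -> \bar R)).
    apply/funext => x; rewrite /= !patchE.
    have -> : (x \in @enorm R @^-1` N) = (enorm x \in N).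
      by apply/idP/idP; rewrite !inE.
    by [].
  rewrite (polarE mF); last by move=> t; rewrite patchE; case: ifP.
  rewrite (ae_eq_integral (cst 0%E)) ?integral0 ?mule0//.
    by apply: emeasurable_funM => //; [apply/measurable_EFinP/measurable_funX|exact: measurable_funTS].
  exists N; split => // t /= /not_implyP[_].
  rewrite patchE; case: ifPn; first by rewrite inE.
  by rewrite mule0.
- move=> x /= /not_implyP[xr /not_implyP[x0 px]]; apply: pN => /=.
  apply/not_implyP; split => //; rewrite xr andbT lt_def enorm_ge0 andbT.
  by apply/eqP => /enorm_eq0 /eqP; exact/negP.
Qed.
End RadialIntegrals.

(** * Flat functions and smooth functions on the line *)
Lemma near_gt {R : realType} (a x : R) : a < x -> \forall y \near x, a < y.
Proof. by move=> ax; apply: open_nbhs_nbhs; split; [exact: open_gt|]. Qed.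

Lemma near_lt {R : realType} (a x : R) : x < a -> \forall y \near x, y < a.
Proof. by move=> ax; apply: open_nbhs_nbhs; split; [exact: open_lt|]. Qed.

Section FlatFunction.
Context {R : realType}.
Implicit Types (p : {poly R}) (x : R).

(** The functions p(1/x) exp(-1/x), extended by zero.  As p ranges over all
    polynomials the family is stable under derivation, whence smoothness
    at 0. *)
Definition flat p x : R := if 0 < x then p.[x^-1] * expR (- x^-1) else 0.

Lemma flat_npos p x : x <= 0 -> flat p x = 0.
Proof. by rewrite /flat leNgt => /negbTE ->. Qed.

(** Exponential decay beats every polynomial: induction on the degree, spending
    half of the rate s on each step. *)
Lemma poly_expR_bound p (s : R) : 0 < s -> exists2 C : R, 0 <= C &
  forall u, 0 <= u -> `|p.[u]| * expR (- (s * u)) <= C.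
Proof.
elim/poly_ind: p s => [|p c IH] s s0.
  by exists 0 => // u _; rewrite horner0 normr0 mul0r.
have s20 : 0 < s / 2 by rewrite divr_gt0.
have [C C0 Cp] := IH _ s20.
exists (C * (s / 2)^-1 + `|c|); first by rewrite addr_ge0// mulr_ge0// invr_ge0 ltW.
move=> u u0; rewrite hornerMXaddC (le_trans (ler_wpM2r (expR_ge0 _) (ler_normD _ _)))//.
rewrite mulrDl lerD//; last first.
  by rewrite ler_piMr// expR_le1 oppr_le0 mulr_ge0// ltW.
have -> : - (s * u) = - (s / 2 * u) + - (s / 2 * u) by field.
rewrite expRD normrM (ger0_norm u0) mulrACA ler_pM ?mulr_ge0 ?expR_ge0 ?Cp//.
rewrite expRN ler_pdivrMr ?expR_gt0// ler_pdivlMl//.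
by apply: le_trans (expR_ge1Dx _); rewrite lerDr.
Qed.

Lemma is_derive0_quadratic (f : R -> R) (C : R) :
  (forall h, `|f h| <= C * h ^+ 2) -> is_derive (0 : R) (1 : R) f 0.
Proof.
move=> fC; have f0 : f 0 = 0.
  by apply/eqP; rewrite -normr_le0 (le_trans (fC 0))// expr0n mulr0.
have C0 : 0 <= C by have := fC 1; rewrite expr1n mulr1; exact: le_trans.
have cv : (fun h : R => h^-1 *: ((f \o shift 0) (h *: (1 : R)) - f 0)) @ 0^' --> (0 : R).
  apply/cvgrPdist_le => e e0; near=> h.
  rewrite /= f0 subr0 addr0 sub0r normrN [_%:A]mulr1 /GRing.scale/= normrM normfV.
  have h0 : h != 0 by near: h; exact: nbhs_dnbhs_neq.
  rewrite ler_pdivrMl ?normr_gt0// (le_trans (fC h))// -real_normK ?num_real//.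
  have hC : `|h| <= e / (C + 1).
    by near: h; apply: dnbhs0_le; rewrite divr_gt0// ltr_wpDl.
  rewrite expr2 mulrCA ler_wpM2l// (@le_trans _ _ ((C + 1) * `|h|))//.
    by rewrite ler_wpM2r// lerDl.
  by rewrite mulrC -ler_pdivlMr// ltr_wpDl.
by split; [apply/cvg_ex; exists 0|exact/cvg_lim].
Unshelve. all: by end_near. Qed.

(** At the origin a quadratic bound suffices, and it follows from the decay of
    the exponential against a polynomial. *)
Lemma is_derive_flat p x :
  is_derive x (1 : R) (flat p) (flat ('X ^+ 2 * (p - p^`())) x).
Proof.
have [x0|x0|->] := ltgtP x 0; last first.
- have [C C0 Cp] := poly_expR_bound ('X ^+ 2 * p) (ltr01).
  rewrite {2}/flat ltxx; apply: (@is_derive0_quadratic _ C) => h.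
  rewrite /flat; case: ifPn => [h0|_]; last by rewrite normr0 mulr_ge0// sqr_ge0.
  rewrite normrM (ger0_norm (expR_ge0 _)).
  have := Cp h^-1; rewrite invr_ge0 (ltW h0) mul1r => /(_ isT).
  rewrite hornerM hornerXn normrM (ger0_norm (exprn_ge0 _ _)) ?invr_ge0 ?(ltW h0)//.
  rewrite exprVn -mulrA ler_pdivrMl ?exprn_gt0//.
  by rewrite [C * _]mulrC.
- apply: (@near_eq_is_derive _ _ _ ((horner p \o GRing.inv) * (expR \o (-%R \o GRing.inv)))).
    near=> y; rewrite /flat ifT//=.
    by near: y; exact: near_gt.
  have dV : is_derive x (1 : R) GRing.inv (- x ^- 2).
    apply: is_derive_eq; first by apply: (@is_deriveV _ id); rewrite ?gt_eqF.
    by rewrite [_%:A]mulr1.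
  have dp : is_derive x (1 : R) (horner p \o GRing.inv) (p^`().[x^-1] * - x ^- 2).
    exact: is_derive1_comp.
  have de : is_derive x (1 : R) (expR \o (-%R \o GRing.inv))
      (expR (- x^-1) * (-1 * - x ^- 2)).
    apply: is_derive1_comp; apply: is_derive1_comp.
  apply: (is_derive_eq (is_deriveM dp de)).
  rewrite /flat x0 !hornerE /= /GRing.scale/= exprVn; ring.
- apply: (@near_eq_is_derive _ _ _ (cst 0)).
    near=> y; rewrite flat_npos//; apply: ltW.
    by near: y; exact: near_lt.
  by rewrite flat_npos ?ltW//; exact: is_derive_cst.
Unshelve. all: by end_near. Qed.

Lemma flat_ge0 x : 0 <= flat 1 x.
Proof. by rewrite /flat; case: ifP => // _; rewrite hornerC mul1r expR_ge0. Qed.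

Lemma flat_le1 x : flat 1 x <= 1.
Proof.
rewrite /flat; case: ifP => // x0; rewrite hornerC mul1r expR_le1 oppr_le0.
by rewrite invr_ge0 ltW.
Qed.

End FlatFunction.

Section SmoothLine.
Context {R : realType}.
Implicit Types f g : R -> R.

Fixpoint Ck (n : nat) f : Prop :=
  if n is m.+1 then exists2 g, (forall x, is_derive x (1 : R) f (g x)) & Ck m g
  else True.

Definition smooth1 f := forall n, Ck n f.

Lemma CkW n f : Ck n.+1 f -> Ck n f.
Proof.
elim: n f => // n IH f [g fg ng]; exists g => //; exact: IH.
Qed.

Lemma Ck_cst n (c : R) : Ck n (cst c).
Proof.
by elim: n c => // n IH c; exists (cst 0) => [x|]; [exact: is_derive_cst|exact: IH].
Qed.

Lemma CkD n f g : Ck n f -> Ck n g -> Ck n (f \+ g).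
Proof.
elim: n f g => // n IH f g [f' ff' nf] [g' gg' ng]; exists (f' \+ g') => //.
  by move=> x; exact: is_deriveD.
exact: IH.
Qed.

Lemma CkM n f g : Ck n f -> Ck n g -> Ck n (f \* g).
Proof.
elim: n f g => // n IH f g F G; have := G; have := F.
move=> [f' ff' nf] [g' gg' ng]; exists (f \* g' \+ g \* f').
  by move=> x; exact: is_deriveM.
by apply: CkD; apply: IH => //; exact: CkW.
Qed.

Lemma Ck_id n : Ck n id.
Proof.
by case: n => // n; exists (cst 1) => [x|]; [exact: is_derive_id|exact: Ck_cst].
Qed.

Lemma Ck_comp n f g : Ck n f -> Ck n g -> Ck n (f \o g).
Proof.
elim: n f g => // n IH f g [f' ff' nf] G; have [g' gg' ng] := G.
exists ((f' \o g) \* g') => [x|]; first exact: is_derive1_comp.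
by apply: CkM => //; apply: IH => //; exact: CkW.
Qed.

Lemma Ck_flat n p : Ck n (@flat R p).
Proof.
elim: n p => // n IH p; exists (flat ('X ^+ 2 * (p - p^`()))) => //.
by move=> x; exact: is_derive_flat.
Qed.

Lemma smooth1_derive f : smooth1 f ->
  (forall x, is_derive x (1 : R) f (derive1 f x)) /\ smooth1 (derive1 f).
Proof.
move=> sf; have [f1 ff1 _] := sf 1%N; split.
  by move=> x; rewrite derive1E; have [dfx _] := ff1 x; exact: derivableP.
move=> n; have [g fg ng] := sf n.+1; rewrite (_ : derive1 f = g)//.
by apply/funext => x; rewrite derive1E; have [_ ->] := fg x.
Qed.

Lemma smooth1_continuous f : smooth1 f -> continuous f.
Proof.
move=> /smooth1_derive[df _] x; apply/differentiable_continuous.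
by have [dfx _] := df x; exact/derivable1_diffP.
Qed.

End SmoothLine.

(** * Radial test functions *)
Section Directional.
Context {R : realType}.
Local Notation R3 := (R * R * R)%type.

Lemma is_derive_line (u : R3 -> R) (x v : R3) (l : R) :
  is_derive (0 : R) (1 : R) (fun h => u (h *: v + x)) l <-> is_derive x v u l.
Proof.
have E : (fun h : R => h^-1 *: (((fun h => u (h *: v + x)) \o shift 0) (h *: (1:R)) - u (0 *: v + x)))
  = (fun h => h^-1 *: ((u \o shift x) (h *: v) - u x)).
  by apply/funext => h /=; rewrite addr0 scale0r add0r [_%:A]mulr1.
by split=> -[du <-]; split; rewrite /derivable /derive ?E//; move: du;
   rewrite /derivable E.
Qed.

Lemma is_derive_chain (F : R -> R) (u : R3 -> R) (x v : R3) (a b : R) :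
  is_derive (u x) (1 : R) F a -> is_derive x v u b ->
  is_derive x v (F \o u) (a * b).
Proof.
move=> dF /is_derive_line du; apply/is_derive_line.
apply: (@is_derive1_comp _ F (fun h => u (h *: v + x))) => //.
by rewrite scale0r add0r.
Qed.

Definition coord (i : 'I_3) (x : R3) : R :=
  if i == 0 then x.1.1 else if i == 1 then x.1.2 else x.2.

Lemma is_derive_coord i (x v : R3) : is_derive x v (coord i) (coord i v).
Proof.
apply/is_derive_line.
have -> : (fun h : R => coord i (h *: v + x)) =
    ((id : R -> R) * cst (coord i v) + cst (coord i x)).
  by apply/funext => h; rewrite /coord; case: ifP => // _; case: ifP.
by apply: is_derive_eq; rewrite /GRing.scale/= mul0r add0r mulr1 addr0.
Qed.

Lemma dotE (x y : R3) : dot x y = coord 0 x * coord 0 y + coord 1 x * coord 1 y + coord 2 x * coord 2 y.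
Proof. by []. Qed.

Lemma is_derive_sqnorm (x v : R3) :
  is_derive x v (fun y => dot y y) (2 * dot x v).
Proof.
have D i : is_derive x v (coord i * coord i) _ := is_deriveM (is_derive_coord i x v) (is_derive_coord i x v).
apply: (is_derive_eq (is_deriveD (is_deriveD (D 0) (D 1)) (D 2))).
by rewrite !dotE /GRing.scale/=; ring.
Qed.

End Directional.

Section RadialTestFunctions.
Context {R : realType}.
Local Notation R3 := (R * R * R)%type.

(** The expressions that occur as iterated partial derivatives of Phi(|x|^2).
    The class is closed under partial derivation, so one structural induction
    gives continuity and differentiability at every order. *)
Inductive radexp : Type :=
  | RadCst of R | RadProfile of nat | RadCoord of 'I_3
  | RadAdd of radexp & radexp | RadMul of radexp & radexp.

Fixpoint rad_eval (Phi : R -> R) (e : radexp) : R3 -> R :=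
  match e with
  | RadCst c => cst c
  | RadProfile n => (iter n (@derive1 R R^o) Phi) \o (fun x => dot x x)
  | RadCoord i => coord i
  | RadAdd e1 e2 => rad_eval Phi e1 \+ rad_eval Phi e2
  | RadMul e1 e2 => rad_eval Phi e1 \* rad_eval Phi e2
  end.

Fixpoint rad_partial (i : 'I_3) (e : radexp) : radexp :=
  match e with
  | RadCst _ => RadCst 0
  | RadProfile n => RadMul (RadProfile n.+1) (RadMul (RadCst 2) (RadCoord i))
  | RadCoord j => RadCst (coord j (e3 i))
  | RadAdd e1 e2 => RadAdd (rad_partial i e1) (rad_partial i e2)
  | RadMul e1 e2 =>
      RadAdd (RadMul e1 (rad_partial i e2)) (RadMul e2 (rad_partial i e1))
  end.

Lemma dot_e3 (i : 'I_3) (x : R3) : dot x (e3 i) = coord i x.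
Proof.
rewrite /dot /e3 /coord; case: i => [[|[|[|]]]] //= _;
  by rewrite !(mulr1, mulr0, addr0, add0r).
Qed.

Lemma is_derive_rad_eval Phi e (i : 'I_3) (x : R3) : smooth1 Phi ->
  is_derive x (e3 i) (rad_eval Phi e) (rad_eval Phi (rad_partial i e) x).
Proof.
move=> sPhi; elim: e => /= [c|n|j|e1 IH1 e2 IH2|e1 IH1 e2 IH2].
- exact: is_derive_cst.
- have sn : smooth1 (iter n (@derive1 R R^o) Phi).
    by elim: n => //= n /smooth1_derive[].
  have [dPhi _] := smooth1_derive sn.
  rewrite -(dot_e3 i x); apply: is_derive_chain.
  exact: is_derive_sqnorm.
- exact: is_derive_coord.
- exact: is_deriveD.
- exact: is_deriveM.
Qed.

Lemma foldr_partial_rad Phi (l : seq 'I_3) : smooth1 Phi ->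
  foldr partial (fun x : R3 => Phi (dot x x)) l =
  rad_eval Phi (foldr rad_partial (RadProfile 0) l).
Proof.
move=> sPhi; elim: l => //= i l ->; apply/funext => x.
by have [_ dE] := is_derive_rad_eval (foldr rad_partial (RadProfile 0) l) i x sPhi.
Qed.

Lemma continuous_coord i : continuous (@coord R i).
Proof.
rewrite /coord => x; case: (i == 0); first exact: continuous_X1.
by case: (i == 1); [exact: continuous_X2|exact: continuous_X3].
Qed.

Lemma continuous_rad_eval Phi e : smooth1 Phi -> continuous (rad_eval Phi e).
Proof.
move=> sPhi; elim: e => /= [c|n|j|e1 IH1 e2 IH2|e1 IH1 e2 IH2] x.
- exact: cvg_cst.
- have sn : smooth1 (iter n (@derive1 R R^o) Phi).
    by elim: n => //= n /smooth1_derive[].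
  apply: continuous_comp; first exact: continuous_sqnorm.
  exact: smooth1_continuous.
- exact: continuous_coord.
- by apply: cvgD; [exact: IH1|exact: IH2].
- by apply: cvgM; [exact: IH1|exact: IH2].
Qed.

Lemma radial_test_fun (Phi : R -> R) (b r : R) : smooth1 Phi -> b < r ->
  (forall x : R3, b < enorm x -> Phi (dot x x) = 0) ->
  test_fun (eball r) (fun x : R3 => Phi (dot x x)).
Proof.
move=> sPhi br Phi0.
have sub : closure [set x : R3 | Phi (dot x x) != 0] `<=` [set x | enorm x <= b].
  have cb : closed [set x : R3 | enorm x <= b].
    exact: closed_cball.
  rewrite [X in _ `<=` X](closure_id _).1//; apply: closure_subset => x /=.
  by apply: contraNle => /Phi0/eqP.
split.
- move=> l; rewrite foldr_partial_rad//; split.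
    exact: continuous_rad_eval.
  move=> x i.
  by have [dx _] := is_derive_rad_eval (foldr rad_partial (RadProfile 0) l) i x sPhi.
- apply: subclosed_compact sub; first exact: closed_closure.
  exact: compact_cball.
- by move=> x /sub/le_lt_trans; exact.
Qed.

Lemma grad_radial (Phi : R -> R) (x : R3) : smooth1 Phi ->
  grad (fun x : R3 => Phi (dot x x)) x = (2 * derive1 Phi (dot x x)) *: x.
Proof.
move=> sPhi.
have pE i : partial i (fun x : R3 => Phi (dot x x)) x = 2 * derive1 Phi (dot x x) * coord i x.
  have [_] := is_derive_rad_eval (RadProfile 0) i x sPhi.
  by rewrite /partial => -> /=; ring.
by rewrite /grad !pE; case: x {pE} => [[a b] c].
Qed.
End RadialTestFunctions.

(** * The layer formula *)
Section Layer.
Context {R : realType} d (T : measurableType d).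
Context (m : {sigma_finite_measure set T -> \bar R}).
Local Notation mu := (@lebesgue_measure R).

Lemma integrable_itv_mkcond (i : interval R) (F : R -> \bar R) :
  mu.-integrable [set` i] F <-> mu.-integrable setT (F \_ [set` i]).
Proof.
by have := @integrable_mkcond _ _ _ mu [set` i] F; apply; exact: measurable_itv.
Qed.

Lemma integrable_itvS (i j : interval R) (F : R -> \bar R) :
  [set` j] `<=` [set` i] -> mu.-integrable [set` i] F -> mu.-integrable [set` j] F.
Proof. by move=> ji; apply: integrableS. Qed.

(** Fubini on the region rho(x) <= t, where k is the derivative of K: integrals of
    h against a function of rho only see the cumulative integrals N of h.  It
    serves on the ball with rho = |x|, and on the line with rho the identity. *)
Lemma integral_layer (D : set T) (h rho : T -> R) (k K : R -> R) (a b : R) :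
  measurable D -> m.-integrable D (EFin \o h) -> measurable_fun setT rho ->
  (forall x, D x -> a <= rho x <= b) -> mu.-integrable `[a, b] (EFin \o k) ->
  (forall r, a <= r <= b -> K b - K r = \int[mu]_(t in `[r, b]) k t) ->
  let N t := \int[m]_(x in D `&` [set x | rho x <= t]) h x in
  [/\ m.-integrable D (fun x => (h x * K (rho x))%:E),
      mu.-integrable `[a, b] (fun t => (k t * N t)%:E) &
      \int[m]_(x in D) (h x * K (rho x)) =
      K b * \int[m]_(x in D) h x - \int[mu]_(t in `[a, b]) (k t * N t)].
Proof.
move=> mD ih mrho rhoab ik KE N.
pose hD := h \_ D; pose kI := k \_ `[a, b].
pose low (x : T) (t : R) : R := (rho x <= t)%R%:R.
pose f (p : T * R) : \bar R := (hD p.1 * (kI p.2 * low p.1 p.2))%:E.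
have ihD : m.-integrable setT (EFin \o hD).
  by rewrite /hD -restrict_EFin; exact: (integrable_mkcond (EFin \o h) mD).1.
have ikI : mu.-integrable setT (EFin \o kI).
  by rewrite /kI -restrict_EFin; exact: (integrable_itv_mkcond _ _).1.
have mhD : measurable_fun setT hD by apply/measurable_EFinP; exact: measurable_int ihD.
have mkI : measurable_fun setT kI by apply/measurable_EFinP; exact: measurable_int ikI.
have mlow : measurable_fun setT (fun p : T * R => low p.1 p.2).
  apply: measurable_natb; apply: measurable_fun_ler => //.
  exact: measurableT_comp mrho measurable_fst.
have mf : measurable_fun setT f.
  apply/measurable_EFinP/measurable_funM.
    exact: measurableT_comp mhD measurable_fst.
  by apply: measurable_funM => //; exact: measurableT_comp mkI measurable_snd.
have low1 x t : 0 <= low x t <= 1 by rewrite /low; case: (rho x <= t); rewrite ler01 lexx.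
have iff : (m \x mu)%E.-integrable setT f.
  apply: (integrable12ltyP m mu mf).2.
  apply: (@le_lt_trans _ _ (\int[m]_x (`|(hD x)%:E| * \int[mu]_t `|(kI t)%:E|))%E).
    apply: ge0_le_integral => //.
    - by move=> x _; apply: integral_ge0.
    - apply: (measurable_fun_fubini_tonelli_F (m2 := mu) (abse \o f)).
        exact: measurableT_comp mf.
      by move=> p /=.
    - apply: emeasurable_funM => //; apply: measurableT_comp => //.
      exact/measurable_EFinP.
    - move=> x _; rewrite -ge0_integralZl//; last first.
        by apply: measurableT_comp => //; exact/measurable_EFinP.
      apply: ge0_le_integral => //.
      + apply: measurableT_comp => //; apply: measurableT_comp mf _.
        exact: pair1_measurable.
      + apply: emeasurable_funM => //; apply: measurableT_comp => //.
        exact/measurable_EFinP.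
      + move=> t _; rewrite /f/= -EFinM lee_fin !normrM ler_wpM2l//.
        by have /andP[l0 l1] := low1 x t; rewrite (ger0_norm l0) ler_piMr.
  rewrite ge0_integralZr//.
  - have /integrableP[_ /= hy] := ihD; have /integrableP[_ /= ky] := ikI.
    by rewrite lte_mul_pinfty// ?integral_ge0// ge0_fin_numE ?integral_ge0.
  - by apply: measurableT_comp => //; exact/measurable_EFinP.
  - exact: integral_ge0.
have Fx x : D x -> (\int[mu]_t f (x, t) = (h x * (K b - K (rho x)))%:E)%E.
  move=> Dx; have /andP[ax xb] := rhoab x Dx.
  have sub : `[rho x, b]%classic `<=` `[a, b]%classic by apply: subset_itvr.
  have ikx : mu.-integrable `[rho x, b] (EFin \o k).
    exact: integrable_itvS sub ik.
  rewrite KE ?ax// EFinM fineK; last exact: integrable_fin_num.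
  rewrite -integralZl// integral_mkcond; apply: eq_integral => t _.
  rewrite patchE /f/= /hD patchE mem_set// /kI /low patchE !mem_setE !in_itv/= EFinM.
  case: (leP (rho x) t) => xt /=; last by rewrite mulr0 mule0.
  by rewrite (le_trans ax xt)/=; case: (t <= b); rewrite ?mulr1//; exact: mule0.
have Fx0 x : ~ D x -> (\int[mu]_t f (x, t) = 0)%E.
  by move=> Dx; apply: integral0_eq => t _; rewrite /f/= /hD patchE memNset// mul0r.
have Gt t : `[a, b]%classic t -> (\int[m]_x f (x, t) = (k t * N t)%:E)%E.
  move=> tab.
  have mDt : measurable (D `&` [set x | rho x <= t]).
    rewrite -[X in _ `&` X]setTI; apply: measurableI => //.
    rewrite (_ : [set x | rho x <= t] = rho @^-1` `]-oo, t]%classic); first exact: mrho.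
    by apply/seteqP; split => x /=; rewrite in_itv.
  have iht : m.-integrable (D `&` [set x | rho x <= t]) (EFin \o h).
    exact: integrableS mD mDt (@subIsetl _ _ _) ih.
  rewrite EFinM fineK; last exact: integrable_fin_num.
  rewrite -integralZl// integral_mkcond; apply: eq_integral => x _.
  rewrite patchE /f/= /kI patchE mem_set// /hD /low patchE in_setI mulrCA EFinM.
  have -> : (x \in [set x | rho x <= t]) = (rho x <= t).
    by apply/idP/idP; rewrite inE.
  case: (x \in D); case: (rho x <= t); rewrite /= ?mulr1 ?mulr0 ?mul0r ?mule0//.
have Gt0 t : ~ `[a, b]%classic t -> (\int[m]_x f (x, t) = 0)%E.
  move=> tab; apply: integral0_eq => x _; rewrite /f/= /kI patchE memNset//.
  by rewrite mul0r mulr0.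
have iF : m.-integrable D (fun x => (h x * (K b - K (rho x)))%:E).
  apply/(integrable_mkcond _ mD).2.
  apply: eq_integrable (integrable_fubini_F (m1 := m) (m2 := mu) iff) => //.
  move=> x _; rewrite patchE; case: ifPn; first by rewrite inE => /Fx.
  by rewrite notin_setE => /Fx0.
have iG0 : mu.-integrable setT (fun t => \int[m]_x f (x, t))%E.
  apply/integrableP; split.
    exact: (measurable_fubini_G (m1 := m) (m2 := mu) iff).
  apply: le_lt_trans ((integrable21ltyP m mu mf).1 iff).
  apply: ge0_le_integral => //.
  - apply: measurableT_comp => //.
    exact: (measurable_fubini_G (m1 := m) (m2 := mu) iff).
  - apply: (measurable_fun_fubini_tonelli_G (m1 := m) (abse \o f)).
      exact: measurableT_comp mf.
    by move=> p /=.
  - move=> t _; apply: le_abse_integral => //.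
    by apply: measurableT_comp mf _; exact: pair2_measurable.
have iG : mu.-integrable `[a, b] (fun t => (k t * N t)%:E).
  apply: (integrable_itv_mkcond _ _).2.
  apply: eq_integrable iG0 => //.
  move=> t _; rewrite patchE; case: ifPn; first by rewrite inE => /Gt.
  by rewrite notin_setE => /Gt0.
have E : \int[m]_(x in D) (h x * (K b - K (rho x))) =
    \int[mu]_(t in `[a, b]) (k t * N t).
  rewrite /Rintegral; congr fine.
  rewrite integral_mkcond [RHS]integral_mkcond.
  transitivity (\int[m]_x \int[mu]_t f (x, t))%E.
    apply: eq_integral => x _; rewrite patchE; case: ifPn; first by rewrite inE => /Fx.
    by rewrite notin_setE => /Fx0.
  rewrite (Fubini (m1 := m) (m2 := mu) iff).
  apply: eq_integral => t _; rewrite patchE; case: ifPn; first by rewrite inE => /Gt.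
  by rewrite notin_setE => /Gt0.
have ihK : m.-integrable D (fun x => (K b * h x)%:E).
  by under eq_fun do rewrite EFinM; exact: integrableZl.
have ihKr : m.-integrable D (fun x => (h x * K (rho x))%:E).
  apply: eq_integrable (integrableB mD ihK iF) => // x _ /=.
  by rewrite -EFinB; congr EFin; ring.
split => //; rewrite -E -RintegralZl// -RintegralB//.
by apply: eq_Rintegral => x _; ring.
Qed.
End Layer.

(** * Integration on the line and bump functions *)
Section LineTools.
Context {R : realType}.
Local Notation mu := (@lebesgue_measure R).
Implicit Types (a b x : R).

Lemma Rintegral_dominated d (T : measurableType d) (m : {measure set T -> \bar R})
    (D : set T) (f_ : nat -> T -> R) (f : T -> R) (g : T -> R) :
  measurable D -> (forall n, measurable_fun D (f_ n)) -> measurable_fun D f ->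
  {ae m, forall y, D y -> f_ n y @[n --> \oo] --> f y} ->
  m.-integrable D (EFin \o g) ->
  (forall n y, D y -> `|f_ n y| <= g y) ->
  m.-integrable D (EFin \o f) /\
  (\int[m]_(y in D) f_ n y) @[n --> \oo] --> \int[m]_(y in D) f y.
Proof.
move=> mD mf_ mf cf ig fg.
have [] := @dominated_convergence _ _ _ m D mD (fun n => EFin \o f_ n) (EFin \o f) (EFin \o g).
- by move=> n; apply/measurable_EFinP.
- exact/measurable_EFinP.
- by apply: filterS cf => x cfx Dx; apply/cvg_EFin; [exact: nearW|exact: cfx].
- exact: ig.
- by apply: aeW => x n Dx /=; rewrite lee_fin fg.
move=> iff _ cI; split => //.
apply: fine_cvg; rewrite fineK; first exact: cI.
exact: integrable_fin_num.
Qed.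

Lemma derive_continuous_at (F : R -> R) (x l : R) :
  is_derive x (1 : R) F l -> {for x, continuous F}.
Proof. by case=> dF _; apply/differentiable_continuous/derivable1_diffP. Qed.

Lemma within_continuous_itv (f : R -> R) (i : interval R) :
  (forall x, x \in i -> {for x, continuous f}) -> {within [set` i], continuous f}.
Proof. by move=> cf; apply: continuous_in_subspaceT => x; rewrite inE => /cf. Qed.

Lemma Rintegral_derive (F f : R -> R) a b : a <= b ->
  (forall x, a <= x <= b -> is_derive x (1 : R) F (f x)) ->
  {within `[a, b], continuous f} ->
  \int[mu]_(t in `[a, b]) f t = F b - F a.
Proof.
rewrite le_eqVlt => /predU1P[->|ab] dF cf.
  by rewrite set_itv1 Rintegral_set1 subrr.
have cF x : a <= x <= b -> {for x, continuous F}.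
  by move=> /dF; exact: derive_continuous_at.
have cFab : {within `[a, b], continuous F}.
  by apply: within_continuous_itv => x; rewrite in_itv/=; exact: cF.
rewrite /Rintegral (@continuous_FTC2 _ f F)//.
- have [_ Fa Fb] := (continuous_within_itvP _ ab).1 cFab; split => //.
  by move=> x; rewrite in_itv/= => /andP[ax xb]; case: (dF x _) => //; rewrite !ltW.
- move=> x; rewrite in_itv/= => /andP[ax xb]; rewrite derive1E.
  by case: (dF x _) => //; rewrite !ltW.
Qed.

Lemma compact_primitive (psi : R -> R) a b :
  continuous psi -> (forall t, t <= a -> psi t = 0) ->
  (forall t, b <= t -> psi t = 0) ->
  exists2 Phi : R -> R, (forall t, is_derive t (1 : R) Phi (psi t)) &
    forall t, b <= t -> Phi t = 0.
Proof.
move=> cpsi psia psib.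
pose Psi t := \int[mu]_(x in `[a - 1, t]) psi x.
have ipsi u v : mu.-integrable `[u, v] (EFin \o psi).
  apply: continuous_compact_integrable; first exact: segment_compact.
  exact: continuous_subspaceT.
have dPsi t : is_derive t (1 : R) Psi (psi t).
  have [at1|ta] := ltP (a - 1) t.
    have t1 : t < t + 1 by rewrite ltrDl.
    have [dP eP] := continuous_FTC1_closed t1 (ipsi (a - 1) (t + 1)) at1 (cpsi t).
    by split; [exact: dP|rewrite -derive1E].
  have ta' : t < a by rewrite (le_lt_trans ta)// gtrBl.
  rewrite psia ?ltW//; apply: (@near_eq_is_derive _ _ _ (cst 0)).
  have : \forall s \near t, s < a by exact: near_lt.
  apply: filterS => s sa; rewrite /Psi/= /Rintegral integral0_eq// => x.
  by rewrite /= in_itv/= => /andP[_ xs]; rewrite psia// (le_trans xs)// ltW.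
exists (fun t => Psi t - Psi b) => t.
  apply: (is_derive_eq (is_deriveB (dPsi t) (is_derive_cst (Psi b) t 1))).
  by rewrite subr0.
move=> bt; rewrite -(@Rintegral_derive Psi psi)//; last exact: continuous_subspaceT.
rewrite /Rintegral integral0_eq// => x; rewrite /= in_itv/= => /andP[bx _].
by rewrite psib.
Qed.

(** Between 0 and 1, smooth, and convergent to the indicator of the open interval
    as n grows. *)
Definition bump a b (n : nat) (x : R) : R := flat 1 (n.+1%:R * ((x - a) * (b - x))).

Lemma bump_ge0 a b n x : 0 <= bump a b n x.
Proof. exact: flat_ge0. Qed.

Lemma bump_le1 a b n x : bump a b n x <= 1.
Proof. exact: flat_le1. Qed.

Lemma bump_eq0 a b n x : a <= b -> ~~ (a < x < b) -> bump a b n x = 0.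
Proof.
move=> ab; rewrite negb_and -!leNgt => xab; apply: flat_npos.
rewrite pmulr_rle0//; case/orP : xab => [xa|bx].
  by rewrite mulr_le0_ge0// ?subr_le0// subr_ge0 (le_trans xa).
by rewrite mulr_ge0_le0// ?subr_le0// subr_ge0 (le_trans ab).
Qed.

Lemma smooth1_bump a b n : smooth1 (bump a b n).
Proof.
move=> m; pose q := (cst n.+1%:R : R -> R) \* ((id \+ cst (- a)) \* (cst b \+ (cst (-1) \* id))).
have -> : bump a b n = flat 1 \o q.
  by apply/funext => x; rewrite /bump /q/= mulN1r.
apply: Ck_comp; first exact: Ck_flat.
apply: CkM; first exact: Ck_cst.
apply: CkM; apply: CkD; [exact: Ck_id|exact: Ck_cst|exact: Ck_cst|].
by apply: CkM; [exact: Ck_cst|exact: Ck_id].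
Qed.

Lemma flat_large (c : R) : 0 < c -> flat 1 (n.+1%:R * c) @[n --> \oo] --> (1 : R).
Proof.
move=> c0.
have E n : flat 1 (n.+1%:R * c) = expR (- (harmonic n * c^-1)).
  by rewrite /flat pmulr_rgt0// c0 hornerC mul1r invfM.
apply: cvg_trans; first by apply: near_eq_cvg; apply: nearW => n; exact/esym/E.
suff : expR (- (harmonic n * c^-1)) @[n --> \oo] --> expR (0 : R) by rewrite expR0.
apply: continuous_cvg; first exact: continuous_expR.
rewrite -oppr0 -(mul0r c^-1); apply: cvgN; apply: cvgMl; exact: cvg_harmonic.
Qed.

Lemma bump_cvg a b x : a <= b -> bump a b n x @[n --> \oo] --> ((a < x < b)%R%:R : R).
Proof.
move=> ab; have [/andP[ax xb]|xab] := boolP (a < x < b).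
  by apply: flat_large; rewrite mulr_gt0// subr_gt0.
apply: cvg_near_cst; apply: nearW => n; exact: bump_eq0.
Qed.

(** The open interval is exhausted by compact ones, on which the vanishing of the
    integrals over subintervals applies. *)
Lemma ae_itv_eq0 (r : R) (h : R -> R) :
  (forall a b, 0 < a -> a < b -> b < r -> mu.-integrable `[a, b] (EFin \o h)) ->
  (forall a b, 0 < a -> a < b -> b < r -> \int[mu]_(t in `[a, b]) h t = 0) ->
  {ae mu, forall t, 0 < t < r -> h t = 0}.
Proof.
move=> ih h0.
have [r0|r0] := ltP 0 r; last first.
  by apply: aeW => t /andP[t0 /(lt_trans t0)]; rewrite ltNge r0.
pose a n := r / n.+3%:R; pose b n := r - r / n.+3%:R.
have a0 n : 0 < a n by rewrite divr_gt0.
have br n : b n < r by rewrite /b ltrBlDr ltrDl; exact: a0.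
have ab n : a n < b n.
  have : r / n.+3%:R < r / 2 by rewrite ltr_pM2l// ltf_pV2 ?posrE// ltr_nat.
  by rewrite /a /b; move: (r / n.+3%:R) => z; lra.
have loc n : {ae mu, forall t, a n < t < b n -> h t = 0}.
  pose H := h \_ `[a n, b n].
  have iH : mu.-integrable setT (EFin \o H).
    by rewrite /H -restrict_EFin; apply: (integrable_itv_mkcond _ _).1; exact: ih.
  have lH : locally_integrable [set: R] H.
    by apply: open_integrable_locally => //; exact: openT.
  have iHy y : mu.-integrable [set` Interval (BLeft (a n)) (BRight y)] (EFin \o H).
    by apply: integrableS iH.
  have := FTC1 iHy lH; apply: filterS; first exact: (ae_filter_ringOfSetsType mu).
  move=> t /= ft /andP[at_ tb].
  have [|_ HE] := ft; first by rewrite lte_fin.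
  have -> : h t = H t by rewrite /H patchE mem_set//= in_itv/= !ltW.
  rewrite -HE derive1E; apply: derive_val.
  apply: (@near_eq_is_derive _ _ _ (cst 0)).
  have Na := near_gt at_; have Nb := near_lt tb.
  near=> y; have ay : a n < y by near: y.
  have yb : y < b n by near: y.
  rewrite /= -(h0 (a n) y)//; last by rewrite (lt_trans yb).
  apply: eq_Rintegral => s; rewrite inE/= in_itv/= => /andP[as_ sy].
  by rewrite /H patchE mem_set//= in_itv/= as_ (le_trans sy)// ltW.
have := ae_foralln loc; apply: filterS => t /= ht /andP[t0 tr].
have [n nt] : exists n, a n < Num.min t (r - t).
  have m0 : 0 < Num.min t (r - t) by rewrite lt_min t0 subr_gt0.
  exists (Num.truncn (r / Num.min t (r - t))).
  rewrite /a ltr_pdivrMr// mulrC -ltr_pdivrMr//.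
  apply: lt_trans (truncnS_gt _) _.
  by rewrite ltr_nat.
move: nt; rewrite lt_min => /andP[nt nrt]; apply: (ht n); rewrite nt/= /b.
by rewrite ltrBrDl -ltrBrDr.
Unshelve. all: by end_near. Qed.

End LineTools.

(** * Divergence of radial fields with continuous profile *)
Section Divergence.
Context {R : realType}.
Local Notation R3 := (R * R * R)%type.
Local Notation mu := (@lebesgue_measure R).

Lemma is_derive_curve (c : R -> R3) (v : R3) (u : R3 -> R) (t l : R) :
  (forall h, c (h + t) = h *: v + c t) -> is_derive (c t) v u l ->
  is_derive t (1 : R) (u \o c) l.
Proof.
move=> cE [du <-].
have E : (fun h : R => h^-1 *: (((u \o c) \o shift t) (h *: (1:R)) - (u \o c) t))
  = (fun h => h^-1 *: ((u \o shift (c t)) (h *: v) - u (c t))).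
  by apply/funext => h /=; rewrite [_%:A]mulr1 cE.
by split; rewrite /derivable /derive E.
Qed.

Lemma integral_derive_compact (v dv : R -> R) (M : R) :
  (forall t, is_derive t (1 : R) v (dv t)) -> continuous dv ->
  (forall t, M <= `|t| -> v t = 0) -> (forall t, M <= `|t| -> dv t = 0) ->
  (\int[mu]_t (dv t)%:E = 0)%E.
Proof.
move=> vdv cdv v0 dv0.
pose A : R := `|M|.
have MA : M <= A by rewrite ler_norm.
have A0 : 0 <= A by exact: normr_ge0.
have -> : (\int[mu]_t (dv t)%:E = \int[mu]_(t in `[(- A)%R, A]) (dv t)%:E)%E.
  rewrite [RHS]integral_mkcond; apply: eq_integral => t _.
  rewrite patchE; case: ifPn => //; rewrite notin_setE/= in_itv/= -ler_norml => /negP.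
  by rewrite -ltNge => /ltW /(le_trans MA) /dv0 ->.
have iv : mu.-integrable `[- A, A] (EFin \o dv).
  apply: continuous_compact_integrable; first exact: segment_compact.
  exact: continuous_subspaceT.
rewrite -[LHS]fineK; last exact: integrable_fin_num.
rewrite -[X in X%:E]/(\int[mu]_(t in `[- A, A]) dv t).
rewrite (@Rintegral_derive _ v dv) ?ge0_cp//; last exact: continuous_subspaceT.
by rewrite !v0 ?subrr// ?normrN ger0_norm.
Qed.

Lemma integrable_mkcond3 (D : set R3) (F : R3 -> \bar R) : measurable D ->
  mu3.-integrable D F <-> mu3.-integrable setT (F \_ D).
Proof. by have := @integrable_mkcond _ _ _ (@mu3 R) D F; apply. Qed.

Lemma compact_support_bounded (w : R3 -> R) (M : R) :
  continuous w -> (forall x, M <= enorm x -> w x = 0) ->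
  exists N, forall x, `|w x| <= N.
Proof.
move=> cw w0.
have := @continuous_compact _ _ w _ (continuous_subspaceT cw) (@compact_cball R M).
move=> /compact_bounded[N [Nr NM]]; exists (`|N| + 1) => x.
have [Mx|xM] := leP M (enorm x); first by rewrite w0// normr0 addr_ge0.
by apply: NM; [rewrite (le_lt_trans (ler_norm _))// ltrDl|exists x => //=; exact: ltW].
Qed.

Lemma compact_support_integrable3 (w : R3 -> R) (M : R) :
  continuous w -> (forall x, M <= enorm x -> w x = 0) ->
  mu3.-integrable setT (EFin \o w).
Proof.
move=> cw w0.
have mw : measurable_fun setT w by exact: continuous_measurable3.
have iB : mu3.-integrable [set x : R3 | enorm x <= M] (EFin \o w).
  apply: measurable_bounded_integrable.
  - exact: measurable_cball.
  - exact: mu3_cball_fin.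
  - exact: measurable_funTS.
  - have [N wN] := compact_support_bounded cw w0.
    by exists N; split => [|y Ny x _]; [exact: num_real|apply: (le_trans (wN x)); exact: ltW].
have := (integrable_mkcond3 _ (@measurable_cball R M)).1 iB.
apply: eq_integrable => // x _; rewrite patchE; case: ifPn => //.
by rewrite notin_setE/= => /negP; rewrite -ltNge => /ltW/w0/= ->.
Qed.

Lemma enorm_coord (i : 'I_3) (x : R3) : `|coord i x| <= enorm x.
Proof.
have [x1 x2 x3] := normr_coord_le x.
by rewrite /coord; case: ifP => // _; case: ifP.
Qed.

(** Integrate first along the i-th axis: the fundamental theorem of calculus gives
    zero on every line, because u vanishes far out. *)
Lemma integral_partial_eq0 (i : 'I_3) (u du : R3 -> R) (M : R) :
  (forall x, is_derive x (e3 i) u (du x)) -> continuous du ->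
  (forall x, M <= enorm x -> u x = 0) -> (forall x, M <= enorm x -> du x = 0) ->
  \int[mu3]_x du x = 0.
Proof.
move=> udu cdu u0 du0.
have idu : mu3.-integrable setT (EFin \o du) by exact: compact_support_integrable3 du0.
have line (c : R -> R3) : (forall t h, c (h + t) = h *: e3 i + c t) ->
    (forall t, coord i (c t) = t) -> (\int[mu]_t (du (c t))%:E = 0)%E.
  move=> cE ct.
  have cc : continuous c.
    have -> : c = (fun t => t *: e3 i + c 0) by apply/funext => t; rewrite -cE addr0.
    by move=> t; apply: cvgD; [exact: scalel_continuous|exact: cvg_cst].
  have far t : M <= `|t| -> M <= enorm (c t).
    by move=> /le_trans; apply; rewrite -{1}(ct t) enorm_coord.
  apply: (@integral_derive_compact (u \o c) (du \o c) M).
  - move=> t; apply: is_derive_curve (udu (c t)) => h; exact: cE.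
  - by move=> t; apply: continuous_comp; [exact: cc|exact: cdu].
  - by move=> t /far/u0.
  - by move=> t /far/du0.
rewrite /Rintegral.
have plane z : (@mu2 R).-integrable setT (fun p => (du (p, z))%:E).
  have [N duN] := compact_support_bounded cdu du0.
  pose Q : set (R * R) := (`[- M, M] `*` `[- M, M])%classic.
  have mQ : measurable Q by exact: measurableX.
  have mduz : measurable_fun setT (fun p : R * R => du (p, z)).
    exact: measurable_fun_pair1 (continuous_measurable3 cdu).
  have iQ : (@mu2 R).-integrable Q (EFin \o (fun p => du (p, z))).
    apply: measurable_bounded_integrable.
    - exact: mQ.
    - suff : (mu `[(- M)%R, M]%classic * mu `[(- M)%R, M]%classic < +oo)%E.
        by apply: le_lt_trans; rewrite -product_measure1E.
      rewrite lebesgue_measure_itv/=; case: ifP => _; last by rewrite mule0.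
      by rewrite -EFinB -EFinM ltry.
    - exact: measurable_funTS.
    - by exists N; split => [|y Ny p _]; [exact: num_real|apply: (le_trans (duN _)); exact: ltW].
  have := (@integrable_mkcond _ _ _ (@mu2 R) Q (EFin \o (fun p => du (p, z))) mQ).1 iQ.
  apply: eq_integrable => // -[x y] _; rewrite patchE; case: ifPn => //.
  rewrite notin_setE /Q/= !in_itv/= -!ler_norml => xyM; rewrite du0//.
  have [x1 x2 _] := normr_coord_le (x, y, z); apply: contrapT => /negP; rewrite -ltNge => eM.
  by apply: xyM; split; rewrite ltW// (le_lt_trans _ eM).
case: i udu line => [[|[|[|]]]]// i3 udu line.
- rewrite -(integral21_prod_meas1 (m1 := @mu2 R) (m2 := mu) idu) /fubini_G/=.
  rewrite integral0_eq// => z _.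
  rewrite -(integral21_prod_meas1 (m1 := mu) (m2 := mu) (plane z)) /fubini_G/=.
  apply: integral0_eq => y _; apply: (line (fun x => (x, y, z))).
  + move=> t h; transitivity (h * 1 + t, h * 0 + y, h * 0 + z); last by [].
    by rewrite mulr1 mulr0 !add0r.
  + by [].
- rewrite -(integral21_prod_meas1 (m1 := @mu2 R) (m2 := mu) idu) /fubini_G/=.
  rewrite integral0_eq// => z _.
  rewrite -(integral12_prod_meas1 (m1 := mu) (m2 := mu) (plane z)) /fubini_F/=.
  apply: integral0_eq => x _; apply: (line (fun y => (x, y, z))).
  + move=> t h; transitivity (h * 0 + x, h * 1 + t, h * 0 + z); last by [].
    by rewrite mulr1 mulr0 !add0r.
  + by [].
- rewrite -(integral12_prod_meas1 (m1 := @mu2 R) (m2 := mu) idu) /fubini_F/=.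
  rewrite integral0_eq// => -[x y] _; apply: (line (fun z => (x, y, z))).
  + move=> t h; transitivity (h * 0 + x, h * 0 + y, h * 1 + t); last by [].
    by rewrite mulr1 mulr0 !add0r.
  + by [].
Qed.

Lemma is_derive_enorm (x v : R3) : x != 0 ->
  is_derive x v (@enorm R) (dot x v / enorm x).
Proof.
move=> x0; have d0 : 0 < dot x x.
  rewrite lt_def dot_ge0 andbT; apply: contra_neq x0 => d0.
  by apply: enorm_eq0; rewrite /enorm d0 sqrtr0.
have := @is_derive_chain _ Num.sqrt (fun y : R3 => dot y y) x v _ _ (is_derive1_sqrt d0) (is_derive_sqnorm x v).
move=> D; apply: (is_derive_eq D); rewrite -[Num.sqrt (dot x x)]/(enorm x).
have : enorm x != 0 by rewrite /enorm sqrtr_eq0 -ltNge.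
by move=> n0; field.
Qed.

Lemma continuous_radial_cut (k : R -> R) (a : R) : 0 < a ->
  (forall r, r <= a -> k r = 0) -> (forall r, 0 < r -> {for r, continuous k}) ->
  continuous (k \o @enorm R).
Proof.
move=> a0 ka ck x.
have [xa|ax] := ltP (enorm x) a; last first.
  apply: continuous_comp; first exact: continuous_enorm.
  by apply: ck; exact: lt_le_trans ax.
have Nx : \forall y \near x, k (enorm y) = 0.
  have : \forall y \near x, enorm y < a.
    exact: (continuous_enorm (near_lt xa)).
  by apply: filterS => y /ltW/ka.
by rewrite /continuous_at /= (nbhs_singleton Nx); apply: cvg_near_cst.
Qed.

Lemma test_fun_outside (r : R) (phi : R3 -> R) (x : R3) :
  test_fun (eball r) phi -> r <= enorm x ->
  phi x = 0 /\ forall i, partial i phi x = 0.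
Proof.
move=> [_ _ supp] rx.
have Nx : \forall y \near x, phi y = 0.
  have xc : (~` closure [set x | phi x != 0]) x.
    by move=> /supp; rewrite /eball/= ltNge rx.
  have oc : open (~` closure [set x | phi x != 0]).
    by apply: closed_openC; exact: closed_closure.
  have := open_nbhs_nbhs (conj oc xc); apply: filterS => y /= yc.
  by apply/eqP; apply: contra_notT yc => ?; exact: subset_closure.
split; first exact: nbhs_singleton Nx.
move=> i; rewrite /partial.
have [_] : is_derive x (e3 i) phi 0; last by [].
apply: (@near_eq_is_derive _ _ _ (cst 0)).
by apply: filterS Nx => y ->.
Qed.

Lemma Rintegral_sum3_eq0 (f0 f1 f2 : R3 -> R) :
  mu3.-integrable setT (EFin \o f0) -> mu3.-integrable setT (EFin \o f1) ->
  mu3.-integrable setT (EFin \o f2) -> \int[mu3]_x f0 x = 0 ->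
  \int[mu3]_x f1 x = 0 -> \int[mu3]_x f2 x = 0 ->
  \int[mu3]_x ((f0 \+ f1) x + f2 x) = 0.
Proof.
move=> i0 i1 i2 z0 z1 z2.
have i01 : mu3.-integrable setT (EFin \o (f0 \+ f1)).
  by apply: eq_integrable (integrableD _ i0 i1).
rewrite (RintegralD measurableT i01 i2) z2 addr0.
by rewrite (RintegralD measurableT i0 i1) z0 z1 addr0.
Qed.

(** The components u_i = K(|x|) x_i phi with K(r) = G(r)/r^3 have compact support
    and vanish near the origin.  As x/|x|^3 is divergence free there, the sum of
    the partial derivatives of u_i is K x.grad phi + (g/r^2) phi, and its
    integral is zero. *)
Lemma radial_divergence (G g : R -> R) (a r : R) (phi : R3 -> R) : 0 < a ->
  (forall t, is_derive t (1 : R) G (g t)) -> continuous g ->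
  (forall t, t <= a -> G t = 0) -> (forall t, t <= a -> g t = 0) ->
  test_fun (eball r) phi ->
  \int[mu3]_(x in eball r) (G (enorm x) * enorm x ^- 3 * dot x (grad phi x)) =
  - \int[mu3]_(x in eball r) (g (enorm x) * enorm x ^- 2 * phi x).
Proof.
move=> a0 dG cg G0 g0 tphi; have [sphi _ _] := tphi.
have [cphi dphi] := sphi [::].
have cpart i : continuous (partial i phi) by have [] := sphi [:: i].
pose K t := G t * t ^- 3.
pose K' t := g t * t ^- 3 - 3 * G t * t ^- 4.
pose k2 t := K' t / t.
have K0 t : t <= a -> K t = 0 by move=> /G0; rewrite /K => ->; rewrite mul0r.
have k20 t : t <= a -> k2 t = 0.
  by move=> ta; rewrite /k2 /K' g0// G0// mul0r mulr0 mul0r subr0 mul0r.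
have cG t : {for t, continuous G} by exact: derive_continuous_at (dG t).
have cV (n : nat) (t : R) : 0 < t -> {for t, continuous (fun s : R => s ^- n)}.
  move=> t0; apply: cvgV; first by rewrite expf_neq0// gt_eqF.
  exact: exprn_continuous.
have cK : continuous (K \o @enorm R).
  apply: (continuous_radial_cut a0 K0) => t t0.
  by apply: cvgM; [exact: cG|exact: cV].
have ck2 : continuous (k2 \o @enorm R).
  apply: (continuous_radial_cut a0 k20) => t t0.
  apply: cvgM; last exact: (cV 1%N).
  apply: cvgB; first by apply: cvgM; [exact: cg|exact: cV].
  by apply: cvgM; [apply: cvgM; [exact: cvg_cst|exact: cG]|exact: cV].
have dK i x : is_derive x (e3 i) (K \o @enorm R) (k2 (enorm x) * coord i x).
  have [xa|ax] := ltP (enorm x) a.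
    rewrite k20 ?mul0r; last exact: ltW.
    apply: (@near_eq_is_derive _ _ _ (cst 0)).
    have : \forall y \near x, enorm y < a.
      exact: (continuous_enorm (near_lt xa)).
    by apply: filterS => y /ltW/K0/= ->.
  have ex : 0 < enorm x by exact: lt_le_trans ax.
  have x0 : x != 0.
    by apply: contraTneq ex => ->; rewrite /enorm /dot/= !mulr0 !addr0 sqrtr0 ltxx.
  have dK1 : is_derive (enorm x) (1 : R) K (K' (enorm x)).
    have dV : is_derive (enorm x) (1 : R) (fun s : R => s ^- 3) _ :=
      @is_deriveV _ (fun s : R => s ^+ 3) (enorm x) _ _ (expf_neq0 3 (lt0r_neq0 ex)) (is_deriveX 3 (is_derive_id (enorm x) (1 : R))).
    apply: (is_derive_eq (is_deriveM (dG (enorm x)) dV)).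
    rewrite /K' /GRing.scale/=; field.
    by rewrite gt_eqF.
  apply: (is_derive_eq (is_derive_chain dK1 (is_derive_enorm (e3 i) x0))).
  rewrite dot_e3 /k2; field.
  by rewrite gt_eqF.
pose u i x := K (enorm x) * coord i x * phi x.
pose du i x := k2 (enorm x) * coord i x * coord i x * phi x + K (enorm x) * phi x
  + K (enorm x) * coord i x * partial i phi x.
have udu i x : is_derive x (e3 i) (u i) (du i x).
  have dp : is_derive x (e3 i) phi (partial i phi x).
    by apply: derivableP; exact: (dphi x i).
  apply: (is_derive_eq (is_deriveM (is_deriveM (dK i x) (is_derive_coord i x (e3 i))) dp)).
  rewrite /du /GRing.scale/=.
  have -> : coord i (e3 i) = 1 :> R by case: i {dp u du} => [[|[|[|]]]].
  rewrite -[((K \o @enorm R) * coord i) x]/(K (enorm x) * coord i x); ring.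
have cdu i : continuous (du i).
  move=> x; apply: cvgD; first apply: cvgD.
  - apply: cvgM; last exact: cphi.
    by apply: cvgM; [apply: cvgM; [exact: ck2|]|]; exact: continuous_coord.
  - by apply: cvgM; [exact: cK|exact: cphi].
  - apply: cvgM; last exact: cpart.
    by apply: cvgM; [exact: cK|exact: continuous_coord].
have out x : r <= enorm x -> phi x = 0 /\ forall i, partial i phi x = 0.
  exact: test_fun_outside.
have u0 i x : r <= enorm x -> u i x = 0.
  by move=> /out[p0 _]; rewrite /u p0 mulr0.
have du0 i x : r <= enorm x -> du i x = 0.
  by move=> /out[p0 q0]; rewrite /du p0 q0 !mulr0 !addr0.
have idu i : mu3.-integrable setT (EFin \o du i).
  exact: compact_support_integrable3 (cdu i) (du0 i).
have zero i : \int[mu3]_x du i x = 0 by exact: integral_partial_eq0 (udu i) (cdu i) (u0 i) (du0 i).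
pose A x := K (enorm x) * dot x (grad phi x).
pose B x := g (enorm x) * enorm x ^- 2 * phi x.
have ABE x : A x + B x = du 0 x + du 1 x + du 2 x.
  rewrite /A /B /du dotE.
  have -> : coord 0 (grad phi x) = partial 0 phi x by [].
  have -> : coord 1 (grad phi x) = partial 1 phi x by [].
  have -> : coord 2 (grad phi x) = partial 2 phi x by [].
  have dE : coord 0 x * coord 0 x + coord 1 x * coord 1 x + coord 2 x * coord 2 x = enorm x ^+ 2.
    by rewrite enorm_sqr dotE.
  have kE : k2 (enorm x) * enorm x ^+ 2 + 3 * K (enorm x) = g (enorm x) * enorm x ^- 2.
    rewrite /k2 /K' /K; have [->|n0] := eqVneq (enorm x) 0.
      by rewrite g0 ?ltW// G0 ?ltW// !mul0r; ring.
    by field.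
  rewrite -kE -dE; move: (K _) (k2 _) (coord 0 x) (coord 1 x) (coord 2 x).
  move: (partial 0 phi x) (partial 1 phi x) (partial 2 phi x) (phi x).
  by move=> *; ring.
have cA : continuous A.
  move=> x; apply: cvgM; first exact: cK.
  rewrite /dot/=; apply: cvgD; first apply: cvgD.
  - by apply: cvgM; [exact: continuous_X1|exact: cpart].
  - by apply: cvgM; [exact: continuous_X2|exact: cpart].
  - by apply: cvgM; [exact: continuous_X3|exact: cpart].
have A0 x : r <= enorm x -> A x = 0.
  by move=> /out[_ q0]; rewrite /A /dot /grad/= !q0 !mulr0 !addr0 mulr0.
have iA : mu3.-integrable setT (EFin \o A) by exact: compact_support_integrable3 A0.
have i01 : mu3.-integrable setT (EFin \o (du 0 \+ du 1)).
  by apply: eq_integrable (integrableD _ (idu 0) (idu 1)).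
have iAB : mu3.-integrable setT (EFin \o (A \+ B)).
  have -> : A \+ B = (du 0 \+ du 1) \+ du 2 by apply/funext => x; exact: ABE.
  by apply: eq_integrable (integrableD _ i01 (idu 2)).
have iB : mu3.-integrable setT (EFin \o B).
  apply: eq_integrable (integrableB _ iAB iA) => // x _ /=.
  by rewrite -EFinB; congr EFin; ring.
have E012 : \int[mu3]_x ((du 0 \+ du 1) x + du 2 x) = 0.
  exact: Rintegral_sum3_eq0 (zero 0) (zero 1) (zero 2).
have E : \int[mu3]_x A x + \int[mu3]_x B x = 0.
  have := @RintegralD _ _ _ (@mu3 R) setT _ _ measurableT iA iB => <-.
  by rewrite -[RHS]E012; apply: eq_Rintegral => x _; exact: ABE.
have restr (w : R3 -> R) : (forall x, r <= enorm x -> w x = 0) ->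
    \int[mu3]_x w x = \int[mu3]_(x in eball r) w x.
  move=> w0; rewrite [RHS]Rintegral_mkcond; apply: eq_Rintegral => x _.
  rewrite patchE; case: ifPn => //; rewrite notin_setE => /negP.
  by rewrite -leNgt => /w0.
rewrite -(restr A A0) -(restr B); last by move=> x /out[p0 _]; rewrite /B p0 mulr0.
by apply/eqP; rewrite -addr_eq0; apply/eqP.
Qed.
End Divergence.

(** * Smooth truncations that vanish near zero *)
Section Truncation.
Context {R : realType}.
Implicit Types (y : R) (n : nat).

(** Positive exactly when |y| exceeds (n+1)^(-1/2). *)
Definition level n y : R := n.+1%:R * y ^+ 2 - 1.
(** A smooth function that vanishes near 0 and tends to the identity; [dtrunc] is
    its derivative. *)
Definition trunc n y : R := y * flat 1 (level n y).
Definition dtrunc n y : R :=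
  flat 1 (level n y) + 2 * (level n y + 1) * flat 'X^2 (level n y).

Lemma continuous_flat p : continuous (@flat R p).
Proof. by move=> x; exact: derive_continuous_at (is_derive_flat p x). Qed.

Lemma is_derive_level n y : is_derive y (1 : R) (level n) (n.+1%:R * (2 * y)).
Proof.
have D := is_deriveB (is_deriveZ (n.+1%:R : R) (is_deriveX 2 (is_derive_id y (1 : R))))
  (is_derive_cst (1 : R) y 1).
by apply: (is_derive_eq D); rewrite /GRing.scale/=; ring.
Qed.

Lemma is_derive_trunc n y : is_derive y (1 : R) (trunc n) (dtrunc n y).
Proof.
have dF := is_derive1_comp (is_derive_flat 1 (level n y)) (is_derive_level n y).
have D := is_deriveM (is_derive_id y (1 : R)) dF.
apply: (is_derive_eq D); rewrite /GRing.scale/= derivC subr0 mulr1 /dtrunc.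
rewrite [X in 2 * (X + 1)]/level.
by move: (flat _ _) (flat _ _) => p q; ring.
Qed.

Lemma continuous_trunc n : continuous (trunc n).
Proof. by move=> y; exact: derive_continuous_at (is_derive_trunc n y). Qed.

Lemma continuous_dtrunc n : continuous (dtrunc n).
Proof.
move=> y; have cl : {for y, continuous (level n)}.
  exact: derive_continuous_at (is_derive_level n y).
have cf p : {for y, continuous (flat p \o level n)}.
  by apply: continuous_comp; [exact: cl|exact: continuous_flat].
apply: cvgD; first exact: cf.
apply: cvgM; last exact: cf.
by apply: cvgM; [exact: cvg_cst|apply: cvgD; [exact: cl|exact: cvg_cst]].
Qed.

Lemma trunc_small n y : n.+1%:R * y ^+ 2 <= 1 -> trunc n y = 0 /\ dtrunc n y = 0.
Proof.
move=> y1; have l0 : level n y <= 0 by rewrite /level subr_le0.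
by rewrite /trunc /dtrunc !flat_npos// !mulr0 addr0.
Qed.

Lemma trunc_le n y : `|trunc n y| <= `|y|.
Proof.
rewrite /trunc normrM ler_piMr// ger0_norm ?flat_ge0//; exact: flat_le1.
Qed.

(** With x = 1/u the second term of the derivative is 2 (x + x^2) exp(-x), which is
    at most 6; the first one is at most 1. *)
Lemma dtrunc_le n y : `|dtrunc n y| <= 7.
Proof.
rewrite /dtrunc; set u := level n y.
have [u0|u0] := leP u 0; first by rewrite !flat_npos// mulr0 addr0 normr0.
have v0 : 0 < u^-1 by rewrite invr_gt0.
have -> : 2 * (u + 1) * flat 'X^2 u = 2 * ((u^-1 + u^-1 ^+ 2) / expR u^-1).
  by rewrite /flat u0 hornerXn expRN; field; rewrite !lt0r_neq0// expR_gt0.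
have e0 := expR_gt0 u^-1.
have e1 := expR_ge1Dx u^-1.
have e2 := @expR_ge1Dxn R u^-1 1 (ltW v0).
have f0 := flat_ge0 u; have f1 := flat_le1 u.
have b : (u^-1 + u^-1 ^+ 2) / expR u^-1 <= 3.
  rewrite ler_pdivrMr//; move: e2; rewrite (_ : 2`! = 2)//.
  by move: (u^-1 ^+ 2) (expR _) e1 => q e; lra.
have b0 : 0 <= (u^-1 + u^-1 ^+ 2) / expR u^-1.
  by rewrite divr_ge0 ?addr_ge0 ?sqr_ge0// ltW.
by rewrite ger0_norm; lra.
Qed.

Lemma level_inv_cvg y : y != 0 -> (level n y)^-1 @[n --> \oo] --> (0 : R).
Proof.
move=> y0; have y2 : y ^+ 2 != 0 by rewrite expf_neq0.
have E n : (level n y)^-1 = harmonic n * (y ^+ 2 - harmonic n)^-1.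
  have n0 : n.+1%:R != 0 :> R by rewrite pnatr_eq0.
  by rewrite -[harmonic n]/(n.+1%:R^-1) -invfM mulrBr mulfV.
apply: (@cvg_trans _ (harmonic n * (y ^+ 2 - harmonic n)^-1 @[n --> \oo])).
  by apply: near_eq_cvg; apply: nearW => n; exact/esym/E.
rewrite -(mul0r (y ^+ 2 - 0)^-1); apply: cvgM; first exact: cvg_harmonic.
apply: cvgV; first by rewrite subr0.
by apply: cvgB; [exact: cvg_cst|exact: cvg_harmonic].
Qed.

Lemma level_gt0 y : y != 0 -> \forall n \near \oo, 0 < level n y.
Proof.
move=> y0; have y2 : 0 < y ^+ 2 by rewrite exprn_even_gt0.
exists (Num.truncn (y ^+ 2)^-1) => // n /= kn.
rewrite /level subr_gt0 -ltr_pdivrMr// div1r.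
by apply: lt_le_trans (truncnS_gt _) _; rewrite ler_nat.
Qed.

Lemma flat_level_cvg y : y != 0 -> flat 1 (level n y) @[n --> \oo] --> (1 : R).
Proof.
move=> y0.
suff : expR (- (level n y)^-1) @[n --> \oo] --> (1 : R).
  apply: cvg_trans; apply: near_eq_cvg.
  have := level_gt0 y0; apply: filterS => n n0.
  by rewrite /flat n0 hornerC mul1r.
rewrite -expR0; apply: continuous_cvg; first exact: continuous_expR.
by rewrite -oppr0; apply: cvgN; exact: level_inv_cvg.
Qed.

Lemma trunc_cvg y : trunc n y @[n --> \oo] --> y.
Proof.
have [->|y0] := eqVneq y 0.
  by apply: cvg_near_cst; apply: nearW => n; rewrite /trunc mul0r.
rewrite -[X in _ --> X]mulr1; apply: cvgM; first exact: cvg_cst.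
exact: flat_level_cvg.
Qed.

(** The limit is 0 at y = 0: this is why only the part of a density that lives
    where its primitive is nonzero is recovered in the limit. *)
Lemma dtrunc_cvg y : dtrunc n y @[n --> \oo] --> ((y != 0)%:R : R).
Proof.
have [->|y0] := eqVneq y 0.
  apply: cvg_near_cst; apply: nearW => n.
  by have [] := @trunc_small n 0; rewrite ?expr0n ?mulr0.
pose v n := (level n y)^-1.
have cv : v n @[n --> \oo] --> (0 : R) by exact: level_inv_cvg.
suff : flat 1 (level n y) + 2 * ((v n + v n ^+ 2) * expR (- v n)) @[n --> \oo] --> (1 : R).
  apply: cvg_trans; apply: near_eq_cvg.
  have := level_gt0 y0; apply: filterS => n n0.
  rewrite /dtrunc [flat 'X^2 _]/flat n0 hornerXn /v; field.
  by rewrite gt_eqF.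
rewrite -[X in _ --> X]addr0; apply: cvgD; first exact: flat_level_cvg.
rewrite -(mulr0 2); apply: cvgM; first exact: cvg_cst.
rewrite -(mul0r (expR (- 0 : R))); apply: cvgM.
  rewrite -[X in _ --> X](addr0 0); apply: cvgD; first exact: cv.
  by rewrite -(mulr0 0); apply: cvgM; exact: cv.
apply: continuous_cvg; first exact: continuous_expR.
by apply: cvgN.
Qed.

End Truncation.

(** * Primitives of integrable functions *)
Section Approximation.
Context {R : realType}.
Local Notation R3 := (R * R * R)%type.
Local Notation mu := (@lebesgue_measure R).

Lemma Rintegral_cvg_mul d (T : measurableType d) (m : {measure set T -> \bar R})
    (D : set T) (G_ th_ : nat -> T -> R) (G th : T -> R) (M : R) :
  measurable D -> (forall n, m.-integrable D (EFin \o G_ n)) ->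
  m.-integrable D (EFin \o G) ->
  (\int[m]_(x in D) `|G_ n x - G x|) @[n --> \oo] --> (0 : R) ->
  (forall n, measurable_fun D (th_ n)) -> measurable_fun D th ->
  (forall n x, D x -> `|th_ n x| <= M) ->
  (forall x, D x -> th_ n x @[n --> \oo] --> th x) ->
  (\int[m]_(x in D) (th_ n x * G_ n x)) @[n --> \oo] --> \int[m]_(x in D) (th x * G x).
Proof.
move=> mD iG_ iG cG mth_ mth bth cth.
have bnd n : [bounded th_ n x | x in D].
  by exists M; split => [|y My x Dx]; [exact: num_real|apply: (le_trans (bth n x Dx)); exact: ltW].
have iGB n : m.-integrable D (EFin \o (fun x => G_ n x - G x)).
  by apply: eq_integrable (integrableB mD (iG_ n) iG).
have i1 n : m.-integrable D (EFin \o (fun x => th_ n x * (G_ n x - G x))).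
  exact: integrableMr (mth_ n) (bnd n) (iGB n).
have i2 n : m.-integrable D (EFin \o (fun x => th_ n x * G x)).
  exact: integrableMr (mth_ n) (bnd n) iG.
have mG : measurable_fun D G by apply/measurable_EFinP; exact: measurable_int iG.
have iMG : m.-integrable D (EFin \o (fun x => M * `|G x|)).
  have -> : EFin \o (fun x => M * `|G x|) = (fun x => M%:E * (EFin \o (fun x => `|G x|%R)) x)%E.
    by apply/funext.
  by apply: integrableZl => //; exact: (integrable_norm iG).
have [_ c2] := @Rintegral_dominated _ _ _ m D (fun n x => th_ n x * G x) (fun x => th x * G x)
   (fun x => M * `|G x|) mD (fun n => measurable_funM (mth_ n) mG) (measurable_funM mth mG)
   (aeW _ (fun x Dx => cvgM (cth x Dx) (cvg_cst _))) iMG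
   (fun n x Dx => ltac:(by rewrite normrM ler_wpM2r// bth)).
have c1 : (\int[m]_(x in D) (th_ n x * (G_ n x - G x))) @[n --> \oo] --> (0 : R).
  apply/cvgr0Pnorm_le => e e0.
  have M0 : 0 < `|M| + 1 by rewrite ltr_wpDl.
  have eM : 0 < e / (`|M| + 1) by rewrite divr_gt0.
  move/cvgr0Pnorm_le: cG => /(_ _ eM); apply: filterS => n; rewrite ger0_norm; last first.
    by apply: Rintegral_ge0 => x _.
  move=> Hn; apply: (le_trans (le_normr_Rintegral mD (i1 n))).
  have iGn : m.-integrable D (EFin \o (fun x => `|G_ n x - G x|)).
    exact: (integrable_norm (iGB n)).
  apply: (@le_trans _ _ (\int[m]_(x in D) ((`|M| + 1) * `|G_ n x - G x|))).
    apply: le_Rintegral => //.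
    - exact: (integrable_norm (i1 n)).
    - by apply: eq_integrable (integrableZl mD (`|M| + 1) iGn).
    - move=> x Dx; rewrite normrM ler_wpM2r// (le_trans (bth n x Dx))//.
      by rewrite (le_trans (ler_norm _))// lerDl.
  by rewrite RintegralZl// mulrC -ler_pdivlMr.
have E n : \int[m]_(x in D) (th_ n x * G_ n x) =
    \int[m]_(x in D) (th_ n x * (G_ n x - G x)) + \int[m]_(x in D) (th_ n x * G x).
  rewrite -(RintegralD mD (i1 n) (i2 n)); apply: eq_Rintegral => x _; ring.
rewrite (funext E : (fun n => _) = _) -[X in _ --> X]add0r.
exact: cvgD c1 c2.
Qed.

Lemma le_norm_Rintegral_sub (t r : R) (w : R -> R) : t <= r ->
  mu.-integrable `[0, r] (EFin \o w) ->
  `|\int[mu]_(s in `[0, t]) w s| <= \int[mu]_(s in `[0, r]) `|w s|.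
Proof.
move=> tr iw; have sub : `[0, t]%classic `<=` `[0, r]%classic by apply: subset_itvl.
have iwt : mu.-integrable `[0, t] (EFin \o w) by exact: integrable_itvS sub iw.
apply: le_trans; first by apply: le_normr_Rintegral iwt.
have fin (u : R) : mu.-integrable `[0, u] (EFin \o w) ->
    (\int[mu]_(s in `[0%R, u]) `|w s|%:E)%E \is a fin_num.
  by move=> i; apply: integrable_fin_num => //; exact: (integrable_norm i).
apply: fine_le; [exact: fin|exact: fin|].
apply: ge0_subset_integral => //.
by apply/measurable_EFinP; apply: measurableT_comp => //; apply/measurable_EFinP; case/integrableP: iw.
Qed.

Variables (r : R) (g : R -> R).
Hypotheses (r0 : 0 < r) (ig : mu.-integrable `[0, r] (EFin \o g)).
Let I t := \int[mu]_(s in `[0, t]) g s.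

Let ig_sub t : t <= r -> mu.-integrable `[0, t] (EFin \o g).
Proof. by move=> tr; apply: integrable_itvS ig; apply: subset_itvl. Qed.

Lemma primitive_continuous : {within `[0, r], continuous I}.
Proof. by apply: parameterized_integral_continuous => //; exact: ltW. Qed.

Lemma primitive_measurable : measurable_fun `[0, r] I.
Proof. by apply: subspace_continuous_measurable_fun => //; exact: primitive_continuous. Qed.

Lemma primitive_bounded : exists2 M : R, 0 <= M & forall t, 0 <= t <= r -> `|I t| <= M.
Proof.
exists (\int[mu]_(s in `[0, r]) `|g s|); first exact: Rintegral_ge0.
move=> t /andP[t0 tr].
exact: (le_norm_Rintegral_sub tr ig).
Qed.

(** Continuous functions are dense in L1, and L1 convergence of the densities is
    uniform convergence of the primitives.  The derivative is two-sided at 0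
    because the primitives start from -1. *)
Lemma approx_primitive : exists (g_ I_ : nat -> R -> R), [/\
  forall k, continuous (g_ k),
  forall (k : nat) (t : R), -1 < t -> is_derive t (1 : R) (I_ k) (g_ k t),
  forall k, I_ k 0 = 0,
  (\int[mu]_(t in `[0, r]) `|g_ k t - g t|) @[k --> \oo] --> (0 : R) &
  forall (k : nat) (t : R), 0 <= t <= r ->
    `|I_ k t - I t| <= \int[mu]_(t in `[0, r]) `|g_ k t - g t|].
Proof.
have mr : (mu `[0%R, r]%classic < +oo)%E by rewrite lebesgue_measure_itv/= lte_fin r0 -EFinB ltry.
have [g_ [cg ig_ cvg]] := approximation_continuous_integrable (measurable_itv _) mr ig.
pose P (k : nat) (t : R) : R := \int[mu]_(s in `[-1, t]) g_ k s.
exists g_, (fun (k : nat) (t : R) => P k t - P k 0).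
have icpt (k : nat) (a b : R) : mu.-integrable `[a, b] (EFin \o g_ k).
  apply: continuous_compact_integrable; first exact: segment_compact.
  by apply: continuous_subspaceT; exact: cg.
have dP (k : nat) (t : R) : -1 < t -> is_derive t (1 : R) (P k) (g_ k t).
  move=> t1; have tt : t < t + 1 by rewrite ltrDl.
  have [dP eP] := continuous_FTC1_closed tt (icpt k _ _) t1 (cg k t).
  by split; [exact: dP|rewrite -derive1E].
have iB k : mu.-integrable `[0, r] (EFin \o (fun t => g_ k t - g t)).
  by apply: eq_integrable (integrableB _ (icpt k 0 r) ig).
have iBn k : mu.-integrable `[0, r] (EFin \o (fun t => `|g_ k t - g t|)).
  exact: (integrable_norm (iB k)).
split => //.
- move=> k t t1; apply: (is_derive_eq (is_deriveB (dP k t t1) (is_derive_cst (P k 0) t 1))).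
  by rewrite subr0.
- by move=> k; rewrite subrr.
- have E (k : nat) : \int[mu]_(t in `[0, r]) `|g_ k t - g t| =
      fine (\int[mu]_(z in `[0%R, r]) `|(g z - g_ k z)%:E|)%E.
    by rewrite /Rintegral; congr fine; apply: eq_integral => t _ /=; rewrite distrC.
  by rewrite (funext E); apply: fine_cvg.
- move=> k t /andP[t0 tr].
  have sub : `[0, t]%classic `<=` `[0, r]%classic by apply: subset_itvl.
  have -> : P k t - P k 0 = \int[mu]_(s in `[0, t]) g_ k s.
    have D (s : R) : 0 <= s <= t -> is_derive s (1 : R) (P k) (g_ k s).
      by move=> /andP[s0 _]; apply: dP; exact: lt_le_trans s0.
    rewrite (Rintegral_derive t0 D)//.
    by apply: continuous_subspaceT; exact: cg.
  rewrite /I -(RintegralB _ (icpt k 0 t) (ig_sub tr))//.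
  exact: (le_norm_Rintegral_sub tr (iB k)).
Qed.

Lemma primitive_cvg0 : forall e : R, 0 < e -> exists2 a : R, 0 < a < r &
  forall t, 0 <= t <= a -> `|I t| <= e.
Proof.
move=> e e0; have cI := primitive_continuous.
have [_ /cvgrPdist_le/(_ _ e0) c0 _] := (continuous_within_itvP _ r0).1 cI.
have I0 : I 0 = 0 by rewrite /I set_itv1 Rintegral_set1.
have [d /= d0 H] := c0.
pose a := Num.min (d / 2) (r / 2).
have a0 : 0 < a by rewrite lt_min !divr_gt0.
exists a; first by rewrite a0 /a gt_min [r / 2 < r]gtr_pMr// invf_lt1// ltr1n orbT.
move=> t /andP[t0 ta]; move: t0; rewrite le_eqVlt => /predU1P[<-|t0].
  by rewrite I0 normr0 ltW.
have := H t _ t0; rewrite I0 !sub0r !normrN; apply.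
rewrite /= sub0r normrN gtr0_norm//; apply: (le_lt_trans ta).
by rewrite /a gt_min gtr_pMr// invf_lt1// ltr1n.
Qed.

(** The chain rule for an absolutely continuous primitive, obtained from that of
    its C1 approximations. *)
Lemma trunc_chain n : trunc n (I r) = \int[mu]_(t in `[0, r]) (dtrunc n (I t) * g t).
Proof.
have [g_ [I_ [cg dI I0 cI bI]]] := approx_primitive.
have cI_ k : {within `[0, r], continuous (I_ k)}.
  apply: within_continuous_itv => t; rewrite in_itv/= => /andP[t0 _].
  by apply: derive_continuous_at; apply: dI; exact: lt_le_trans t0.
have icpt k : mu.-integrable `[0, r] (EFin \o g_ k).
  apply: continuous_compact_integrable; first exact: segment_compact.
  by apply: continuous_subspaceT; exact: cg.
have cvgI (t : R) : 0 <= t <= r -> I_ k t @[k --> \oo] --> I t.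
  move=> tr; apply/cvgrPdist_le => e e0; move/cvgr0Pnorm_le: cI => /(_ _ e0).
  apply: filterS => k; rewrite distrC => kE; apply: (le_trans (bI k t tr)).
  by apply: le_trans kE; exact: ler_norm.
have mdt : measurable_fun setT (@dtrunc R n).
  by apply: continuous_measurable_fun; exact: continuous_dtrunc.
have L : \int[mu]_(t in `[0, r]) (dtrunc n (I_ k t) * g_ k t) @[k --> \oo] -->
    \int[mu]_(t in `[0, r]) (dtrunc n (I t) * g t).
  apply: (@Rintegral_cvg_mul _ _ mu `[0, r] g_ (fun k t => dtrunc n (I_ k t)) g
            (fun t => dtrunc n (I t)) 7) => //.
  - move=> k; apply: measurableT_comp mdt _.
    by apply: subspace_continuous_measurable_fun => //; exact: cI_.
  - exact: measurableT_comp mdt primitive_measurable.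
  - by move=> k t _; exact: dtrunc_le.
  - move=> t /=; rewrite in_itv/= => tr.
    by apply: continuous_cvg; [exact: continuous_dtrunc|exact: cvgI].
have rr : 0 <= r <= r by rewrite (ltW r0) lexx.
have L2 : trunc n (I_ k r) @[k --> \oo] --> trunc n (I r).
  by apply: continuous_cvg; [exact: continuous_trunc|exact: cvgI].
apply: (cvg_unique _ L2) => //; apply: cvg_trans L; apply: near_eq_cvg.
apply: nearW => k.
have D (t : R) : 0 <= t <= r ->
    is_derive t (1 : R) (trunc n \o I_ k) (dtrunc n (I_ k t) * g_ k t).
  move=> /andP[t0 _]; apply: is_derive1_comp; first exact: is_derive_trunc.
  by apply: dI; exact: lt_le_trans t0.
rewrite (Rintegral_derive (ltW r0) D).
  by rewrite /= I0 [trunc n 0]/trunc mul0r subr0.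
apply: within_continuous_itv => t; rewrite in_itv/= => /andP[t0 _].
apply: cvgM; last exact: cg.
apply: continuous_cvg; first exact: continuous_dtrunc.
by apply: derive_continuous_at; apply: dI; exact: lt_le_trans t0.
Qed.

End Approximation.

(** * Divergence of radial fields with integrable profile *)
Section RadialDivergenceL1.
Context {R : realType}.
Local Notation R3 := (R * R * R)%type.
Local Notation mu := (@lebesgue_measure R).

(** By [trunc_chain], trunc_n(I(t)) is the integral of trunc_n'(I) g over [0,t].
    In the limit, I(t) is the integral of g over the part of [0,t] where I is
    nonzero; hence g restricted to the set I = 0 has zero primitive. *)
Lemma primitive_zero_ae (r : R) (g : R -> R) : 0 < r ->
  mu.-integrable `[0, r] (EFin \o g) ->
  {ae mu, forall t, 0 < t < r -> \int[mu]_(s in `[0, t]) g s = 0 -> g t = 0}.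
Proof.
move=> r0 ig; pose I (t : R) := \int[mu]_(s in `[0, t]) g s.
have igt (t : R) : t <= r -> mu.-integrable `[0, t] (EFin \o g).
  by move=> tr; apply: integrable_itvS ig; apply: subset_itvl.
have mIg : measurable_fun `[0, r] (fun s => (I s != 0)%R%:R * g s).
  apply: measurable_funM; last by apply/measurable_EFinP; exact: measurable_int ig.
  apply: measurable_natb; apply: measurable_neg.
  apply: measurable_fun_eqr; last exact: measurable_cst.
  exact: primitive_measurable r0 ig.
have key (t : R) : 0 < t <= r ->
    mu.-integrable `[0, t] (EFin \o (fun s => (I s != 0)%R%:R * g s)) /\
    \int[mu]_(s in `[0, t]) ((I s != 0)%R%:R * g s) = I t.
  move=> /andP[t0 tr]; have it := igt t tr.
  have sub : `[0, t]%classic `<=` `[0, r]%classic by apply: subset_itvl.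
  have mI : measurable_fun `[0, t] I := primitive_measurable t0 it.
  have mg : measurable_fun `[0, t] g by apply/measurable_EFinP; exact: measurable_int it.
  have mdt n : measurable_fun `[0, t] (fun s => dtrunc n (I s) * g s).
    apply: measurable_funM => //; apply: measurableT_comp mI.
    by apply: continuous_measurable_fun; exact: continuous_dtrunc.
  have i7 : mu.-integrable `[0, t] (EFin \o (fun s => 7 * `|g s|)).
    have -> : EFin \o (fun s => 7 * `|g s|) = (fun s => 7%:E * (EFin \o (fun s => `|g s|%R)) s)%E.
      by apply/funext.
    by apply: integrableZl => //; exact: (integrable_norm it).
  have cv : {ae mu, forall s, `[0, t]%classic s ->
      dtrunc n (I s) * g s @[n --> \oo] --> (I s != 0)%R%:R * g s}.
    by apply: aeW => s _; apply: cvgM; [exact: dtrunc_cvg|exact: cvg_cst].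
  have bd n (s : R) : `[0, t]%classic s -> `|dtrunc n (I s) * g s| <= 7 * `|g s|.
    by move=> _; rewrite normrM ler_wpM2r// dtrunc_le.
  have mIgt : measurable_fun `[0, t] (fun s => (I s != 0)%R%:R * g s).
    by apply: measurable_funS mIg.
  have [//|i c] := @Rintegral_dominated R _ _ mu `[0, t]%classic
    (fun n s => dtrunc n (I s) * g s) _ _ _ mdt mIgt cv i7 bd.
  split => //; apply: (cvg_unique _ c) => //.
  rewrite -(funext (fun n => trunc_chain t0 it n)); exact: trunc_cvg.
pose h s := g s - (I s != 0)%R%:R * g s.
have rr : 0 < r <= r by rewrite r0 lexx.
have ih : mu.-integrable `[0, r] (EFin \o h).
  by apply: eq_integrable (integrableB _ ig (key r rr).1).
have h0 (t : R) : 0 < t <= r -> \int[mu]_(s in `[0, t]) h s = 0.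
  move=> t0r; have [i e] := key t t0r; have /andP[t0 tr] := t0r.
  by rewrite (RintegralB _ (igt t tr) i)// e subrr.
have : {ae mu, forall t, 0 < t < r -> h t = 0}.
  apply: ae_itv_eq0.
    move=> a b a0 ab br; apply: integrable_itvS ih => t /=; rewrite !in_itv/= => /andP[at_ tb].
    by rewrite (le_trans (ltW a0))//= (le_trans tb)// ltW.
  move=> a b a0 ab br.
  have b0 := lt_trans a0 ab.
  have ihb : mu.-integrable `[0, b] (EFin \o h).
    by apply: integrable_itvS ih; apply: subset_itvl; exact: ltW.
  have := @Rintegral_itvB _ h (BLeft 0) (BRight b) a ihb.
  rewrite !bnd_simp => /(_ (ltW a0) (ltW ab)).
  rewrite !h0 ?a0 ?b0 ?(ltW br) ?(ltW (lt_trans ab br))// subrr => H.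
  rewrite -Rintegral_itv_obnd_cbnd -?H//.
  by apply: integrable_itvS ihb => t /=; rewrite !in_itv/= => /andP[at_ ->]; rewrite (ltW (lt_trans a0 at_)).
apply: filterS; first exact: (ae_filter_ringOfSetsType mu).
move=> t ht tr I0; have := ht tr.
by rewrite /h /I I0 eqxx mul0r subr0.
Qed.

Lemma test_fun_bounded (r : R) (phi : R3 -> R) : test_fun (eball r) phi ->
  continuous phi /\ exists M, forall x, `|phi x| <= M.
Proof.
move=> tphi; have [smphi _ _] := tphi; have [cphi _] := smphi [::].
split => //; apply: (compact_support_bounded (M := r) cphi) => x xr.
by have [] := test_fun_outside tphi xr.
Qed.

Lemma test_fun_radial_derivative (r : R) (phi : R3 -> R) : test_fun (eball r) phi ->
  continuous (fun x => dot x (grad phi x)) /\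
  exists M, forall x, `|dot x (grad phi x)| <= M.
Proof.
move=> tphi; have [smphi _ _] := tphi.
have cdphi i : continuous (partial i phi) := (smphi [:: i]).1.
have cpsi : continuous (fun x => dot x (grad phi x)).
  move=> x; have cc (i : 'I_3) := @continuous_coord R i x.
  by apply: cvgD; [apply: cvgD|]; apply: cvgM; [exact: (cc 0)|exact: cdphi|exact: (cc 1)|exact: cdphi|exact: (cc 2%:R)|exact: cdphi].
split => //; apply: (compact_support_bounded (M := r) cpsi) => x xr.
have [_ d0] := test_fun_outside tphi xr.
by rewrite /dot /grad/= !d0 !mulr0 !addr0.
Qed.

(** Polar coordinates turn weighted L1 convergence of the profiles into L1
    convergence on the ball, where [th] is bounded. *)
Lemma radial_cvg (r : R) (u_ : nat -> R -> R) (u : R -> R) (th : R3 -> R) (M : R) :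
  (forall k, measurable_fun `[0, r[ (u_ k)) -> measurable_fun `[0, r[ u ->
  (forall k, mu.-integrable `[0, r[ (fun t => (t ^+ 2 * u_ k t)%:E)) ->
  mu.-integrable `[0, r[ (fun t => (t ^+ 2 * u t)%:E) ->
  (\int[mu]_(t in `[0, r[) (t ^+ 2 * `|u_ k t - u t|)) @[k --> \oo] --> (0 : R) ->
  measurable_fun (eball r) th -> (forall x, eball r x -> `|th x| <= M) ->
  (\int[mu3]_(x in eball r) (th x * u_ k (enorm x))) @[k --> \oo] -->
  \int[mu3]_(x in eball r) (th x * u (enorm x)).
Proof.
move=> mu_ mu' iu_ iu cu mth bth.
have iB k : mu.-integrable `[0, r[ (fun t => (t ^+ 2 * `|u_ k t - u t|)%:E).
  have := integrable_norm (integrableB _ (iu_ k) iu).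
  move=> /(_ (measurable_itv _)); apply: eq_integrable => // t _ /=.
  by rewrite -mulrBr normrM ger0_norm// sqr_ge0.
have mB k : measurable_fun `[0, r[ (fun t => `|u_ k t - u t|).
  by apply: measurableT_comp => //; exact: measurable_funB.
have := @Rintegral_cvg_mul R _ _ (@mu3 R) (eball r) (fun k x => u_ k (enorm x))
  (fun _ x => th x) (fun x => u (enorm x)) th M (@measurable_eball R r).
apply => //.
- by move=> k; apply/integrable_radial.
- exact/integrable_radial.
- rewrite (funext (fun k => Rintegral_radial (mB k) (iB k))).
  by rewrite -[X in _ --> X](mulr0 (@sphere_const R)); apply: cvgMr; exact: cu.
- by move=> x _; exact: cvg_cst.
Qed.

Lemma radial_divergence_continuous (g : R -> R) (a b r : R) (phi : R3 -> R) :
  0 < a -> continuous g -> (forall t, t <= a -> g t = 0) ->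
  (forall t, b <= t -> g t = 0) -> test_fun (eball r) phi ->
  \int[mu3]_(x in eball r)
    ((\int[mu]_(s in `[0, enorm x]) g s) * enorm x ^- 3 * dot x (grad phi x)) =
  - \int[mu3]_(x in eball r) (g (enorm x) * enorm x ^- 2 * phi x).
Proof.
move=> a0 cg ga gb tphi.
have [Phi dPhi _] := compact_primitive cg ga gb.
have FTC (x y : R) : x <= y -> \int[mu]_(t in `[x, y]) g t = Phi y - Phi x.
  move=> xy; apply: Rintegral_derive => //.
  exact: continuous_subspaceT.
have Phia (t : R) : t <= a -> Phi t = Phi a.
  move=> ta; apply/esym/eqP; rewrite -subr_eq0 -FTC//; apply/eqP.
  rewrite (@eq_Rintegral _ _ _ mu _ (cst 0)); first by rewrite Rintegral_cst// mul0r.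
  by move=> s; rewrite inE/= in_itv/= => /andP[_ /ga].
have dG (t : R) : is_derive t (1 : R) (fun t => Phi t - Phi a) (g t).
  by apply: (is_derive_eq (is_deriveB (dPhi t) (is_derive_cst (Phi a) t 1))); rewrite subr0.
have G0 (t : R) : t <= a -> Phi t - Phi a = 0 by move=> /Phia ->; rewrite subrr.
rewrite -(radial_divergence a0 dG cg G0 ga tphi).
by apply: eq_Rintegral => x _; rewrite FTC ?enorm_ge0// (Phia 0)// ltW.
Qed.

Let clamp (t : R) : R := Num.min 1 (Num.max 0 t).

Let continuous_clamp : continuous clamp.
Proof.
move=> t; apply: (@continuous_min R R (cst 1) (fun t => Num.max 0 t)); first exact: cvg_cst.
by apply: (@continuous_max R R (cst 0) id); [exact: cvg_cst|exact: cvg_id].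
Qed.

Let clamp0 t : t <= 0 -> clamp t = 0.
Proof. by move=> t0; rewrite /clamp max_l// min_r. Qed.

Let clamp1 t : 1 <= t -> clamp t = 1.
Proof. by move=> t1; rewrite /clamp max_r ?min_l// (le_trans ler01). Qed.

Let clamp_bnd t : 0 <= clamp t <= 1.
Proof. by rewrite /clamp le_min ler01 le_max lexx ge_min lexx. Qed.

(** Density of continuous profiles.  The approximations are multiplied by a fixed
    cutoff [chi], equal to 1 on the support of g, so that they too vanish near
    the origin and the singular weight r^-3 stays bounded uniformly in k. *)
Lemma radial_divergence_L1 (g : R -> R) (a r : R) (phi : R3 -> R) :
  0 < a -> 0 < r -> mu.-integrable `[0, r] (EFin \o g) ->
  (forall t, 0 <= t <= a -> g t = 0) -> test_fun (eball r) phi ->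
  \int[mu3]_(x in eball r)
    ((\int[mu]_(s in `[0, enorm x]) g s) * enorm x ^- 3 * dot x (grad phi x)) =
  - \int[mu3]_(x in eball r) (g (enorm x) * enorm x ^- 2 * phi x).
Proof.
move=> a0 r0 ig g0 tphi.
have [g_ [_ [cg _ _ cI _]]] := approx_primitive r0 ig.
pose b := a / 2; have b0 : 0 < b by rewrite divr_gt0.
have ba : b < a by rewrite /b gtr_pMr// invf_lt1// ltr1n.
(* 0 below b = a/2 and beyond r + 1, and 1 on [a, r] *)
pose chi (t : R) := clamp (t / b - 1) * clamp (r + 1 - t).
have cchi : continuous chi.
  move=> t; apply: cvgM; apply: continuous_cvg; try exact: continuous_clamp.
    by apply: cvgB; [apply: cvgMl; exact: cvg_id|exact: cvg_cst].
  by apply: cvgB; [exact: cvg_cst|exact: cvg_id].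
have chib (t : R) : t <= b -> chi t = 0.
  by move=> tb; rewrite /chi clamp0 ?mul0r// subr_le0 ler_pdivrMr// mul1r.
have chir (t : R) : r + 1 <= t -> chi t = 0.
  by move=> tb; rewrite /chi [clamp (_ - t)]clamp0 ?mulr0// subr_le0.
have chi1 (t : R) : a <= t <= r -> chi t = 1.
  move=> /andP[at_ tr]; rewrite /chi !clamp1 ?mul1r//.
    by lra.
  by rewrite lerBrDr ler_pdivlMr// /b; lra.
have chi_bnd t : `|chi t| <= 1.
  have /andP[c0 c1] := clamp_bnd (t / b - 1); have /andP[d0 d1] := clamp_bnd (r + 1 - t).
  by rewrite ger0_norm ?mulr_ge0// mulr_ile1.
pose G k t := chi t * g_ k t.
have cG k : continuous (G k) by move=> t; apply: cvgM; [exact: cchi|exact: cg].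
have Gb k t : t <= b -> G k t = 0 by move=> /chib; rewrite /G => ->; rewrite mul0r.
have iG k (x y : R) : mu.-integrable `[x, y] (EFin \o G k).
  apply: continuous_compact_integrable; first exact: segment_compact.
  by apply: continuous_subspaceT; exact: cG.
have ig_ k (x y : R) : mu.-integrable `[x, y] (EFin \o g_ k).
  apply: continuous_compact_integrable; first exact: segment_compact.
  by apply: continuous_subspaceT; exact: cg.
have gchi t : 0 <= t <= r -> g t = chi t * g t.
  move=> /andP[t0 tr]; have [ta|at_] := leP t a; first by rewrite g0 ?t0// mulr0.
  by rewrite chi1 ?mul1r// (ltW at_).
have leG k t : 0 <= t <= r -> `|G k t - g t| <= `|g_ k t - g t|.
  move=> tr; rewrite {1}(gchi t tr) /G -mulrBr normrM ler_piMl//.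
pose del k := \int[mu]_(t in `[0, r]) `|g_ k t - g t|.
have iBg k : mu.-integrable `[0, r] (EFin \o (fun t => g_ k t - g t)).
  by apply: eq_integrable (integrableB _ (ig_ k 0 r) ig).
have iBG k : mu.-integrable `[0, r] (EFin \o (fun t => G k t - g t)).
  by apply: eq_integrable (integrableB _ (iG k 0 r) ig).
have intG k : \int[mu]_(t in `[0, r]) `|G k t - g t| <= del k.
  apply: le_Rintegral => //; [exact: (integrable_norm (iBG k))|exact: (integrable_norm (iBg k))|].
  by move=> t /=; rewrite in_itv/= => tr; exact: leG.
pose T t := \int[mu]_(s in `[0, t]) g s.
pose T_ k t := \int[mu]_(s in `[0, t]) G k s.
have TT k t : 0 <= t <= r -> `|T_ k t - T t| <= del k.
  move=> /andP[t0 tr]; apply: le_trans (intG k).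
  have igt : mu.-integrable `[0, t] (EFin \o g).
    by apply: integrable_itvS ig; apply: subset_itvl.
  rewrite /T_ /T -(RintegralB _ (iG k 0 t) igt)//.
  exact: (le_norm_Rintegral_sub tr (iBG k)).
have Gcvg : \int[mu]_(t in `[0, r]) `|G k t - g t| @[k --> \oo] --> (0 : R).
  apply: (squeeze_cvgr _ (cvg_cst 0) cI); apply: nearW => k; apply/andP; split; last exact: intG.
  exact: Rintegral_ge0.
have T0 t : 0 <= t <= b -> T t = 0.
  move=> /andP[t0 tb]; rewrite /T (@eq_Rintegral _ _ _ mu _ (cst 0)).
    by rewrite Rintegral_cst// mul0r.
  move=> s; rewrite inE/= in_itv/= => /andP[s0 st]; apply: g0.
  by rewrite s0 (le_trans st)// (le_trans tb)// ltW.
have T_0 k t : 0 <= t <= b -> T_ k t = 0.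
  move=> /andP[t0 tb]; rewrite /T_ (@eq_Rintegral _ _ _ mu _ (cst 0)).
    by rewrite Rintegral_cst// mul0r.
  by move=> s; rewrite inE/= in_itv/= => /andP[s0 st]; apply: Gb; exact: le_trans tb.
have sub : `[0, r[%classic `<=` `[0, r]%classic.
  by apply: subset_itvl; rewrite bnd_simp.
have meas (w : R -> R) m : measurable_fun `[0, r[ w -> measurable_fun `[0, r[ (fun t => w t * t ^- m).
  move=> mw; apply: measurable_funM => //.
  apply: measurableT_comp; first exact: measurable_inv.
  exact: measurable_funX.
have mint (w : R -> R) : mu.-integrable `[0, r] (EFin \o w) -> measurable_fun `[0, r[ w.
  move=> iw; apply/measurable_EFinP.
  have := integrable_itvS sub iw; exact: measurable_int.
have intw3 (w : R -> R) : {within `[0, r], continuous w} -> (forall t, 0 <= t <= b -> w t = 0) ->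
    mu.-integrable `[0, r[ (fun t => (t ^+ 2 * (w t * t ^- 3))%:E).
  move=> cw w0; have iw : mu.-integrable `[0, r] (EFin \o w).
    by apply: continuous_compact_integrable => //; exact: segment_compact.
  have iw' : mu.-integrable `[0, r[ (fun t => (b^-1 * `|w t|)%:E).
    have -> : (fun t => (b^-1 * `|w t|)%:E) = (fun t => b^-1%:E * (EFin \o (fun s => `|w s|%R)) t)%E.
      by apply/funext.
    apply: integrableZl => //; apply: integrable_norm; exact: integrable_itvS sub iw.
  apply: le_integrable iw' => //.
    by apply/measurable_EFinP; apply: measurable_sqr_fun; apply: meas; exact: mint.
  move=> t /=; rewrite in_itv/= => /andP[t0 tr]; rewrite lee_fin.
  have [tb|bt] := leP t b; first by rewrite w0 ?t0// mul0r mulr0 normr0.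
  have tp := lt_trans b0 bt.
  have -> : t ^+ 2 * (w t * t ^- 3) = t^-1 * w t by field; rewrite gt_eqF.
  rewrite !normrM normr_id ler_wpM2r// !gtr0_norm ?invr_gt0// lef_pV2 ?posrE// ltW//.
have cT : {within `[0, r], continuous T} := primitive_continuous r0 ig.
have cT_ k : {within `[0, r], continuous (T_ k)} := primitive_continuous r0 (iG k 0 r).
have iT (w : R -> R) : {within `[0, r], continuous w} -> mu.-integrable `[0, r] (EFin \o w).
  by move=> cw; apply: continuous_compact_integrable => //; exact: segment_compact.
have intw2 (w : R -> R) : mu.-integrable `[0, r] (EFin \o w) -> w 0 = 0 ->
    mu.-integrable `[0, r[ (fun t => (t ^+ 2 * (w t * t ^- 2))%:E).
  move=> iw w0; apply: eq_integrable (integrable_itvS sub iw) => // t _ /=.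
  have [->|t0] := eqVneq t 0; first by rewrite w0 mul0r mulr0.
  by congr EFin; field.
have [cphi0 [N1 bphi]] := test_fun_bounded tphi.
pose psi x := dot x (grad phi x).
have [cpsi [N2 bpsi]] := test_fun_radial_derivative tphi.
have meball (w : R3 -> R) : continuous w -> measurable_fun (eball r) w.
  by move=> cw; apply: measurable_funTS; exact: continuous_measurable3.
have L1 : \int[mu3]_(x in eball r) (psi x * (T_ k (enorm x) * enorm x ^- 3)) @[k --> \oo] -->
    \int[mu3]_(x in eball r) (psi x * (T (enorm x) * enorm x ^- 3)).
  apply: (@radial_cvg r (fun k t => T_ k t * t ^- 3) (fun t => T t * t ^- 3) psi N2) => //.
  - by move=> k; apply: meas; apply: mint; exact: iT.
  - by apply: meas; apply: mint; exact: iT.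
  - by move=> k; apply: intw3 => //; exact: T_0.
  - exact: intw3.
  - have bc : r / b * del k @[k --> \oo] --> (0 : R).
      by rewrite -(mulr0 (r / b)); apply: cvgMr; exact: cI.
    apply: (squeeze_cvgr _ (cvg_cst 0) bc); apply: nearW => k; apply/andP; split.
      by apply: Rintegral_ge0 => t _; rewrite mulr_ge0// sqr_ge0.
    have iD := integrable_norm (integrableB _ (intw3 _ (cT_ k) (T_0 k)) (intw3 _ cT T0)).
    have ic : mu.-integrable `[0, r[ (EFin \o cst (del k / b)).
      by apply: integrable_itvS sub _; apply: iT => t; exact: cvg_cst.
    have -> : r / b * del k = \int[mu]_(t in `[0, r[) (cst (del k / b)) t.
      rewrite Rintegral_cst//.
      have L : mu `[0%R, r[%classic = r%:E by rewrite lebesgue_measure_itv/= lte_fin r0/= sube0.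
      have -> : r / b * del k = del k / b * fine r%:E by rewrite /=; ring.
      by rewrite -L.
    apply: le_Rintegral => //.
      by move: (iD (measurable_itv _)); apply: eq_integrable => // t _ /=; rewrite -mulrBr normrM ger0_norm ?sqr_ge0.
    move=> t /=; rewrite in_itv/= => /andP[t0 tr].
    have del0 : 0 <= del k by exact: Rintegral_ge0.
    have [tb|bt] := leP t b.
      by rewrite T0 ?T_0 ?t0// !mul0r subr0 normr0 mulr0 divr_ge0// ltW.
    have tp := lt_trans b0 bt.
    have -> : t ^+ 2 * `|T_ k t * t ^- 3 - T t * t ^- 3| = `|T_ k t - T t| * t^-1.
      rewrite -mulrBl normrM (ger0_norm (_ : 0 <= t ^- 3)) ?invr_ge0 ?exprn_ge0//.
      by field; rewrite gt_eqF.
    apply: ler_pM => //; first by rewrite invr_ge0.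
      by apply: TT; rewrite t0 ltW.
    by rewrite lef_pV2 ?posrE// ltW.
  - exact: meball.
  - by move=> x _; exact: bpsi.
have L2 : \int[mu3]_(x in eball r) (phi x * (G k (enorm x) * enorm x ^- 2)) @[k --> \oo] -->
    \int[mu3]_(x in eball r) (phi x * (g (enorm x) * enorm x ^- 2)).
  apply: (@radial_cvg r (fun k t => G k t * t ^- 2) (fun t => g t * t ^- 2) phi N1) => //.
  - by move=> k; apply: meas; apply: mint.
  - by apply: meas; apply: mint.
  - by move=> k; apply: intw2 => //; apply: Gb; exact: ltW.
  - by apply: intw2 => //; apply: g0; rewrite lexx ltW.
  - apply: (squeeze_cvgr _ (cvg_cst 0) cI); apply: nearW => k; apply/andP; split.
      by apply: Rintegral_ge0 => t _; rewrite mulr_ge0// sqr_ge0.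
    apply: le_trans (intG k); rewrite -Rintegral_itv_bndo_bndc.
      rewrite le_eqVlt; apply/orP; left; apply/eqP; apply: eq_Rintegral => t _.
      have [->|t0] := eqVneq t 0.
        by rewrite expr0n mul0r Gb ?ltW// g0 ?subrr ?normr0// lexx ltW.
      rewrite -mulrBl normrM (ger0_norm (_ : 0 <= t ^- 2)) ?invr_ge0 ?sqr_ge0//.
      by field.
    by apply: integrable_itvS sub _; exact: (integrable_norm (iBG k)).
  - exact: meball.
have C (u v : R3 -> R) : \int[mu3]_(x in eball r) (u x * v x) =
    \int[mu3]_(x in eball r) (v x * u x).
  by apply: eq_Rintegral => x _; rewrite mulrC.
have E k : \int[mu3]_(x in eball r) (psi x * (T_ k (enorm x) * enorm x ^- 3)) =
    - \int[mu3]_(x in eball r) (phi x * (G k (enorm x) * enorm x ^- 2)).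
  have := radial_divergence_continuous b0 (cG k) (Gb k) _ tphi => /(_ (r + 1)) H.
  rewrite [LHS]C [X in - X]C H// => t tr.
  by rewrite /G chir// mul0r.
have L3 : \int[mu3]_(x in eball r) (psi x * (T_ k (enorm x) * enorm x ^- 3)) @[k --> \oo] -->
    - \int[mu3]_(x in eball r) (phi x * (g (enorm x) * enorm x ^- 2)).
  by rewrite (funext E); exact: cvgN L2.
have U := cvg_unique (@Rhausdorff R) L1 L3.
rewrite [LHS]C [X in - X]C; exact: U.
Qed.

End RadialDivergenceL1.

(** * Relative derivatives *)
Section RelativeDerivative.
Context {R : realType}.
Local Notation mu := (@lebesgue_measure R).

Lemma is_derive_in (A : set R) (f : R -> R) (x : R) :
  nbhs x A -> derivable_in A f x -> is_derive x (1 : R) f (derive_in A f x).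
Proof.
move=> xA; rewrite /derivable_in /derive_in; set l := lim _ => cf.
apply/is_derive1_caratheodory.
exists (fun z => if z == x then l else (f z - f x) / (z - x)); split; last by rewrite eqxx.
  move=> z; case: eqVneq => [->|zx]; first by rewrite !subrr mulr0.
  by rewrite divfK// subr_eq0.
rewrite /prop_for /continuous_at eqxx; apply/cvgrPdist_lt => e e0.
have /cvgrPdist_lt/(_ _ e0) H : (f y - f x) / (y - x) @[y --> within A x^'] --> l by exact: cf.
have H' : \forall y \near x, y != x -> A y -> `|l - (f y - f x) / (y - x)| < e by exact: H.
apply: filterS2 xA H' => z Az Hz; case: eqVneq => [_|zx]; last exact: Hz.
by rewrite subrr normr0.
Qed.

Lemma within_continuous_comp_in (A B : set R) (h g : R -> R) : (forall t, B t -> A (g t)) ->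
  {within A, continuous h} -> {within B, continuous g} -> {within B, continuous (h \o g)}.
Proof.
move=> BA /subspace_continuousP ch /subspace_continuousP cg; apply/subspace_continuousP => t Bt.
apply: cvg_comp (ch _ (BA _ Bt)) => V wV.
have H : \forall s \near t, B s -> A (g s) -> V (g s) := cg _ Bt _ wV.
by apply: filterS H => s Hs Bs; exact: Hs Bs (BA _ Bs).
Qed.

Lemma continuous_composition2 (F : R -> R -> R) (B : set R) (u v : R -> R) (G : set_system R)
    (x : R) : Filter G -> open B -> B (v x) ->
  {within [set: R] `*` B, continuous (fun p : R * R => F p.1 p.2)} ->
  u y @[y --> G] --> u x -> v y @[y --> G] --> v x ->
  F (u y) (v y) @[y --> G] --> F (u x) (v x).
Proof.
move=> FG oB Bx cF cu cv.
have oSB : open ([set: R] `*` B).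
  rewrite (_ : _ `*` _ = (fun p : R * R => p.2) @^-1` B).
    by apply: open_comp oB => p _; exact: cvg_snd.
  by apply/seteqP; split => [p [_ ?]//|p ?]; split.
rewrite continuous_open_subspace// in cF.
have := cF (u x, v x); rewrite inE/= => /(_ (conj I Bx)) cx.
exact: cvg_comp (cvg_pair cu cv) cx.
Qed.

Lemma mvt_is_derive (f df : R -> R) (a b : R) : a < b ->
  (forall x : R, a < x < b -> is_derive x (1 : R) f (df x)) ->
  {within `[a, b], continuous f} ->
  exists2 c, a < c < b & f b - f a = df c * (b - a).
Proof.
move=> ab dF cf.
have dF' x : x \in `]a, b[ -> is_derive x (1 : R) f (df x).
  by rewrite in_itv/=; exact: dF.
by have [c] := MVT ab dF' cf; rewrite in_itv; exists c.
Qed.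

Lemma Rintegral_derive_oo (F f : R -> R) (a b : R) : a <= b ->
  (forall x : R, a < x < b -> is_derive x (1 : R) F (f x)) ->
  {within `[a, b], continuous F} -> {within `[a, b], continuous f} ->
  \int[mu]_(t in `[a, b]) f t = F b - F a.
Proof.
rewrite le_eqVlt => /predU1P[->|ab] dF cF cf.
  by rewrite set_itv1 Rintegral_set1 subrr.
rewrite /Rintegral (@continuous_FTC2 _ f F)//.
- have [_ Fa Fb] := (continuous_within_itvP _ ab).1 cF; split => //.
  by move=> x; rewrite in_itv/= => xab; case: (dF x xab).
- by move=> x; rewrite in_itv/= => xab; rewrite derive1E; apply: derive_val; exact: dF.
Qed.

End RelativeDerivative.

Lemma ae_exists_itvoo {R : realType} (p : R -> Prop) (a b : R) : a < b ->
  {ae (@lebesgue_measure R), forall t, p t} -> exists2 t, a < t < b & p t.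
Proof.
move=> ab [N [mN N0 pN]]; apply: contrapT => H.
have abN : `]a, b[%classic `<=` N.
  move=> t /=; rewrite in_itv/= => tab; apply: pN => /= pt; apply: H; by exists t.
have : (@lebesgue_measure R `]a, b[%classic <= lebesgue_measure N)%E.
  by apply: le_measure; rewrite ?inE//; exact: measurable_itv.
by rewrite [X in (_ <= X)%E]N0 lebesgue_measure_itv/= lte_fin ab -EFinB lee_fin subr_le0 leNgt ab.
Qed.

(** * The radial equilibrium and its weights *)
Section Equilibrium.
Context {R : realType}.
Local Notation R3 := (R * R * R)%type.
Local Notation mu := (@lebesgue_measure R).
Variables (P : R -> R -> R) (gamma0 alpha0 : R) (rho0 S0 f : R -> R) (Rs : R).
Hypotheses (HP : pressure_law P gamma0 alpha0)
  (HE : equilibrium P gamma0 alpha0 rho0 S0 f Rs).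
Local Notation drho := (drho0 rho0 Rs).
Local Notation dfr := (df rho0 f).
Local Notation W1 t := (dPtilde P rho0 f (rho0 t) / rho0 t).
Local Notation W2 := (schwarzschild P rho0 S0 f).

Let Rs0 : 0 < Rs := eq_Rs HE.

Lemma rho0_continuous : {within `[0, Rs], continuous rho0}.
Proof. by have [] := eq_rho0_C1 HE. Qed.

Lemma drho0_continuous : {within `[0, Rs], continuous drho}.
Proof. by have [_ [_ []]] := eq_rho0_C1 HE. Qed.

Lemma rho0_is_derive t : 0 < t < Rs -> is_derive t (1 : R) rho0 (drho t).
Proof.
move=> tR; have [_ [dr _]] := eq_rho0_C1 HE; apply: is_derive_in.
  by apply: filterS (near_in_itvoo tR) => y /=; rewrite !in_itv/= => /andP[y0 yR]; rewrite !ltW.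
by apply: dr; rewrite /= in_itv/=; case/andP: tR => t0 tR; rewrite !ltW.
Qed.

Let sub_cont (h : R -> R) a b : 0 <= a -> b <= Rs -> {within `[0, Rs], continuous h} ->
  {within `[a, b], continuous h}.
Proof.
move=> a0 bR; apply: continuous_subspaceW => t /=; rewrite !in_itv/= => /andP[at_ tb].
by rewrite (le_trans a0)// (le_trans tb).
Qed.

Lemma rho0_lt a b : 0 <= a -> a < b -> b <= Rs -> rho0 b < rho0 a.
Proof.
move=> a0 ab bR; have dab (x : R) : a < x < b -> 0 < x < Rs.
  by move=> /andP[ax xb]; rewrite (le_lt_trans a0)// (lt_le_trans xb).
have [|c cab E] := mvt_is_derive (df := drho) ab _ (sub_cont a0 bR rho0_continuous).
  by move=> x /dab; exact: rho0_is_derive.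
rewrite -subr_lt0 E pmulr_llt0 ?subr_gt0//; apply: (eq_rho0_decr HE); exact: dab.
Qed.

Lemma rho0_gt0 t : 0 <= t < Rs -> 0 < rho0 t.
Proof. by move=> /andP[t0 tR]; rewrite -(eq_rho0_boundary HE) rho0_lt. Qed.

Lemma rho0_le t : 0 <= t <= Rs -> rho0 t <= rho0 0.
Proof.
move=> /andP[]; rewrite le_eqVlt => /predU1P[<-//|t0] tR; apply: ltW; exact: rho0_lt.
Qed.

Lemma drho0_bounded : exists2 C : R, 0 < C & forall t, 0 <= t <= Rs -> `|drho t| <= C.
Proof.
have cn : {within `[0, Rs], continuous (fun t => `|drho t|)}.
  by move=> t; apply: continuous_cvg; [exact: norm_continuous|exact: drho0_continuous].
have [c _ Hc] := EVT_max (ltW Rs0) cn.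
exists (`|drho c| + 1); first by rewrite ltr_wpDl.
move=> t tR; apply: (le_trans (Hc t _)); first by rewrite in_itv.
by rewrite lerDl.
Qed.

(** The profile is C1 up to the boundary and vanishes there. *)
Lemma rho0_le_dist : exists2 C : R, 0 < C &
  forall t, 0 <= t <= Rs -> rho0 t <= C * (Rs - t).
Proof.
have [C C0 HC] := drho0_bounded; exists C => // t /andP[t0].
rewrite le_eqVlt => /predU1P[->|tR]; first by rewrite (eq_rho0_boundary HE) subrr mulr0.
have [|c /andP[tc cR] E] := mvt_is_derive (df := drho) tR _ (sub_cont t0 (lexx Rs) rho0_continuous).
  by move=> x /andP[tx xR]; apply: rho0_is_derive; rewrite (le_lt_trans t0).
have : - (rho0 Rs - rho0 t) <= C * (Rs - t).
  rewrite E -mulNr ler_wpM2r// ?subr_ge0 ?(ltW tR)//.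
  apply: (le_trans (ler_norm _)); rewrite normrN; apply: HC.
  by rewrite (le_trans t0 (ltW tc)) ltW.
by rewrite (eq_rho0_boundary HE) sub0r opprK.
Qed.

Let f_continuous : {within `[0, rho0 0], continuous f}.
Proof. by have [] := eq_f_C1 HE. Qed.

Let df_continuous : {within `[0, rho0 0], continuous dfr}.
Proof. by have [_ [_ []]] := eq_f_C1 HE. Qed.

Let comp_rho (h : R -> R) : {within `[0, rho0 0], continuous h} ->
  {within `[0, Rs], continuous (h \o rho0)}.
Proof.
move=> ch; apply: within_continuous_comp_in ch rho0_continuous => t /=.
rewrite !in_itv/= => tR; rewrite rho0_le//; case/andP: tR => t0.
rewrite le_eqVlt => /predU1P[->|tR]; first by rewrite (eq_rho0_boundary HE) lexx.
by rewrite ltW// rho0_gt0// t0.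
Qed.

Lemma df_rho0_continuous : {within `[0, Rs], continuous (dfr \o rho0)}.
Proof. exact: comp_rho df_continuous. Qed.

Lemma S0_continuous : {within `[0, Rs[, continuous S0}.
Proof.
apply: (@subspace_eq_continuous _ _ _ (f \o rho0)).
  by move=> t; rewrite inE/= in_itv/= => tR; exact: (esym (eq_S0 HE tR)).
apply: continuous_subspaceW (comp_rho f_continuous).
by apply: subset_itvl; rewrite bnd_simp.
Qed.

Lemma S0_is_derive t : 0 < t < Rs -> is_derive t (1 : R) S0 (dfr (rho0 t) * drho t).
Proof.
move=> tR; have /andP[t0 tRs] := tR.
have rt : 0 < rho0 t < rho0 0 by rewrite rho0_gt0 ?(ltW t0)// rho0_lt// ltW.
have [_ [dff _]] := eq_f_C1 HE.
have D1 : is_derive (rho0 t) (1 : R) f (dfr (rho0 t)).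
  apply: is_derive_in.
    by apply: filterS (near_in_itvoo rt) => y /=; rewrite !in_itv/= => /andP[y0 yR]; rewrite !ltW.
  by apply: dff; rewrite /= in_itv/=; case/andP: rt => a b; rewrite !ltW.
have D := is_derive1_comp D1 (rho0_is_derive tR).
apply: near_eq_is_derive D => //.
apply: filterS (near_in_itvoo tR) => y /=; rewrite in_itv/= => /andP[y0 yR].
by rewrite (eq_S0 HE)// (ltW y0).
Qed.

Let cont_profile (F : R -> R -> R) :
  {within [set: R] `*` `]0, +oo[, continuous (fun p : R * R => F p.1 p.2)} ->
  {within `[0, Rs[, continuous (fun t => F (S0 t) (rho0 t))}.
Proof.
move=> cF; apply/subspace_continuousP => t tR.
have rt : `]0, +oo[%classic (rho0 t).
  by rewrite /= in_itv/= andbT rho0_gt0//; move: tR; rewrite /= in_itv.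
apply: (continuous_composition2 (within_filter _ _) (rray_open _) rt cF).
  exact: (subspace_continuousP _ _).1 S0_continuous t tR.
have : {within `[0, Rs[, continuous rho0}.
  by apply: continuous_subspaceW rho0_continuous; apply: subset_itvl; rewrite bnd_simp.
by move=> /subspace_continuousP; apply.
Qed.

Let sub_co (h : R -> R) : {within `[0, Rs], continuous h} -> {within `[0, Rs[, continuous h}.
Proof. by apply: continuous_subspaceW; apply: subset_itvl; rewrite bnd_simp. Qed.

Let PS_continuous : {within `[0, Rs[, continuous (fun t => partialS setT P (S0 t) (rho0 t))}.
Proof. by apply: (cont_profile (F := partialS setT P)); have [_ [_ _ []]] := pl_C3 HP. Qed.

Let Prho_continuous : {within `[0, Rs[, continuous (fun t => partialrho P (S0 t) (rho0 t))}.
Proof. by apply: (cont_profile (F := partialrho P)); have [_ [_ _ _ []]] := pl_C3 HP. Qed.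

Let rhoV_continuous : {within `[0, Rs[, continuous (fun t => (rho0 t)^-1)}.
Proof.
apply/subspace_continuousP => t tR.
have rt : rho0 t != 0 by rewrite gt_eqF// rho0_gt0//; move: tR; rewrite /= in_itv.
apply: cvgV => //; exact: (subspace_continuousP _ _).1 (sub_co rho0_continuous) t tR.
Qed.

Let cM (u v : R -> R) (A : set R) : {within A, continuous u} -> {within A, continuous v} ->
  {within A, continuous (fun t => u t * v t)}.
Proof. by move=> cu cv t; apply: cvgM; [exact: cu|exact: cv]. Qed.

Lemma schwarzschild_continuous : {within `[0, Rs[, continuous W2}.
Proof.
apply: cM rhoV_continuous; apply: cM; last exact: sub_co df_rho0_continuous.
by move=> t; apply: cvgN; exact: PS_continuous.
Qed.

Lemma w1_continuous : {within `[0, Rs[, continuous (fun t => W1 t)}.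
Proof.
apply: cM rhoV_continuous.
apply: (@subspace_eq_continuous _ _ _ (fun t => partialrho P (S0 t) (rho0 t)
                       + partialS setT P (S0 t) (rho0 t) * dfr (rho0 t))).
  by move=> t; rewrite inE/= in_itv/= => tR; have [] := eq_dPtilde HE tR.
move=> t; apply: cvgD; first exact: Prho_continuous.
exact: cM PS_continuous (sub_co df_rho0_continuous) t.
Qed.

Lemma w1_gt0 t : 0 <= t < Rs -> 0 < W1 t.
Proof. by move=> tR; have [_ d0] := eq_dPtilde HE tR; rewrite divr_gt0// rho0_gt0. Qed.

(** The limit of P~'(rho)/rho^(gamma0-1) at vacuum bounds w1 = P~'(rho0)/rho0 from
    below.  Dividing by rho0 <= 1 gives the first bound, which has the form of
    the upper bound on the Schwarzschild coefficient; gamma0 < 2 gives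
    rho <= rho^(gamma0-1), hence the second. *)
Lemma w1_near_vacuum : exists2 L : R, 0 < L & exists2 t1 : R, 0 <= t1 < Rs &
  forall t, t1 <= t < Rs -> L * rho0 t `^ (gamma0 - 1) <= W1 t /\ L <= W1 t.
Proof.
have ab : f 0 - 1 < f 0 + 1 by lra.
have [K lK] := pl_leading HP ab.
have fab : f 0 - 1 <= f 0 <= f 0 + 1 by lra.
have [L0 cL] := eq_dPtilde_vacuum HE ab fab lK.
set L := gamma0 * K (f 0) in L0 cL.
have L20 : 0 < L / 2 by rewrite divr_gt0.
have /cvgrPdist_lt/(_ _ L20) := cL.
move=> [d /= d0 Hd].
have [C C0 HC] := rho0_le_dist.
pose e := Num.min d 1; have e0 : 0 < e by rewrite lt_min d0 ltr01.
exists (L / 2) => //; exists (Num.max 0 (Rs - e / (2 * C))).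
  rewrite le_max lexx/= gt_max Rs0/= gtrBl divr_gt0// mulr_gt0//.
move=> t; rewrite ge_max => /andP[/andP[t0 td] tR].
have r0 : 0 < rho0 t by rewrite rho0_gt0// t0.
have re : rho0 t < e.
  apply: (le_lt_trans (HC t _)); first by rewrite t0 ltW.
  have : Rs - t <= e / (2 * C) by lra.
  rewrite -(ler_pM2l C0) => /le_lt_trans; apply.
  by rewrite (_ : C * _ = e / 2); [lra|field; rewrite gt_eqF].
have /andP[rd r1] : (rho0 t < d) && (rho0 t < 1) by move: re; rewrite /e lt_min.
have /= := Hd (rho0 t) _ r0; rewrite sub0r normrN gtr0_norm// => /(_ rd).
set p := rho0 t `^ (gamma0 - 1).
have p0 : 0 < p by exact: powR_gt0.
have pr : rho0 t <= p.
  rewrite -{1}(powRr1 (ltW r0)); apply: ger_powR; first by rewrite r0 ltW.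
  by have /andP[_ g2] := pl_gamma0 HP; lra.
rewrite ltr_norml => /andP[_ H].
have H1 : L / 2 * p <= dPtilde P rho0 f (rho0 t).
  by rewrite -ler_pdivlMr// ltW//; lra.
have H2 : L / 2 * p <= W1 t.
  rewrite ler_pdivlMr//; apply: le_trans H1; exact: ler_piMr (mulr_ge0 (ltW L20) (ltW p0)) (ltW r1).
split => //; rewrite ler_pdivlMr//; apply: le_trans H1; exact: ler_wpM2l (ltW L20) _ _ pr.
Qed.

Let sub_c (h : R -> R) t1 : t1 < Rs -> {within `[0, Rs[, continuous h} ->
  {within `[0, t1], continuous h}.
Proof. by move=> t1R; apply: continuous_subspaceW; apply: subset_itvl; rewrite bnd_simp. Qed.

Lemma w1_lower : exists2 c : R, 0 < c & forall t, 0 <= t < Rs -> c <= W1 t.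
Proof.
have [L L0 [t1 /andP[t10 t1R] H]] := w1_near_vacuum.
have [u] := EVT_min t10 (sub_c t1R w1_continuous).
rewrite in_itv/= => /andP[u0 ut1] Hu.
exists (Num.min L (W1 u)).
  by rewrite lt_min L0 w1_gt0// u0 (le_lt_trans ut1).
move=> t /andP[t0 tR]; rewrite ge_min; have [tt1|t1t] := leP t t1.
  by apply/orP; right; apply: Hu; rewrite in_itv/= t0.
by apply/orP; left; apply: (H t _).2; rewrite (ltW t1t).
Qed.

(** Near the boundary both sides compare with rho0^(gamma0-1); elsewhere a maximum
    and a positive lower bound suffice. *)
Lemma schwarzschild_le_w1 : exists2 C : R, 0 < C &
  forall t, 0 <= t < Rs -> W2 t <= C * W1 t.
Proof.
have [L L0 [t1 /andP[t10 t1R] H]] := w1_near_vacuum.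
have [c c0 Hc] := w1_lower.
have [C [d /= d0 HC]] := eq_schw_bound HE.
pose t2 := Num.max t1 (Rs - d / 2).
have t20 : 0 <= t2 by rewrite le_max t10.
have t2R : t2 < Rs by rewrite gt_max t1R/=; lra.
have [u _ Hu] := EVT_max t20 (sub_c t2R schwarzschild_continuous).
exists (Num.max (`|C| / L + 1) (`|W2 u| / c)).
  by rewrite lt_max; apply/orP; left; rewrite ltr_wpDl// divr_ge0// ltW.
move=> t /andP[t0 tR].
have w0 : 0 < W1 t by rewrite w1_gt0// t0.
have [tt2|t2t] := leP t t2.
  apply: (le_trans (Hu t _)); first by rewrite in_itv/= t0.
  apply: (le_trans (ler_norm _)).
  apply: (@le_trans _ _ (`|W2 u| / c * W1 t)); last first.
    by rewrite ler_wpM2r ?(ltW w0)// le_max lexx orbT.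
  rewrite mulrAC ler_pdivlMr// ler_wpM2l//; apply: Hc; by rewrite t0.
move: t2t; rewrite /t2 gt_max => /andP[t1t dt].
have /andP[_ HCt] : 0 < W2 t <= C * rho0 t `^ (gamma0 - 1).
  by apply: HC => //=; rewrite gtr0_norm; lra.
apply: (@le_trans _ _ (`|C| / L * W1 t)); last first.
  by rewrite ler_wpM2r ?(ltW w0)// le_max lerDl ler01.
apply: (le_trans HCt).
have [HL _] := H t (ltac:(by rewrite (ltW t1t) tR)).
apply: (@le_trans _ _ (`|C| / L * (L * rho0 t `^ (gamma0 - 1)))).
  by rewrite mulrA divfK ?gt_eqF// ler_wpM2r ?powR_ge0// ler_norm.
by rewrite ler_wpM2l// divr_ge0// ltW.
Qed.

(** An almost everywhere positive continuous function is nonnegative. *)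
Lemma schwarzschild_ge0 t : 0 <= t < Rs -> 0 <= W2 t.
Proof.
move=> tR; have /andP[t0 tRs] := tR; rewrite leNgt; apply/negP => wt0.
have /cvgrPdist_lt/(_ (- W2 t)) := (subspace_continuousP _ _).1 schwarzschild_continuous t tR.
rewrite oppr_gt0 => /(_ wt0) [d /= d0 Hd].
have tb : t < Num.min Rs (t + d) by rewrite lt_min tRs ltrDl.
have [s] := ae_exists_itvoo tb (eq_schw_pos HE).
rewrite lt_min => /andP[ts /andP[sR sd]] /(_ _).
rewrite (le_lt_trans t0 ts) sR => /(_ isT).
have := Hd s; rewrite /= ltr0_norm ?subr_lt0// opprB => /(_ _) H.
have : `|W2 t - W2 s| < - W2 t.
  apply: H; first by lra.
  by rewrite /= in_itv/= sR andbT (le_trans t0)// ltW.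
by rewrite ltr_norml => /andP[A B]; lra.
Qed.

(** The Schwarzschild coefficient is -P_S f'(rho0)/rho0 with P_S > 0. *)
Lemma df_rho0_lt0_ae : {ae mu, forall t, 0 < t < Rs -> dfr (rho0 t) < 0}.
Proof.
have := eq_schw_pos HE; apply: filterS; first exact: (ae_filter_ringOfSetsType mu).
move=> t Ht tR; have /andP[t0 tRs] := tR; move/(_ tR): Ht.
have r0 : 0 < rho0 t by rewrite rho0_gt0// (ltW t0).
rewrite /schwarzschild pmulr_lgt0 ?invr_gt0// mulNr oppr_gt0 pmulr_rlt0//.
exact: (pl_S_pos HP).
Qed.

Lemma df_rho0_le0 t : 0 < t < Rs -> dfr (rho0 t) <= 0.
Proof.
move=> tR; have /andP[t0 tRs] := tR.
have tR' : 0 <= t < Rs by rewrite (ltW t0).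
have r0 : 0 < rho0 t by rewrite rho0_gt0.
have := schwarzschild_ge0 tR'.
rewrite /schwarzschild pmulr_lge0 ?invr_gt0// mulNr oppr_ge0 pmulr_rle0//.
exact: (pl_S_pos HP).
Qed.

(** The derivative f'(rho0) rho0' is nonnegative, so S0 is nondecreasing; if it
    took the same value at a and b it would be constant in between, against
    f'(rho0) < 0 almost everywhere. *)
Lemma S0_lt a b : 0 < a -> a < b -> b < Rs -> S0 a < S0 b.
Proof.
move=> a0 ab bR.
have inR (x : R) : a <= x <= b -> 0 < x < Rs.
  by move=> /andP[ax xb]; rewrite (lt_le_trans a0)// (le_lt_trans xb).
have cS (x y : R) : a <= x -> y <= b -> {within `[x, y], continuous S0}.
  move=> ax yb; apply: continuous_subspaceW S0_continuous => s /=; rewrite !in_itv/= => /andP[xs sy].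
  by rewrite (le_trans (ltW a0) (le_trans ax xs)) (le_lt_trans sy (le_lt_trans yb bR)).
have mono (x y : R) : a <= x -> x <= y -> y <= b -> S0 x <= S0 y.
  move=> ax; rewrite le_eqVlt => /predU1P[->//|xy] yb.
  have [|c /andP[xc cy] E] := mvt_is_derive (df := fun t => dfr (rho0 t) * drho t) xy _ (cS x y ax yb).
    move=> z /andP[xz zy]; apply: S0_is_derive; apply: inR.
    by rewrite (le_trans ax (ltW xz)) (le_trans (ltW zy)).
  have cR : 0 < c < Rs by apply: inR; rewrite (le_trans ax (ltW xc)) (le_trans (ltW cy)).
  have d1 := ltW (eq_rho0_decr HE cR); have d2 := df_rho0_le0 cR.
  by rewrite -subr_ge0 E; apply: mulr_ge0; [exact: mulr_le0|rewrite subr_ge0 ltW].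
rewrite lt_neqAle mono ?lexx ?(ltW ab)// andbT; apply/negP => /eqP E.
have [t /andP[at_ tb] Ht] := ae_exists_itvoo ab df_rho0_lt0_ae.
have tR : 0 < t < Rs by apply: inR; rewrite !ltW.
have const s : a <= s <= b -> S0 s = S0 a.
  by move=> /andP[as_ sb]; apply/eqP; rewrite eq_le {1}E !mono// ?lexx// ltW.
have D0 : is_derive t (1 : R) S0 0.
  apply: near_eq_is_derive (is_derive_cst (S0 a) t 1) => //.
  have tab : t \in `]a, b[ by rewrite in_itv/= at_.
  apply: filterS (near_in_itvoo tab) => s; rewrite in_itv/= => /andP[as_ sb].
  by rewrite const// !ltW.
case: (S0_is_derive tR) => _; case: D0 => _ -> /esym/eqP.
rewrite mulf_eq0 => /orP[/eqP d0|/eqP d0].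
  by move: (Ht tR); rewrite d0 ltxx.
by move: (eq_rho0_decr HE tR); rewrite d0 ltxx.
Qed.

Lemma dot_a0 (x y : R3) : x != 0 -> eball Rs x ->
  dot (a0 rho0 x) y = drho (enorm x) / (rho0 (enorm x) * enorm x) * dot x y.
Proof.
move=> x0 xR; have n0 : 0 < enorm x.
  by rewrite lt_def enorm_ge0 andbT; apply: contra_neq x0; exact: enorm_eq0.
have nR : 0 < enorm x < Rs by rewrite n0.
have pE i : partial i (fun y => rho0 (enorm y)) x = drho (enorm x) * (dot x (e3 i) / enorm x).
  apply: derive_val; exact: is_derive_chain (rho0_is_derive nR) (is_derive_enorm (e3 i) x0).
have r0 : rho0 (enorm x) != 0 by rewrite gt_eqF// rho0_gt0// enorm_ge0.
rewrite !dotE.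
rewrite /a0 /grad; set p0 := partial 0 _ x; set p1 := partial 1 _ x; set p2 := partial 2 _ x.
have cE (c u v w : R) : [/\ coord 0 (c *: (u, v, w)) = c * u, coord 1 (c *: (u, v, w)) = c * v
  & coord 2 (c *: (u, v, w)) = c * w] by [].
have [-> -> ->] := cE (rho0 (enorm x))^-1 p0 p1 p2.
rewrite /p0 /p1 /p2 !pE !dot_e3; move: (coord 0 x) (coord 1 x) (coord _ x) => *; field.
by rewrite r0 gt_eqF.
Qed.

End Equilibrium.

(** * Weighted square-integrable functions *)
Section WeightedL2.
Context {R : realType}.
Local Notation R3 := (R * R * R)%type.
Local Notation mu := (@lebesgue_measure R).

(** Young's inequality |h| <= e/w + w h^2/e.  Keeping e free gives a bound linear
    in e when N = e^2, and lets the two terms be balanced on thin shells. *)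
Lemma weighted_L2_L1 d (T : measurableType d) (m : {measure set T -> \bar R})
    (D : set T) (w h : T -> R) (e N : R) :
  measurable D -> measurable_fun D w -> measurable_fun D h ->
  m.-integrable D (fun x => ((w x)^-1)%:E) ->
  (forall x, D x -> 0 <= w x) -> {ae m, forall x, D x -> 0 < w x} ->
  0 < e -> (normsq m D w h <= N%:E)%E ->
  m.-integrable D (EFin \o h) /\
  \int[m]_(x in D) `|h x| <= e * \int[m]_(x in D) (w x)^-1 + e^-1 * N.
Proof.
move=> mD mw mh iw w0 w1 e0 nh.
have mwh : measurable_fun D (fun x => w x * h x ^+ 2).
  by apply: measurable_funM => //; exact: measurable_funX.
have mw1 : measurable_fun D (fun x => (w x)^-1).
  by apply/measurable_EFinP; exact: measurable_int iw.
have wV0 x : D x -> 0 <= (w x)^-1 by move=> Dx; rewrite invr_ge0 w0.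
have wh0 x : D x -> 0 <= w x * h x ^+ 2 by move=> Dx; rewrite mulr_ge0 ?w0// sqr_ge0.
have mEh : measurable_fun D (fun x => `|(h x)%:E|)%E.
  by apply: measurableT_comp => //; exact/measurable_EFinP.
have le1 : (\int[m]_(x in D) `|(h x)%:E| <=
    \int[m]_(x in D) (e%:E * ((w x)^-1)%:E + (e^-1)%:E * (w x * h x ^+ 2)%:E))%E.
  apply: ae_ge0_le_integral => //.
  - by move=> x Dx; rewrite -!EFinM -EFinD lee_fin addr_ge0// mulr_ge0 ?wV0 ?wh0 ?invr_ge0// ltW.
  - apply: emeasurable_funD; apply: measurable_funeM; exact/measurable_EFinP.
  apply: filterS w1 => x w1x Dx; rewrite lee_fin; have wx := w1x Dx.
  rewrite -subr_ge0.
  have n2 : h x ^+ 2 = `|h x| ^+ 2 by rewrite real_normK ?num_real.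
  have -> : e / w x + e^-1 * (w x * h x ^+ 2) - `|h x| =
      (e * w x)^-1 * ((e - w x * `|h x|) ^+ 2 + e * w x * `|h x|).
    by rewrite n2; field; rewrite !gt_eqF.
  by rewrite mulr_ge0 ?invr_ge0 ?addr_ge0 ?sqr_ge0 ?mulr_ge0// ltW.
have E1 : (\int[m]_(x in D) (e%:E * ((w x)^-1)%:E + (e^-1)%:E * (w x * h x ^+ 2)%:E) =
    e%:E * \int[m]_(x in D) ((w x)^-1)%:E + (e^-1)%:E * normsq m D w h)%E.
  rewrite ge0_integralD//=.
  - rewrite ge0_integralZl ?lee_fin ?(ltW e0)//; last exact/measurable_EFinP.
    rewrite ge0_integralZl ?lee_fin ?invr_ge0 ?(ltW e0)//; exact/measurable_EFinP.
  - by move=> x Dx; rewrite -EFinM lee_fin mulr_ge0 ?wV0// ltW.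
  - by apply: measurable_funeM; exact/measurable_EFinP.
  - by move=> x Dx; rewrite -EFinM lee_fin mulr_ge0 ?wh0 ?invr_ge0// ltW.
  - by apply: measurable_funeM; exact/measurable_EFinP.
have fw : (\int[m]_(x in D) ((w x)^-1)%:E)%E \is a fin_num by exact: integrable_fin_num.
have bound : (\int[m]_(x in D) `|(h x)%:E| <= (e * \int[m]_(x in D) (w x)^-1 + e^-1 * N)%:E)%E.
  apply: (le_trans le1); rewrite E1 EFinD !EFinM fineK//.
  by apply: leeD => //; apply: lee_wpmul2l => //; rewrite lee_fin invr_ge0 ltW.
split.
  apply/integrableP; split; first exact/measurable_EFinP.
  by apply: le_lt_trans bound _; rewrite ltry.
have fh : (\int[m]_(x in D) `|(h x)%:E|)%E \is a fin_num.
  by rewrite ge0_fin_numE ?integral_ge0//; apply: le_lt_trans bound _; rewrite ltry.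
by rewrite -lee_fin; apply: le_trans bound; rewrite fineK.
Qed.

Lemma measurable_sphere (t : R) : measurable [set x : R3 | enorm x = t].
Proof.
rewrite (_ : [set _ | _] = [set x : R3 | enorm x <= t] `\` eball t); last first.
  apply/seteqP; split => x /=; rewrite /eball/=.
    by move=> ->; split => //; rewrite ltxx.
  by move=> [xt /negP]; rewrite -leNgt => tx; apply: le_anti; rewrite xt.
by apply: measurableD; [exact: measurable_cball|exact: measurable_eball].
Qed.

(** Polar coordinates for the indicator of one radius. *)
Lemma mu3_sphere (t : R) : mu3 [set x : R3 | enorm x = t] = 0%E.
Proof.
pose F (s : R) : \bar R := (\1_[set t] s)%:E.
have mF : measurable_fun setT F.
  by apply/measurable_EFinP; exact: measurable_indic.
have := polarE mF (fun s => _); rewrite /F.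
have ms := measurable_sphere t.
rewrite (_ : (fun x : R3 => (\1_[set t] (enorm x))%:E) = EFin \o \1_[set x : R3 | enorm x = t]); last first.
  by apply/funext => x /=; rewrite !indicE; congr ((nat_of_bool _)%:R%:E); rewrite !mem_setE.
rewrite integral_indic// setIT => -> //.
rewrite (ae_eq_integral (cst 0%E)) ?integral0 ?mule0//.
- apply: emeasurable_funM; first by apply/measurable_EFinP; apply: measurable_funX.
  exact: measurable_funTS.
- exists [set t]; split => //; first exact: lebesgue_measure_set1.
  move=> s /= H; apply: contrapT => st; apply: H => _.
  by rewrite indicE memNset// mule0.
Qed.

Lemma ae_not_sphere (t : R) : {ae @mu3 R, forall x, enorm x != t}.
Proof.
exists [set x : R3 | enorm x = t]; split.
- exact: measurable_sphere.
- exact: mu3_sphere.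
- by move=> x /= /negP; rewrite negbK => /eqP.
Qed.

End WeightedL2.

Section Flux.
Context {R : realType}.
Local Notation R3 := (R * R * R)%type.
Local Notation mu := (@lebesgue_measure R).

Lemma smooth1_primitive (Phi psi : R -> R) :
  (forall t, is_derive t (1 : R) Phi (psi t)) -> smooth1 psi -> smooth1 Phi.
Proof. by move=> dPhi spsi [//|n]; exists psi. Qed.

Lemma dotC (x y : R3) : dot x y = dot y x.
Proof. by rewrite /dot; ring. Qed.

Lemma dotZr (c : R) (x y : R3) : dot x (c *: y) = c * dot x y.
Proof. by case: x => [[x1 x2] x3]; case: y => [[y1 y2] y3]; rewrite /dot /GRing.scale/= /GRing.scale/=; ring. Qed.

Lemma dot_cauchy_schwarz (x y : R3) : dot x y ^+ 2 <= dot x x * dot y y.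
Proof.
rewrite /dot -subr_ge0; move: x y => [[x1 x2] x3] [[y1 y2] y3] /=.
have -> : (x1 * x1 + x2 * x2 + x3 * x3) * (y1 * y1 + y2 * y2 + y3 * y3)
   - (x1 * y1 + x2 * y2 + x3 * y3) ^+ 2
   = (x1 * y2 - x2 * y1) ^+ 2 + (x1 * y3 - x3 * y1) ^+ 2 + (x2 * y3 - x3 * y2) ^+ 2 by ring.
by rewrite !addr_ge0// sqr_ge0.
Qed.

Lemma Rintegral_shell (a b r : R) (g : R -> R) : 0 <= a -> a < b -> b <= r ->
  mu.-integrable `[0, r] (EFin \o g) ->
  \int[mu]_(t in `[0, r]) ((a < t < b)%R%:R * g t) = \int[mu]_(t in `[a, b]) g t.
Proof.
move=> a0 ab br ig.
have sub (i : interval R) : (forall t, t \in i -> a <= t <= b) -> mu.-integrable [set` i] (EFin \o g).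
  move=> H; apply: integrable_itvS ig => t /= /H /andP[at_ tb].
  by rewrite in_itv/= (le_trans a0)// (le_trans tb).
rewrite -Rintegral_itv_bndo_bndc; last first.
  by apply: sub => t; rewrite in_itv/= => /andP[-> /ltW].
rewrite -Rintegral_itv_obnd_cbnd; last first.
  by apply: sub => t; rewrite in_itv/= => /andP[/ltW -> /ltW].
rewrite Rintegral_mkcond [RHS]Rintegral_mkcond; apply: eq_Rintegral => t _.
rewrite !patchE !mem_setE !in_itv/=; case: (boolP (a < t < b)) => tab.
  case/andP: tab => at_ tb; rewrite (le_trans a0 (ltW at_)) (le_trans (ltW tb) br)/=.
  by rewrite mul1r.
by rewrite mul0r if_same.
Qed.

Variables (P : R -> R -> R) (gamma0 alpha0 : R) (rho0 S0 f : R -> R) (Rs : R).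
Hypotheses (HP : pressure_law P gamma0 alpha0)
  (HE : equilibrium P gamma0 alpha0 rho0 S0 f Rs).
Variables (q : R3 -> R3) (k1 k2 : R3 -> R).
Hypothesis HB : B_graph P rho0 S0 f Rs q k1 k2.
Local Notation B := (@eball R Rs).
Local Notation drho := (drho0 rho0 Rs).

Let Rs0 : 0 < Rs := eq_Rs HE.
(** Radial test functions see a field q through q.x only. *)
Definition radial_part (x : R3) : R := dot (q x) x.
Local Notation v := radial_part.

Let rhoB x : B x -> 0 < rho0 (enorm x).
Proof. by move=> xB; apply: (rho0_gt0 HE); rewrite enorm_ge0. Qed.

Let sub_co : `[0, Rs[%classic `<=` `[0, Rs]%classic.
Proof. by apply: subset_itvl; rewrite bnd_simp. Qed.

Let mrho : measurable_fun B (fun x => rho0 (enorm x)).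
Proof.
apply: measurable_radial; apply: measurable_funS sub_co _ => //.
by apply: subspace_continuous_measurable_fun => //; exact: (rho0_continuous HE).
Qed.

Let mrhoV : measurable_fun B (fun x => (rho0 (enorm x))^-1).
Proof. by apply: measurableT_comp mrho; exact: measurable_inv. Qed.

Lemma radial_part_measurable : measurable_fun B v.
Proof.
have [[m1 m2 m3 _] _ _ _] := HB.
by apply: measurable_funD; [apply: measurable_funD|]; apply: measurable_funM => //;
  apply: measurable_funTS; apply: continuous_measurable3;
  [exact: continuous_X1|exact: continuous_X2|exact: continuous_X3].
Qed.

Let mqq : measurable_fun B (fun x => dot (q x) (q x)).
Proof.
have [[m1 m2 m3 _] _ _ _] := HB.
by apply: measurable_funD; [apply: measurable_funD|]; apply: measurable_funM.
Qed.

Lemma radial_part_L2 : (normsq mu3 B (fun x => (rho0 (enorm x))^-1)%R v < +oo)%E.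
Proof.
have [[m1 m2 m3 fin] _ _ _] := HB.
have le : (normsq mu3 B (fun x => (rho0 (enorm x))^-1)%R v <=
    (Rs ^+ 2)%:E * \int[mu3]_(x in B) ((rho0 (enorm x))^-1 * dot (q x) (q x))%:E)%E.
  rewrite -ge0_integralZl; last by rewrite lee_fin sqr_ge0.
  - apply: ge0_le_integral.
    + exact: measurable_eball.
    + by move=> x /rhoB r0; rewrite lee_fin mulr_ge0 ?invr_ge0 ?sqr_ge0// ltW.
    + apply/measurable_EFinP; apply: measurable_funM => //.
      by apply: measurable_funX; exact: radial_part_measurable.
    + by apply: measurable_funeM; apply/measurable_EFinP; exact: measurable_funM.
    move=> x xB; rewrite -EFinM lee_fin [X in _ <= X]mulrCA; apply: ler_wpM2l.
      by rewrite invr_ge0 ltW// rhoB.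
    apply: (le_trans (dot_cauchy_schwarz _ _)); rewrite mulrC ler_wpM2r ?dot_ge0//.
    by rewrite -enorm_sqr ler_sqr ?nnegrE ?enorm_ge0// ltW.
  - exact: measurable_eball.
  - by apply/measurable_EFinP; exact: measurable_funM.
  - by move=> x /rhoB r0; rewrite lee_fin mulr_ge0 ?invr_ge0 ?dot_ge0// ltW.
apply: le_lt_trans le _; apply: lte_mul_pinfty => //; by rewrite lee_fin sqr_ge0.
Qed.

(** Young's inequality for the weight 1/rho0, whose inverse is bounded. *)
Lemma radial_part_L1 (D : set R3) (e N : R) : measurable D -> D `<=` B -> 0 < e ->
  (normsq mu3 D (fun x => (rho0 (enorm x))^-1)%R v <= N%:E)%E ->
  mu3.-integrable D (EFin \o v) /\
  \int[mu3]_(x in D) `|v x| <= e * \int[mu3]_(x in D) rho0 (enorm x) + e^-1 * N.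
Proof.
move=> mD DB e0 nN.
have iw : mu3.-integrable D (fun x => (((rho0 (enorm x))^-1)^-1)%:E).
  under eq_fun do rewrite invrK.
  have ic : mu3.-integrable D (cst (rho0 0)%:E).
    apply/integrableP; split => //.
    rewrite integral_cst//= lte_mul_pinfty//.
    by apply: le_lt_trans (mu3_eball_fin Rs); apply: le_measure; rewrite ?inE//; exact: measurable_eball.
  apply: le_integrable ic => //.
  - by apply/measurable_EFinP; apply: measurable_funS mrho => //; exact: measurable_eball.
  - move=> x /DB xB; rewrite /= lee_fin !gtr0_norm ?rhoB ?(eq_rho0_center HE)//.
    by apply: (rho0_le HE); rewrite enorm_ge0 ltW.
have [] := @weighted_L2_L1 _ _ _ (@mu3 R) D (fun x => (rho0 (enorm x))^-1) v e N mD
  (measurable_funS (@measurable_eball R Rs) DB mrhoV)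
  (measurable_funS (@measurable_eball R Rs) DB radial_part_measurable) iw _ _ e0 nN.
- by move=> x /DB /rhoB r0; rewrite invr_ge0 ltW.
- by apply: aeW => x /DB /rhoB r0; rewrite invr_gt0.
have -> : \int[mu3]_(x in D) (rho0 (enorm x))^-1^-1 = \int[mu3]_(x in D) rho0 (enorm x).
  by apply: eq_Rintegral => x _; rewrite invrK.
by [].
Qed.

Lemma radial_part_integrable : mu3.-integrable B (EFin \o v).
Proof.
have fin := radial_part_L2.
have f0 : (0 <= normsq mu3 B (fun x => (rho0 (enorm x))^-1)%R v)%E.
  by apply: integral_ge0 => x /rhoB r0; rewrite lee_fin mulr_ge0 ?invr_ge0 ?sqr_ge0// ltW.
have [//|i _] := @radial_part_L1 B 1 (fine (normsq mu3 B (fun x => (rho0 (enorm x))^-1) v))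
  (@measurable_eball R Rs) (@subset_refl _ _) ltr01 _ => //.
by rewrite fineK// ge0_fin_numE.
Qed.

End Flux.

Section XSpace.
Context {R : realType}.
Local Notation R3 := (R * R * R)%type.
Local Notation mu := (@lebesgue_measure R).

Lemma ae_impl d (T : measurableType d) (m : {measure set T -> \bar R}) (p q : T -> Prop) :
  {ae m, forall x, p x} -> (forall x, p x -> q x) -> {ae m, forall x, q x}.
Proof. by move=> mp pq; apply: filterS mp. Qed.

Lemma Rintegral_zero_off d (T : measurableType d) (m : {measure set T -> \bar R})
    (D B : set T) (g : T -> R) : D `<=` B -> (forall x, B x -> ~ D x -> g x = 0) ->
  \int[m]_(x in B) g x = \int[m]_(x in D) g x.
Proof.
move=> DB g0; rewrite Rintegral_mkcond [RHS]Rintegral_mkcond; apply: eq_Rintegral => x _.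
rewrite !patchE; case: ifPn => xB; case: ifPn => xD //.
  by rewrite inE in xB; apply: g0 => // Dx; rewrite notin_setE in xD.
by rewrite inE in xD; rewrite notin_setE in xB; case: xB; exact: DB.
Qed.

Definition shell (a b : R) : set R3 := [set x | a <= enorm x <= b].

Lemma measurable_shell a b : measurable (shell a b).
Proof.
rewrite (_ : shell a b = [set x : R3 | enorm x <= b] `\` eball a); last first.
  apply/seteqP; split => x; rewrite /shell /eball/=.
    by move=> /andP[ax xb]; split => //; apply/negP; rewrite -leNgt.
  by move=> [xb /negP]; rewrite -leNgt => ->.
by apply: measurableD; [exact: measurable_cball|exact: measurable_eball].
Qed.

Lemma shell_sub_cball a b : shell a b `<=` [set x : R3 | enorm x <= b].
Proof. by move=> x /andP[]. Qed.

Lemma cball_sub_eball b r : b < r -> [set x : R3 | enorm x <= b] `<=` eball r.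
Proof. by move=> br x xb; exact: le_lt_trans xb br. Qed.

Variables (P : R -> R -> R) (gamma0 alpha0 : R) (rho0 S0 f : R -> R) (Rs : R).
Hypotheses (HP : pressure_law P gamma0 alpha0)
  (HE : equilibrium P gamma0 alpha0 rho0 S0 f Rs).
Local Notation B := (@eball R Rs).
Local Notation w1 := (w1 P rho0 f).
Local Notation w2 := (w2 P rho0 S0 f).

Lemma w1_measurable : measurable_fun B w1.
Proof.
apply: (@measurable_radial R _ _ Rs (fun t => dPtilde P rho0 f (rho0 t) / rho0 t)).
by apply: subspace_continuous_measurable_fun => //; exact: w1_continuous HP HE.
Qed.

Lemma w2_measurable : measurable_fun B w2.
Proof.
apply: (@measurable_radial R _ _ Rs (schwarzschild P rho0 S0 f)).
by apply: subspace_continuous_measurable_fun => //; exact: schwarzschild_continuous HP HE.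
Qed.

Lemma w1_pos x : B x -> 0 < w1 x.
Proof. by move=> xB; apply: (w1_gt0 HE); rewrite enorm_ge0. Qed.

Lemma w2_nonneg x : B x -> 0 <= w2 x.
Proof. by move=> xB; apply: (schwarzschild_ge0 HP HE); rewrite enorm_ge0. Qed.

Lemma w2_pos_ae : {ae @mu3 R, forall x, B x -> 0 < w2 x}.
Proof.
have h0 : {ae @mu3 R, forall x, x != 0}.
  exists [set 0]; split; [exact: measurable_set0|exact: mu3_set0|].
  by move=> x /= /negP; rewrite negbK => /eqP.
have h1 := ae_radial (eq_schw_pos HE).
apply: filterS2 h0 h1; first exact: (ae_filter_ringOfSetsType (@mu3 R)).
by move=> x x0 H xB; exact: H.
Qed.

Lemma mu3_fin_sub (D : set R3) : measurable D -> D `<=` B -> (mu3 D < +oo)%E.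
Proof.
move=> mD DB; apply: le_lt_trans (mu3_eball_fin Rs).
by apply: le_measure; rewrite ?inE//; exact: measurable_eball.
Qed.

Lemma normsq_sub (D : set R3) (w h : R3 -> R) : measurable D -> D `<=` B ->
  measurable_fun B w -> measurable_fun B h -> (forall x, B x -> 0 <= w x) ->
  (normsq mu3 D w h <= normsq mu3 B w h)%E.
Proof.
move=> mD DB mw mh w0; apply: ge0_subset_integral => //.
- exact: measurable_eball.
- by apply/measurable_EFinP; apply: measurable_funM => //; exact: measurable_funX.
- by move=> x /w0 wx; rewrite lee_fin mulr_ge0// sqr_ge0.
Qed.

(** The weight w1 is bounded below, so its inverse is integrable. *)
Lemma X1_L1 : exists2 A : R, 0 <= A & forall (h : R3 -> R) (e : R), measurable_fun B h ->
  0 < e -> (normsq mu3 B w1 h <= (e ^+ 2)%:E)%E ->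
  mu3.-integrable B (EFin \o h) /\ \int[mu3]_(x in B) `|h x| <= e * A.
Proof.
have [c c0 Hc] := w1_lower HP HE.
have iw : mu3.-integrable B (fun x => ((w1 x)^-1)%:E).
  have ic : mu3.-integrable B (cst (c^-1)%:E).
    apply/integrableP; split => //.
    rewrite integral_cst//=; last exact: measurable_eball.
    by rewrite lte_mul_pinfty//; exact: mu3_eball_fin.
  apply: le_integrable ic; first exact: measurable_eball.
    apply/measurable_EFinP; apply: measurableT_comp w1_measurable; exact: measurable_inv.
  move=> x xB; rewrite /= lee_fin !gtr0_norm ?invr_gt0 ?w1_pos//.
  by rewrite lef_pV2 ?posrE ?w1_pos//; apply: Hc; rewrite enorm_ge0.
exists (\int[mu3]_(x in B) (w1 x)^-1 + 1).
  by rewrite addr_ge0//; apply: Rintegral_ge0 => x xB; rewrite invr_ge0 ltW// w1_pos.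
move=> h e mh e0 nh.
have [] := @weighted_L2_L1 _ _ _ (@mu3 R) B w1 h e _ (@measurable_eball R Rs) w1_measurable mh iw _ _ e0 nh.
- by move=> x /w1_pos/ltW.
- by apply: aeW => x /w1_pos.
by move=> ih; rewrite mulrDr mulr1 expr2 mulKf ?gt_eqF.
Qed.

(** The inverse of w2 is integrable away from the boundary only. *)
Lemma X2_L1 (b : R) : b < Rs -> exists2 A : R, 0 <= A &
  forall (h : R3 -> R) (e : R), measurable_fun B h ->
  0 < e -> (normsq mu3 B w2 h <= (e ^+ 2)%:E)%E ->
  mu3.-integrable [set x | enorm x <= b] (EFin \o h) /\
  \int[mu3]_(x in [set x | enorm x <= b]) `|h x| <= e * A.
Proof.
move=> bR; pose D := [set x : R3 | enorm x <= b].
have DB : D `<=` B := cball_sub_eball bR.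
have mD : measurable D := measurable_cball b.
have iw : mu3.-integrable D (fun x => ((w2 x)^-1)%:E).
  exact: (eq_schw_inv HE (@compact_cball R b) DB).
exists (\int[mu3]_(x in D) (w2 x)^-1 + 1).
  by rewrite addr_ge0//; apply: Rintegral_ge0 => x /DB xB; rewrite invr_ge0 w2_nonneg.
move=> h e mh e0 nh.
have nh' := le_trans (normsq_sub mD DB w2_measurable mh w2_nonneg) nh.
have [] := @weighted_L2_L1 _ _ _ (@mu3 R) D w2 h e _ mD (measurable_funS (@measurable_eball R Rs) DB w2_measurable)
  (measurable_funS (@measurable_eball R Rs) DB mh) iw _ _ e0 nh'.
- by move=> x /DB/w2_nonneg.
- by apply: (@ae_impl _ _ (@mu3 R) _ _ w2_pos_ae) => x H /DB.
by move=> ih; rewrite mulrDr mulr1 expr2 mulKf ?gt_eqF.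
Qed.

Lemma normsq_bound (D : set R3) (w h : R3 -> R) : (forall x, D x -> 0 <= w x) ->
  (normsq mu3 D w h < +oo)%E ->
  exists2 e : R, 0 < e & (normsq mu3 D w h <= (e ^+ 2)%:E)%E.
Proof.
move=> w0 fin; have n0 : (0 <= normsq mu3 D w h)%E.
  by apply: integral_ge0 => x /w0 wx; rewrite lee_fin mulr_ge0// sqr_ge0.
have fn : normsq mu3 D w h \is a fin_num by rewrite ge0_fin_numE.
have f0 : 0 <= fine (normsq mu3 D w h) by exact: fine_ge0.
exists (fine (normsq mu3 D w h) + 1); first by rewrite ltr_wpDl.
rewrite -[leLHS]fineK// lee_fin sqrrD expr1n mulr1.
by move: (fine _) f0 => y y0; rewrite mulr2n; nra.
Qed.

Lemma in_X_integrable (h1 h2 : R3 -> R) : in_X P rho0 S0 f Rs h1 h2 ->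
  [/\ measurable_fun B h1, measurable_fun B h2, mu3.-integrable B (EFin \o h1) &
  forall b, b < Rs -> mu3.-integrable [set x | enorm x <= b] (EFin \o h2)].
Proof.
move=> [[mh1 f1] [mh2 f2]].
have [e1 e10 n1] := normsq_bound (fun x xB => ltW (w1_pos xB)) f1.
have [e2 e20 n2] := normsq_bound w2_nonneg f2.
have [A1 _ H1] := X1_L1; split => //; first exact: (H1 h1 e1 mh1 e10 n1).1.
by move=> b /X2_L1[A2 _ H2]; exact: (H2 h2 e2 mh2 e20 n2).1.
Qed.

End XSpace.

Lemma ae_not_sphere2 {R : realType} (a b : R) :
  {ae @mu3 R, forall x, enorm x != a /\ enorm x != b}.
Proof.
have := @filterS2 _ _ (ae_filter_ringOfSetsType (@mu3 R)) _ _ _ _ (ae_not_sphere a) (ae_not_sphere b).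
by apply=> x.
Qed.

(** * Flux identities for the domain of B *)
Section ShellBump.
Context {R : realType}.
Local Notation R3 := (R * R * R)%type.
Variables a b : R.
Hypotheses (a0 : 0 < a) (ab : a < b).

Let b0 : 0 < b := lt_trans a0 ab.

Let sq0 (x y : R) : 0 <= x -> 0 <= y -> (x ^+ 2 < y ^+ 2) = (x < y).
Proof. by move=> x0 y0; rewrite ltr_sqr ?nnegrE. Qed.

Let ab2 : a ^+ 2 <= b ^+ 2.
Proof. by rewrite ler_sqr ?nnegrE ltW. Qed.

Lemma bump_shell_eq0 n (x : R3) : ~ shell a b x ->
  bump (a ^+ 2) (b ^+ 2) n (enorm x ^+ 2) = 0.
Proof.
move=> xS; rewrite bump_eq0//; apply/negP.
rewrite !sq0 ?enorm_ge0 ?(ltW a0) ?(ltW b0)//.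
by move=> /andP[ax xb]; apply: xS; rewrite /shell/= !ltW.
Qed.

Lemma measurable_bump_sqr n : measurable_fun setT (fun t : R => bump (a ^+ 2) (b ^+ 2) n (t ^+ 2)).
Proof.
apply: continuous_measurable_fun => t.
apply: (@continuous_comp _ _ _ (fun t : R => t ^+ 2) (bump (a ^+ 2) (b ^+ 2) n)).
  exact: exprn_continuous.
by apply: smooth1_continuous; exact: smooth1_bump.
Qed.

Lemma bump_shell_cvg (g : R3 -> R) : mu3.-integrable (shell a b) (EFin \o g) ->
  \int[mu3]_(x in shell a b) (bump (a ^+ 2) (b ^+ 2) n (enorm x ^+ 2) * g x) @[n --> \oo] -->
  \int[mu3]_(x in shell a b) g x.
Proof.
move=> ig; have mg : measurable_fun (shell a b) g.
  by apply/measurable_EFinP; case/integrableP: ig.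
have mpsi n : measurable_fun (shell a b) (fun x => bump (a ^+ 2) (b ^+ 2) n (enorm x ^+ 2)).
  apply: (@measurable_funS _ _ _ _ (eball (b + 1))); first exact: measurable_eball.
    by move=> x /andP[_ xb]; apply: le_lt_trans xb _; rewrite ltrDl.
  apply: (@measurable_radial R _ _ (b + 1) (fun t => bump (a ^+ 2) (b ^+ 2) n (t ^+ 2))).
  by apply: measurable_funTS; exact: measurable_bump_sqr.
have [] // := @Rintegral_dominated R _ _ (@mu3 R) (shell a b)
  (fun n x => bump (a ^+ 2) (b ^+ 2) n (enorm x ^+ 2) * g x) g (fun x => `|g x|) (measurable_shell a b).
- by move=> n; exact: measurable_funM (mpsi n) mg.
- apply: (@ae_impl _ _ _ (@mu3 R) _ _ (ae_not_sphere2 a b)) => x [xa xb] /andP[ax xb'].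
  rewrite -[X in _ --> X]mul1r; apply: cvgM; last exact: cvg_cst.
  have := @bump_cvg R (a ^+ 2) (b ^+ 2) (enorm x ^+ 2) ab2.
  by rewrite !sq0 ?enorm_ge0 ?(ltW a0) ?(ltW b0)// !lt_neqAle ax xb' xb eq_sym xa.
- exact: (integrable_norm ig).
- by move=> n x _; rewrite normrM ler_piMl// ger0_norm ?bump_ge0 ?bump_le1.
Qed.

End ShellBump.

Section FluxIdentity.
Context {R : realType}.
Local Notation R3 := (R * R * R)%type.
Local Notation mu := (@lebesgue_measure R).
Variables (P : R -> R -> R) (gamma0 alpha0 : R) (rho0 S0 f : R -> R) (Rs : R).
Hypotheses (HP : pressure_law P gamma0 alpha0)
  (HE : equilibrium P gamma0 alpha0 rho0 S0 f Rs).
Local Notation B := (@eball R Rs).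
Local Notation drho := (drho0 rho0 Rs).

Let Rs0 : 0 < Rs := eq_Rs HE.

(** For the first component of B q this is, up to sign, the flux of q through the
    sphere of radius t. *)
Definition mass_below (h : R3 -> R) (t : R) : R :=
  \int[mu3]_(x in B `&` [set x | enorm x <= t]) h x.
Local Notation H := mass_below.

Let enormB x : B x -> 0 <= enorm x <= Rs.
Proof. by move=> xB; rewrite enorm_ge0 ltW. Qed.

Lemma mass_below_integrable (h : R3 -> R) : mu3.-integrable B (EFin \o h) ->
  mu.-integrable `[0, Rs] (EFin \o H h).
Proof.
move=> ih.
have i1 : mu.-integrable `[0, Rs] (EFin \o cst (1 : R)).
  apply: continuous_compact_integrable; first exact: segment_compact.
  by move=> t; exact: cvg_cst.
have K1 (r : R) : 0 <= r <= Rs -> id Rs - id r = \int[mu]_(t in `[r, Rs]) cst (1 : R) t.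
  move=> /andP[_ rR]; have D (x : R) : r <= x <= Rs -> is_derive x (1 : R) id (cst (1 : R) x).
    by move=> _; exact: is_derive_id.
  by rewrite (Rintegral_derive rR D)// => t; exact: cvg_cst.
have [_ + _] := @integral_layer R _ _ (@mu3 R) B h (@enorm R) (cst 1) id 0 Rs
  (@measurable_eball R Rs) ih (@measurable_enorm R) enormB i1 K1.
by apply: eq_integrable => // t _ /=; rewrite mul1r.
Qed.

Lemma mass_below_le (h : R3 -> R) t : mu3.-integrable B (EFin \o h) ->
  `|H h t| <= \int[mu3]_(x in B) `|h x|.
Proof.
move=> ih; have mB := @measurable_eball R Rs.
have mD : measurable (B `&` [set x | enorm x <= t]).
  by apply: measurableI => //; exact: measurable_cball.
have ihD : mu3.-integrable (B `&` [set x | enorm x <= t]) (EFin \o h).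
  by apply: integrableS ih.
apply: le_trans; first by apply: le_normr_Rintegral ihD.
apply: fine_le; [exact: integrable_fin_num (integrable_norm ihD)|exact: integrable_fin_num (integrable_norm ih)|].
apply: ge0_subset_integral => //.
by apply/measurable_EFinP; apply: measurableT_comp => //; apply/measurable_EFinP; case/integrableP: ih.
Qed.

Section Graph.
Variables (q : R3 -> R3) (k1 k2 : R3 -> R).
Hypothesis HB : B_graph P rho0 S0 f Rs q k1 k2.
Local Notation v := (radial_part q).

Let iv : mu3.-integrable B (EFin \o v) := radial_part_integrable HE HB.

Let ik1 : mu3.-integrable B (EFin \o k1).
Proof. by have [_ X _ _] := HB; have [] := in_X_integrable HP HE X. Qed.

(** Test with Phi(|x|^2), where Phi' = psi: its gradient is 2 psi x, and the layer
    formula rewrites the integral of k1 Phi(|x|^2) in terms of the mass below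
    each radius. *)
Lemma flux_smooth (psi : R -> R) (a b : R) : smooth1 psi -> 0 < b < Rs ->
  (forall t, t <= a -> psi t = 0) -> (forall t, b ^+ 2 <= t -> psi t = 0) ->
  (forall t, `|psi t| <= 1) ->
  \int[mu3]_(x in B) (psi (enorm x ^+ 2) * v x) =
  - \int[mu]_(t in `[0, Rs]) (t * psi (t ^+ 2) * H k1 t).
Proof.
move=> spsi /andP[b0 bR] psia psib bp.
have cpsi := smooth1_continuous spsi.
have [Phi dPhi Phib] := compact_primitive cpsi psia psib.
have sPhi : smooth1 Phi := smooth1_primitive dPhi spsi.
have dPhiE t : derive1 Phi t = psi t by rewrite derive1E; apply: derive_val.
have tphi : test_fun B (fun x : R3 => Phi (dot x x)).
  apply: (radial_test_fun sPhi bR) => x bx; apply: Phib.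
  by rewrite -enorm_sqr ler_sqr ?nnegrE ?enorm_ge0 ?(ltW b0)// ltW.
have [_ _ [_ r1] _] := HB.
have := r1 _ tphi; rewrite /B1.
have -> : \int[mu3]_(x in B) dot (q x) (grad (fun x0 : R3 => Phi (dot x0 x0)) x) =
    \int[mu3]_(x in B) (2 * (psi (enorm x ^+ 2) * v x)).
  apply: eq_Rintegral => x _; rewrite grad_radial// dotZr dPhiE -enorm_sqr /radial_part; ring.
have mpsi : measurable_fun B (fun x : R3 => psi (enorm x ^+ 2)).
  apply: (@measurable_radial R _ _ Rs (fun t => psi (t ^+ 2))).
  apply: measurable_funTS; apply: continuous_measurable_fun => t.
  by apply: continuous_comp; [exact: exprn_continuous|exact: cpsi].
have ipv : mu3.-integrable B (EFin \o (fun x => psi (enorm x ^+ 2) * v x)).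
  apply: integrableMr (iv) => //; first exact: measurable_eball.
  by exists 1; split => [|y My x Dx]; [exact: num_real|apply: (le_trans (bp _)); exact: ltW].
rewrite RintegralZl//; last exact: measurable_eball.
pose k (t : R) : R := psi (t ^+ 2) * (2 * t).
have ck : continuous k.
  move=> t; apply: cvgM; last by apply: cvgMr; exact: cvg_id.
  by apply: continuous_comp; [exact: exprn_continuous|exact: cpsi].
have ikk : mu.-integrable `[0, Rs] (EFin \o k).
  apply: continuous_compact_integrable; first exact: segment_compact.
  exact: continuous_subspaceT.
have dK (t : R) : is_derive t (1 : R) (fun t => Phi (t ^+ 2)) (k t).
  have D2 : is_derive t (1 : R) (fun t : R => t ^+ 2) (2 * t).
    apply: (is_derive_eq (is_deriveX 2 (is_derive_id t (1 : R)))).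
    by rewrite /GRing.scale/=; ring.
  exact: (@is_derive1_comp _ Phi (fun t : R => t ^+ 2) t _ _ (dPhi _) D2).
have KE (r : R) : 0 <= r <= Rs -> Phi (Rs ^+ 2) - Phi (r ^+ 2) = \int[mu]_(t in `[r, Rs]) k t.
  move=> /andP[_ rR]; rewrite (@Rintegral_derive R (fun t => Phi (t ^+ 2)) k r Rs rR (fun x _ => dK x))//.
  exact: continuous_subspaceT.
have -> : \int[mu3]_(x in B) (k1 x * Phi (dot x x)) = \int[mu3]_(x in B) (k1 x * Phi (enorm x ^+ 2)).
  by apply: eq_Rintegral => x _; rewrite enorm_sqr.
have [_ ikN ->] := @integral_layer R _ _ (@mu3 R) B k1 (@enorm R) k (fun t => Phi (t ^+ 2)) 0 Rs
  (@measurable_eball R Rs) ik1 (@measurable_enorm R) enormB ikk KE.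
rewrite Phib ?mul0r ?sub0r; last by rewrite ler_sqr ?nnegrE ?(ltW b0) ?(ltW Rs0)// ltW.
have i2 : mu.-integrable `[0, Rs] (EFin \o (fun t => t * psi (t ^+ 2) * H k1 t)).
  have := @integrableZl _ _ _ mu `[0, Rs]%classic (measurable_itv _) 2^-1 _ ikN.
  apply: eq_integrable => // t _ /=; rewrite -EFinM; congr EFin; rewrite /k -/(H k1 t).
  by field.
have -> : \int[mu]_(t in `[0, Rs]) (k t * \int[mu3]_(x in B `&` [set x | enorm x <= t]) k1 x) =
   \int[mu]_(t in `[0, Rs]) (2 * (t * psi (t ^+ 2) * H k1 t)).
  by apply: eq_Rintegral => t _; rewrite /k -/(H k1 t); ring.
rewrite RintegralZl// => E; apply: (mulfI (_ : 2 != 0 :> R)) => //.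
by rewrite E mulrN.
Qed.

Lemma flux (a b : R) : 0 < a -> a < b -> b < Rs ->
  \int[mu3]_(x in shell a b) v x = - \int[mu]_(t in `[a, b]) (t * H k1 t).
Proof.
move=> a0 ab bR; have b0 := lt_trans a0 ab.
have ab2 : a ^+ 2 <= b ^+ 2 by rewrite ler_sqr ?nnegrE ltW.
pose psi n (x : R3) := bump (a ^+ 2) (b ^+ 2) n (enorm x ^+ 2).
have E n : \int[mu3]_(x in B) (psi n x * v x) =
   - \int[mu]_(t in `[0, Rs]) (t * bump (a ^+ 2) (b ^+ 2) n (t ^+ 2) * H k1 t).
  apply: (@flux_smooth _ (a ^+ 2) b); first exact: smooth1_bump.
  - by rewrite b0.
  - by move=> t ta; apply: bump_eq0 => //; rewrite ltNge ta.
  - by move=> t tb; apply: bump_eq0 => //; rewrite negb_and -!leNgt tb orbT.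
  - by move=> t; rewrite ger0_norm ?bump_ge0 ?bump_le1.
have SB : shell a b `<=` B.
  by move=> x /shell_sub_cball xb; exact: cball_sub_eball bR _ xb.
have mS := measurable_shell a b.
have ivS : mu3.-integrable (shell a b) (EFin \o v).
  by apply: integrableS iv => //; exact: measurable_eball.
have sq0 (x y : R) : 0 <= x -> 0 <= y -> (x ^+ 2 < y ^+ 2) = (x < y).
  by move=> x0 y0; rewrite ltr_sqr ?nnegrE.
have L1 := bump_shell_cvg a0 ab ivS.
have iH := mass_below_integrable ik1.
have itH : mu.-integrable `[0, Rs] (EFin \o (fun t => t * H k1 t)).
  apply: integrableMr (iH) => //.
  exists Rs; split => [|y My t /=]; first exact: num_real.
  rewrite in_itv/= => /andP[t0 tR]; rewrite ger0_norm// (le_trans tR)// ltW//.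
have mtH : measurable_fun `[0, Rs] (fun t => t * H k1 t).
  by apply/measurable_EFinP; case/integrableP: itH.
have [_ L2] : mu.-integrable `[0, Rs] (EFin \o (fun t => (a < t < b)%R%:R * (t * H k1 t))) /\
    \int[mu]_(t in `[0, Rs]) (t * bump (a ^+ 2) (b ^+ 2) n (t ^+ 2) * H k1 t) @[n --> \oo] -->
    \int[mu]_(t in `[0, Rs]) ((a < t < b)%R%:R * (t * H k1 t)).
  apply: (@Rintegral_dominated R _ _ mu `[0, Rs]%classic _ _ (fun t => `|t * H k1 t|)) => //.
  - move=> n; rewrite (_ : (fun t => _) = (fun t => bump (a ^+ 2) (b ^+ 2) n (t ^+ 2) * (t * H k1 t))).
      exact: measurable_funM (measurable_funTS (measurable_bump_sqr a b n)) mtH.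
    by apply/funext => t; ring.
  - apply: measurable_funM => //; apply: measurable_natb.
    by apply: measurable_and; apply: measurable_fun_ltr.
  - apply: aeW => t /=; rewrite in_itv/= => /andP[t0 _].
    under eq_fun do rewrite -mulrA mulrCA.
    apply: cvgM; last exact: cvg_cst.
    have := @bump_cvg R (a ^+ 2) (b ^+ 2) (t ^+ 2) ab2.
    by rewrite !sq0// ltW.
  - exact: (integrable_norm itH).
  - move=> n t _; rewrite -mulrA mulrCA normrM ler_piMl// ger0_norm ?bump_ge0 ?bump_le1//.
rewrite -(Rintegral_shell (ltW a0) ab (ltW bR) itH).
have L3 : \int[mu3]_(x in shell a b) (psi n x * v x) @[n --> \oo] -->
    - \int[mu]_(t in `[0, Rs]) ((a < t < b)%R%:R * (t * H k1 t)).
  have E' n : \int[mu3]_(x in shell a b) (psi n x * v x) =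
     - \int[mu]_(t in `[0, Rs]) (t * bump (a ^+ 2) (b ^+ 2) n (t ^+ 2) * H k1 t).
    rewrite -E; apply/esym; apply: Rintegral_zero_off => // x xB xS.
    by rewrite /psi bump_shell_eq0 ?mul0r.
  by rewrite (funext E'); exact: cvgN.
exact: (cvg_unique (@Rhausdorff R) L1 L3).
Qed.

End Graph.
End FluxIdentity.

Section GraphIdentities.
Context {R : realType}.
Local Notation R3 := (R * R * R)%type.
Local Notation mu := (@lebesgue_measure R).
Variables (P : R -> R -> R) (gamma0 alpha0 : R) (rho0 S0 f : R -> R) (Rs : R).
Hypotheses (HP : pressure_law P gamma0 alpha0)
  (HE : equilibrium P gamma0 alpha0 rho0 S0 f Rs).
Local Notation B := (@eball R Rs).
Local Notation drho := (drho0 rho0 Rs).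
Local Notation H := (mass_below Rs).

Let Rs0 : 0 < Rs := eq_Rs HE.

Let co_nbhs t : 0 < t < Rs -> nbhs t (`[0, Rs[%classic : set R).
Proof.
move=> tR; have tR' : t \in `]0, Rs[ by rewrite in_itv.
apply: filterS (near_in_itvoo tR') => y; rewrite !in_itv/= => /andP[y0 yR].
by rewrite /= in_itv/= yR ltW.
Qed.

Lemma drho0_is_derive : exists d2 : R -> R, forall t, 0 < t < Rs ->
  is_derive t (1 : R) drho (d2 t) /\ {for t, continuous d2}.
Proof.
have [_ [d1 [_ [d2 [c2 _]]]]] := eq_rho0_C2 HE.
set D1 := derive_in `[0, Rs[ rho0 in d2 c2.
exists (derive_in `[0, Rs[ D1) => t tR.
have in_co (s : R) : 0 < s < Rs -> `[0, Rs[%classic s.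
  by move=> /andP[s0 sR]; rewrite /= in_itv/= sR ltW.
have E (s : R) : 0 < s < Rs -> D1 s = drho s.
  move=> sR; have [_ e1] := is_derive_in (co_nbhs sR) (d1 _ (in_co s sR)).
  by have [_ e2] := rho0_is_derive HE sR; rewrite -e2 /D1 -e1.
split.
  apply: near_eq_is_derive (is_derive_in (co_nbhs tR) (d2 _ (in_co t tR))) => //.
  have tR' : t \in `]0, Rs[ by rewrite in_itv.
  by apply: filterS (near_in_itvoo tR') => y; rewrite in_itv/= => /E.
have c3 : {within `]0, Rs[, continuous (derive_in `[0, Rs[ D1)}.
  by apply: continuous_subspaceW c2; apply: subset_itvr; rewrite bnd_simp.
rewrite continuous_open_subspace in c3; last exact: itv_open.
by apply: c3; rewrite inE/= in_itv.
Qed.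

(** The scalar with a0(x).q = flux_weight(|x|) q.x. *)
Definition flux_weight (t : R) : R := drho t / (rho0 t * t).
Local Notation K := flux_weight.

Lemma flux_weight_is_derive : exists k : R -> R, forall t, 0 < t < Rs ->
  is_derive t (1 : R) K (k t) /\ {for t, continuous k}.
Proof.
have [d2 Hd2] := drho0_is_derive.
exists (fun t => d2 t * (rho0 t * t)^-1
  - drho t * (drho t * t + rho0 t) * (rho0 t * t)^-1 * (rho0 t * t)^-1) => t tR.
have /andP[t0 tRs] := tR; have [D2 c2] := Hd2 t tR.
have D1 := rho0_is_derive HE tR.
have r0 : rho0 t != 0 by rewrite gt_eqF// (rho0_gt0 HE)// (ltW t0).
have w0 : rho0 t * t != 0 by rewrite mulf_neq0// gt_eqF.
have Dw : is_derive t (1 : R) (fun t => rho0 t * t) (drho t * t + rho0 t).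
  apply: (is_derive_eq (is_deriveM D1 (is_derive_id t (1 : R)))).
  by rewrite /GRing.scale/=; ring.
split.
  apply: (is_derive_eq (is_deriveM D2 (is_deriveV (f := fun t => rho0 t * t) w0 Dw))).
  by rewrite /GRing.scale/=; field; rewrite r0 gt_eqF.
have c1 := derive_continuous_at D2; have c0 := derive_continuous_at D1.
have cw := derive_continuous_at Dw.
have cV : {for t, continuous (fun t => (rho0 t * t)^-1)} by apply: cvgV.
apply: cvgB; first by apply: cvgM.
apply: cvgM => //; apply: cvgM => //; apply: cvgM => //.
by apply: cvgD => //; apply: cvgM => //; exact: cvg_id.
Qed.

Variables (q : R3 -> R3) (k1 k2 : R3 -> R).
Hypothesis HB : B_graph P rho0 S0 f Rs q k1 k2.
Local Notation v := (radial_part q).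

Let iv : mu3.-integrable B (EFin \o v) := radial_part_integrable HE HB.

Let ik1 : mu3.-integrable B (EFin \o k1).
Proof. by have [_ X _ _] := HB; have [] := in_X_integrable HP HE X. Qed.

Let SB a b : b < Rs -> shell a b `<=` B.
Proof. by move=> bR x /shell_sub_cball xb; exact: cball_sub_eball bR _ xb. Qed.

Let itH : mu.-integrable `[0, Rs] (EFin \o (fun t => t * H k1 t)).
Proof.
have iH := mass_below_integrable ik1; apply: integrableMr (iH) => //.
exists Rs; split => [|y My t /=]; first exact: num_real.
by rewrite in_itv/= => /andP[t0 tR]; rewrite ger0_norm// (le_trans tR)// ltW.
Qed.

(** On every shell from a to t, [flux] says that q.x and the density -t H(t) on
    the line have the same integral.  The layer formula, on the shell and on the
    line, then gives equal integrals against any common C1 weight. *)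
Lemma flux_weighted (a b : R) : 0 < a -> a < b -> b < Rs ->
  mu3.-integrable (shell a b) (fun x => (v x * K (enorm x))%:E) /\
  \int[mu3]_(x in shell a b) (v x * K (enorm x)) =
  - \int[mu]_(t in `[a, b]) (drho t / rho0 t * H k1 t).
Proof.
move=> a0 ab bR; have [k Hk] := flux_weight_is_derive.
have inR (t : R) : a <= t <= b -> 0 < t < Rs.
  by move=> /andP[at_ tb]; rewrite (lt_le_trans a0)// (le_lt_trans tb).
have ck (r : R) : a <= r -> {within `[r, b], continuous k}.
  move=> ar; apply: within_continuous_itv => t; rewrite in_itv/= => /andP[rt tb].
  by apply: (Hk t _).2; apply: inR; rewrite (le_trans ar).
have ik : mu.-integrable `[a, b] (EFin \o k).
  by apply: continuous_compact_integrable; [exact: segment_compact|exact: ck].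
have KE (r : R) : a <= r <= b -> K b - K r = \int[mu]_(t in `[r, b]) k t.
  move=> /andP[ar rb].
  have D (x : R) : r <= x <= b -> is_derive x (1 : R) K (k x).
    by move=> /andP[rx xb]; apply: (Hk x _).1; apply: inR; rewrite xb (le_trans ar).
  by rewrite (Rintegral_derive rb D)//; exact: ck.
have ivS : mu3.-integrable (shell a b) (EFin \o v).
  by apply: integrableS iv => //; [exact: measurable_eball|exact: measurable_shell|exact: SB].
have [i1 _ E1] := @integral_layer R _ _ (@mu3 R) (shell a b) v (@enorm R) k K a b
  (measurable_shell a b) ivS (@measurable_enorm R) (fun x xS => xS) ik KE.
split => //; rewrite E1.
have itHab : mu.-integrable `[a, b] (EFin \o (fun t => t * H k1 t)).
  apply: integrable_itvS itH => t /=; rewrite !in_itv/= => /andP[at_ tb].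
  by rewrite (le_trans (ltW a0) at_) (le_trans tb (ltW bR)).
(* the layer formula on the line, for the density t H(t) *)
have [_ iY E2] := @integral_layer R _ _ mu `[a, b]%classic (fun t => t * H k1 t) id k K a b
  (measurable_itv _) itHab (@measurable_id _ _ _) (fun t tab => tab) ik KE.
have -> : \int[mu]_(t in `[a, b]) (drho t / rho0 t * H k1 t) =
    \int[mu]_(t in `[a, b]) (t * H k1 t * K (id t)).
  apply: eq_Rintegral => t; rewrite inE/= in_itv/= => tab.
  have /andP[t0 tRs] := inR t tab; rewrite /K /=; field.
  by rewrite (gt_eqF t0) gt_eqF// (rho0_gt0 HE)// (ltW t0).
rewrite E2 opprB (flux HP HE HB a0 ab bR) mulrN.
set X := \int[mu]_(t in `[a, b]) (k t * \int[mu3]_(x in _) v x).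
set Y := \int[mu]_(t in `[a, b]) (k t * \int[mu]_(x in _) (x * H k1 x)).
suff -> : X = - Y by rewrite opprK addrC.
rewrite -mulN1r -(RintegralZl (-1) _ iY)// /X; apply: eq_Rintegral => t.
rewrite inE/= in_itv/= => /andP[at_ tb]; rewrite mulrCA mulN1r; congr (_ * _).
have -> : shell a b `&` [set x | enorm x <= t] = shell a t.
  apply/seteqP; split => x; rewrite /shell/=; first by move=> [/andP[-> _] ->].
  by move=> /andP[-> xt]; rewrite xt (le_trans xt tb).
have -> : `[a, b]%classic `&` [set x : R | x <= t] = `[a, t]%classic.
  apply/seteqP; split => x; rewrite /= !in_itv/=; first by move=> [/andP[-> _] ->].
  by move=> /andP[-> xt]; rewrite xt (le_trans xt tb).
move: at_; rewrite le_eqVlt => /predU1P[<-|at_]; last first.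
  by rewrite (flux HP HE HB a0 at_)// (le_lt_trans tb).
rewrite set_itv1 Rintegral_set1 oppr0 /Rintegral null_set_integral//.
- exact: measurable_shell.
- apply: measurable_funS (measurable_int _ ivS); first exact: measurable_shell.
  by move=> x /andP[ax xa]; rewrite /shell/= ax (le_trans xa (ltW ab)).
- have -> : shell a a = [set x | enorm x = a]; last exact: mu3_sphere.
  apply/seteqP; split => x; rewrite /shell/=; last by move=> ->; rewrite lexx.
  by move=> /le_anti.
Qed.

(** The two components of B q differ by a0.q; test with bumps in |x|^2. *)
Lemma jump_identity (a b : R) : 0 < a -> a < b -> b < Rs ->
  \int[mu3]_(x in shell a b) (k2 x - k1 x) = \int[mu3]_(x in shell a b) (v x * K (enorm x)).
Proof.
move=> a0 ab bR; have b0 := lt_trans a0 ab.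
have [iK _] := flux_weighted a0 ab bR.
pose psi n (x : R3) := bump (a ^+ 2) (b ^+ 2) n (enorm x ^+ 2).
have psi0 n x : ~ shell a b x -> psi n x = 0 by exact: bump_shell_eq0.
have tpsi n : test_fun B (psi n).
  rewrite (_ : psi n = (fun x => bump (a ^+ 2) (b ^+ 2) n (dot x x))); last first.
    by apply/funext => x; rewrite /psi enorm_sqr.
  apply: (@radial_test_fun _ _ b) => //; first exact: smooth1_bump.
  move=> x bx; rewrite -enorm_sqr; apply: psi0 => /andP[_].
  by rewrite leNgt bx.
have mS := measurable_shell a b.
have mB := @measurable_eball R Rs.
have lim := bump_shell_cvg a0 ab.
have [_ X [_ r1] [_ r2]] := HB.
have [_ _ _ /(_ b bR) ik2] := in_X_integrable HP HE X.
have ik2S : mu3.-integrable (shell a b) (EFin \o k2).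
  by apply: integrableS ik2 => //; [exact: measurable_cball|exact: shell_sub_cball].
have ik1S : mu3.-integrable (shell a b) (EFin \o k1).
  by apply: integrableS ik1 => //; exact: SB.
have E n : \int[mu3]_(x in shell a b) (psi n x * k2 x) - \int[mu3]_(x in shell a b) (psi n x * k1 x) =
    \int[mu3]_(x in shell a b) (psi n x * (v x * K (enorm x))).
  have toB (g : R3 -> R) : \int[mu3]_(x in shell a b) (psi n x * g x) =
      \int[mu3]_(x in B) (g x * psi n x).
    rewrite (@Rintegral_zero_off R _ _ (@mu3 R) (shell a b) B (fun x => g x * psi n x) (SB bR)); last by move=> x _ /psi0 ->; rewrite mulr0.
    by apply: eq_Rintegral => x _; rewrite mulrC.
  rewrite !toB -(r1 _ (tpsi n)) -(r2 _ (tpsi n)) /B2 addrAC subrr add0r.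
  apply: eq_Rintegral => x; rewrite inE => xB.
  have [xS|/psi0 ->] := pselect (shell a b x); last by rewrite !mulr0.
  have x0 : x != 0.
    apply/eqP => x0; move: xS; rewrite /shell/= x0 => /andP[].
    by rewrite /enorm /dot/= !mulr0 !addr0 sqrtr0 leNgt a0.
  by rewrite (dot_a0 HE)// dotC /radial_part /K [X in _ = X * _]mulrC.
have L2 : \int[mu3]_(x in shell a b) (psi n x * k2 x) -
    \int[mu3]_(x in shell a b) (psi n x * k1 x) @[n --> \oo] -->
    \int[mu3]_(x in shell a b) k2 x - \int[mu3]_(x in shell a b) k1 x.
  by apply: cvgB; exact: lim.
have := lim _ iK; rewrite -(funext E) => L1.
have mE := @RintegralB _ _ _ (@mu3 R) (shell a b) _ _ mS ik2S ik1S.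
rewrite mE; exact: (cvg_unique (@Rhausdorff R) L2 L1).
Qed.

End GraphIdentities.

(** * Vanishing of the total mass on the range of B *)
Section MassZero.
Context {R : realType}.
Local Notation R3 := (R * R * R)%type.
Local Notation mu := (@lebesgue_measure R).

Lemma mu3_shell_le (a b r : R) : 0 <= a -> a < b -> b < r ->
  (mu3 (shell a b) <= (sphere_const * (r ^+ 2 * (b - a)))%:E)%E.
Proof.
move=> a0 ab br; have r0 : 0 < r by rewrite (le_lt_trans a0)// (lt_trans ab).
pose F (t : R) : \bar R := (\1_(`[a, b]%classic : set R) t)%:E.
have mF : measurable_fun `[0, r[ F.
  by apply/measurable_EFinP; apply: measurable_indic; exact: measurable_itv.
have F0 (t : R) : 0 <= t < r -> (0 <= F t)%E by rewrite lee_fin.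
have := ge0_integral_radial mF F0.
rewrite /F (_ : (fun x : R3 => (\1_(`[a, b]%classic : set R) (enorm x))%:E) = EFin \o \1_(shell a b)); last first.
  by apply/funext => x /=; rewrite !indicE; congr ((nat_of_bool _)%:R%:E).
rewrite integral_indic; [|exact: measurable_eball|exact: measurable_shell].
rewrite setIidl; last by move=> x /andP[_ xb]; exact: le_lt_trans br.
move=> ->; rewrite EFinM lee_pmul2l ?lte_fin ?sphere_const_gt0//.
apply: (@le_trans _ _ (\int[mu]_(t in `[0%R, r[) ((r ^+ 2)%:E * F t))%E).
  apply: ge0_le_integral => //.
  - by move=> t _; rewrite -EFinM lee_fin mulr_ge0 ?sqr_ge0.
  - apply: emeasurable_funM => //; apply/measurable_EFinP; exact: measurable_funX.
  - by apply: measurable_funeM.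
  - move=> t /=; rewrite in_itv/= => /andP[t0 tr]; apply: lee_wpmul2r; first by rewrite lee_fin.
    by rewrite lee_fin ler_sqr ?nnegrE ?(ltW r0)// ltW.
rewrite ge0_integralZl ?lee_fin ?sqr_ge0//.
rewrite [leRHS]EFinM; apply: lee_wpmul2l; first by rewrite lee_fin sqr_ge0.
rewrite integral_indic//.
rewrite (_ : `[a, b]%classic `&` `[0, r[%classic = `[a, b]%classic).
  have L : mu `[a, b]%classic = (b - a)%:E by rewrite lebesgue_measure_itv/= lte_fin ab.
  by rewrite -L.
apply: setIidl => t /=; rewrite !in_itv/= => /andP[at_ tb].
by rewrite (le_trans a0)// (le_lt_trans tb).
Qed.

Lemma tail_small (r : R) (g : R3 -> R) (e : R) : 0 < r -> 0 < e ->
  mu3.-integrable (eball r) (EFin \o g) ->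
  exists2 a, 0 <= a < r & \int[mu3]_(x in eball r) ((a <= enorm x)%R%:R * `|g x|) <= e.
Proof.
move=> r0 e0 ig; pose a n : R := r - r / n.+1%:R.
have a0 n : 0 <= a n < r.
  rewrite /a subr_ge0 ler_pdivrMr// ler_peMr ?ler1n ?(ltW r0)//=.
  by rewrite gtrBl divr_gt0.
have mg : measurable_fun (eball r) (fun x => `|g x|).
  by apply: measurableT_comp => //; apply/measurable_EFinP; case/integrableP: ig.
have mi c : measurable_fun (eball r) (fun x : R3 => (c <= enorm x)%R%:R : R).
  apply: (@measurable_radial R _ _ r (fun t => (c <= t)%R%:R : R)).
  by apply: measurable_natb; exact: measurable_fun_ler.
have cv (x : R3) : eball r x -> (a n <= enorm x)%R%:R * `|g x| @[n --> \oo] --> (0 : R).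
  move=> xr; apply: cvg_near_cst.
  have d0 : 0 < (r - enorm x) / r by rewrite divr_gt0// subr_gt0.
  exists (Num.truncn ((r - enorm x) / r)^-1) => // n /= kn.
  suff : enorm x < a n by rewrite ltNge => /negbTE ->; rewrite mul0r.
  rewrite /a ltrBrDl -ltrBrDr ltr_pdivrMr// -ltr_pdivrMl ?subr_gt0//.
  rewrite mulrC -invf_div; apply: lt_le_trans (truncnS_gt _) _; by rewrite ler_nat.
have mag n : measurable_fun (eball r) (fun x => (a n <= enorm x)%R%:R * `|g x|).
  exact: measurable_funM (mi (a n)) mg.
have bd n (x : R3) : eball r x -> `|(a n <= enorm x)%R%:R * `|g x| | <= `|g x|.
  by move=> _; rewrite normrM normr_id ler_piMl// ger0_norm// lern1 leq_b1.
have [_] : mu3.-integrable (eball r) (EFin \o (fun=> 0 : R)) /\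
    \int[mu3]_(x in eball r) ((a n <= enorm x)%R%:R * `|g x|) @[n --> \oo] -->
    \int[mu3]_(x in eball r) (0 : R).
  apply: (@Rintegral_dominated R _ _ (@mu3 R) (eball r)
    (fun n x => (a n <= enorm x)%R%:R * `|g x|) (fun=> 0) (fun x => `|g x|)) => //.
  - exact: measurable_eball.
  - by apply: aeW => x xB; exact: (cv x xB).
  - exact: (integrable_norm ig).
rewrite Rintegral_cst; last exact: measurable_eball.
rewrite mul0r => /cvgrPdist_le/(_ _ e0)[N _ /(_ N (leqnn N))].
rewrite /= sub0r normrN => HN; exists (a N) => //; exact: le_trans (ler_norm _) HN.
Qed.

Lemma bounded_indic (p : R3 -> bool) (D : set R3) : [bounded (p x)%:R : R | x in D].
Proof.
exists 1; split => [|y My x _]; first exact: num_real.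
by rewrite /= ger0_norm// (le_trans _ (ltW My))// lern1 leq_b1.
Qed.

Lemma tail_integrable (r a : R) (g : R3 -> R) : mu3.-integrable (eball r) (EFin \o g) ->
  mu3.-integrable (eball r) (EFin \o (fun x => (a <= enorm x)%R%:R * `|g x|)).
Proof.
move=> ig; have mi : measurable_fun (eball r) (fun x : R3 => (a <= enorm x)%R%:R : R).
  apply: (@measurable_radial R _ _ r (fun t => (a <= t)%R%:R : R)).
  by apply: measurable_natb; exact: measurable_fun_ler.
have mB := @measurable_eball R r.
by apply: integrableMr (integrable_norm ig) => //; exact: (bounded_indic (fun x => a <= enorm x)).
Qed.

Lemma tail_mono (r a b : R) (g : R3 -> R) : a <= b -> mu3.-integrable (eball r) (EFin \o g) ->
  \int[mu3]_(x in eball r) ((b <= enorm x)%R%:R * `|g x|) <=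
  \int[mu3]_(x in eball r) ((a <= enorm x)%R%:R * `|g x|).
Proof.
move=> ab ig; apply: le_Rintegral; [exact: measurable_eball|exact: tail_integrable|exact: tail_integrable|].
move=> x _; apply: ler_wpM2r => //; rewrite ler_nat.
by have [bx|//] := leP b (enorm x); rewrite (le_trans ab).
Qed.

Variables (P : R -> R -> R) (gamma0 alpha0 : R) (rho0 S0 f : R -> R) (Rs : R).
Hypotheses (HP : pressure_law P gamma0 alpha0)
  (HE : equilibrium P gamma0 alpha0 rho0 S0 f Rs).
Local Notation B := (@eball R Rs).
Local Notation H := (mass_below Rs).

Let Rs0 : 0 < Rs := eq_Rs HE.

Lemma mass_below_tail (h : R3 -> R) (t : R) : mu3.-integrable B (EFin \o h) ->
  `|\int[mu3]_(x in B) h x - H h t| <= \int[mu3]_(x in B) ((t <= enorm x)%R%:R * `|h x|).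
Proof.
move=> ih; have mB := @measurable_eball R Rs.
have mle c : measurable_fun B (fun x : R3 => (enorm x <= c)%R%:R : R).
  apply: (@measurable_radial R _ _ Rs (fun t => (t <= c)%R%:R : R)).
  by apply: measurable_natb; exact: measurable_fun_ler.
have i1 : mu3.-integrable B (EFin \o (fun x => (enorm x <= t)%R%:R * h x)).
  by apply: integrableMr (ih) => //; [exact: mle|exact: (bounded_indic (fun x => enorm x <= t))].
have i3 := tail_integrable t ih.
have -> : H h t = \int[mu3]_(x in B) ((enorm x <= t)%R%:R * h x).
  rewrite /mass_below Rintegral_mkcond [RHS]Rintegral_mkcond; apply: eq_Rintegral => x _.
  rewrite !patchE in_setI; case: ifPn => /=; case: (x \in B) => //=.
    by rewrite inE/= => ->; rewrite mul1r.
  by rewrite notin_setE/= => /negP/negbTE ->; rewrite mul0r.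
have E := @RintegralB _ _ _ (@mu3 R) B _ _ mB ih i1; rewrite -E.
have i2 : mu3.-integrable B (EFin \o (fun x => h x - (enorm x <= t)%R%:R * h x)).
  by apply: eq_integrable (integrableB _ ih i1).
apply: le_trans; first by apply: le_normr_Rintegral i2.
apply: le_Rintegral => //; first exact: (integrable_norm i2).
move=> x _; have [xt|tx] := leP (enorm x) t; first by rewrite mul1r subrr normr0 mulr_ge0.
by rewrite mul0r subr0 (ltW tx) mul1r.
Qed.

(** A shell of thickness d lying within 2d of the boundary has volume O(d), and
    there rho0 = O(d). *)
Lemma rho0_shell_le : exists2 C : R, 0 <= C & forall a d, 0 <= a -> 0 < d -> a + d < Rs ->
  Rs - a <= 2 * d -> \int[mu3]_(x in shell a (a + d)) rho0 (enorm x) <= C * d ^+ 2.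
Proof.
have [C C0 HC] := rho0_le_dist HE.
exists (C * 2 * (sphere_const * Rs ^+ 2)).
  by rewrite !mulr_ge0// ?sqr_ge0// ltW// sphere_const_gt0.
move=> a d a0 d0 adR ad.
have SB : shell a (a + d) `<=` B.
  by move=> x /shell_sub_cball xb; exact: cball_sub_eball adR _ xb.
have mS := measurable_shell a (a + d).
have fS := mu3_fin_sub mS SB.
have mr : measurable_fun B (fun x => rho0 (enorm x)).
  apply: measurable_radial; apply: (@measurable_funS _ _ _ _ `[0, Rs]%classic) => //.
    by apply: subset_itvl; rewrite bnd_simp.
  by apply: subspace_continuous_measurable_fun => //; exact: (rho0_continuous HE).
have ic (c : R) : mu3.-integrable (shell a (a + d)) (EFin \o cst c).
  apply/integrableP; split; first by apply/measurable_EFinP; exact: measurable_cst.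
  rewrite -[X in (X < _)%E]/(\int[mu3]_(x in shell a (a + d)) cst `|c|%:E x)%E.
  by rewrite integral_cst//= lte_mul_pinfty.
have bd (x : R3) : shell a (a + d) x -> 0 <= rho0 (enorm x) <= C * (2 * d).
  move=> xS; have xB := SB _ xS.
  rewrite ltW ?(rho0_gt0 HE) ?enorm_ge0//=.
  apply: (le_trans (HC _ _)); first by rewrite enorm_ge0 ltW.
  rewrite ler_pM2l//; have /andP[ax _] := xS; lra.
have ir : mu3.-integrable (shell a (a + d)) (EFin \o (fun x => rho0 (enorm x))).
  apply: le_integrable (ic (C * (2 * d))) => //.
    by apply/measurable_EFinP; apply: measurable_funS mr => //; exact: measurable_eball.
  move=> x /bd/andP[r0 rC]; rewrite /= lee_fin !ger0_norm//.
  exact: le_trans rC.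
apply: (@le_trans _ _ (\int[mu3]_(x in shell a (a + d)) cst (C * (2 * d)) x)).
  by apply: le_Rintegral => // x /bd/andP[].
rewrite Rintegral_cst//.
have := mu3_shell_le a0 (_ : a < a + d) adR; rewrite ltrDl => /(_ d0).
rewrite addrAC subrr add0r => H.
have : fine (mu3 (shell a (a + d))) <= sphere_const * (Rs ^+ 2 * d).
  by rewrite -lee_fin fineK ?ge0_fin_numE.
have c0 : 0 <= C * (2 * d) by rewrite !mulr_ge0// ltW.
move=> /(ler_wpM2l c0) /le_trans; apply.
rewrite le_eqVlt; apply/orP; left; apply/eqP; ring.
Qed.

(** A nonzero mass c would be, up to sign, the limit of the fluxes through the
    spheres close to the boundary.  On a shell of thickness d the integral of q.x is then of order c d, whereas
    Cauchy-Schwarz with the weight 1/rho0 bounds it by d times the square root of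
    the integral of |q.x|^2/rho0 over the shell, which tends to 0. *)
Lemma mass_zero (q : R3 -> R3) (k1 k2 : R3 -> R) :
  B_graph P rho0 S0 f Rs q k1 k2 -> \int[mu3]_(x in B) k1 x = 0.
Proof.
move=> HB; set c := \int[mu3]_(x in B) k1 x.
have [C C0 HC] := rho0_shell_le.
have [_ X _ _] := HB; have [_ _ ik1 _] := in_X_integrable HP HE X.
pose w (x : R3) := (rho0 (enorm x))^-1.
have mv := radial_part_measurable HB.
have mr : measurable_fun B w.
  apply: measurableT_comp; first exact: measurable_inv.
  apply: measurable_radial.
  apply: (@measurable_funS _ _ _ _ `[0, Rs]%classic) => //.
    by apply: subset_itvl; rewrite bnd_simp.
  by apply: subspace_continuous_measurable_fun => //; exact: (rho0_continuous HE).
have w0 x : B x -> 0 <= w x by move=> xB; rewrite invr_ge0 ltW// (rho0_gt0 HE)// enorm_ge0.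
have ig : mu3.-integrable B (EFin \o (fun x => w x * radial_part q x ^+ 2)).
  apply/integrableP; split.
    by apply/measurable_EFinP; apply: measurable_funM => //; exact: measurable_funX.
  apply: le_lt_trans (radial_part_L2 HE HB); rewrite le_eqVlt; apply/orP; left; apply/eqP.
  apply: eq_integral => x; rewrite inE => xB.
  by rewrite /= ger0_norm// mulr_ge0 ?sqr_ge0// w0.
(* letting m tend to 0 in the estimate forces c = 0 *)
suff key (m : R) : 0 < m -> `|c| * (Rs / 2) <= m * (C + 1) + Rs * m ^+ 2.
  apply/eqP; rewrite -normr_le0 leNgt; apply/negP => c0.
  pose y := `|c| * (Rs / 2); have y0 : 0 < y by rewrite mulr_gt0// divr_gt0.
  pose D := C + 1 + Rs; have D0 : 0 < D by rewrite addr_gt0// ltr_wpDl.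
  pose m := Num.min 1 (y / (2 * D)).
  have m0 : 0 < m by rewrite lt_min ltr01 divr_gt0// mulr_gt0.
  have m1 : m <= 1 by rewrite ge_min lexx.
  have mD : m * D <= y / 2.
    have : m <= y / (2 * D) by rewrite ge_min lexx orbT.
    by rewrite -(ler_pM2r D0) => /le_trans; apply; rewrite le_eqVlt; apply/orP; left; apply/eqP; field; rewrite gt_eqF.
  have := key m m0; rewrite -/y.
  have : Rs * m ^+ 2 <= m * Rs by rewrite expr2 mulrC -mulrA ler_wpM2l ?(ltW m0)// ler_piMl// ltW.
  move: mD; rewrite /D !mulrDr; lra.
move=> m0; have m20 : 0 < m ^+ 2 by rewrite exprn_gt0.
have [a1 /andP[a10 a1R] T1] := tail_small Rs0 m20 ig.
have [a2 /andP[a20 a2R] T2] := tail_small Rs0 m20 ik1.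
(* beyond a both tails are at most m^2, and the radius is at least Rs/2 *)
pose a := Num.max (Rs / 2) (Num.max a1 a2).
have aR : a < Rs by rewrite !gt_max a1R a2R ltr_pdivrMr// ltr_pMr// ltr1n.
have a0 : 0 < a by rewrite lt_max divr_gt0.
(* stopping halfway keeps the shell inside the ball, at distance comparable
   to its thickness from the boundary *)
pose d := (Rs - a) / 2; have d0 : 0 < d by rewrite divr_gt0// subr_gt0.
have adR : a + d < Rs by rewrite /d; lra.
have aad : a < a + d by rewrite ltrDl.
have ad2 : Rs - a <= 2 * d by rewrite /d; lra.
have SB : shell a (a + d) `<=` B.
  by move=> x /shell_sub_cball xb; exact: cball_sub_eball adR _ xb.
have mS := measurable_shell a (a + d); have mB := @measurable_eball R Rs.
have F := flux HP HE HB a0 aad adR.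
have a1a : a1 <= a by rewrite !le_max lexx orbT.
have a2a : a2 <= a by rewrite !le_max lexx !orbT.
have nN : (normsq mu3 (shell a (a + d)) w (radial_part q) <= (m ^+ 2)%:E)%E.
  have iT := tail_integrable a ig.
  have mT : measurable_fun B (fun x => ((a <= enorm x)%R%:R * `|w x * radial_part q x ^+ 2|)%:E).
    by case/integrableP: iT.
  apply: (@le_trans _ _ (\int[mu3]_(x in B) ((a <= enorm x)%R%:R * `|w x * radial_part q x ^+ 2|)%:E)%E); last first.
    have fT : (\int[mu3]_(x in B) ((a <= enorm x)%R%:R * `|w x * radial_part q x ^+ 2|)%:E)%E \is a fin_num.
      exact: integrable_fin_num iT.
    by rewrite -(fineK fT) lee_fin; apply: le_trans T1; exact: tail_mono.
  apply: (@le_trans _ _ (\int[mu3]_(x in shell a (a + d)) ((a <= enorm x)%R%:R * `|w x * radial_part q x ^+ 2|)%:E)%E).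
    rewrite le_eqVlt; apply/orP; left; apply/eqP; apply: eq_integral => x; rewrite inE => xS.
    have /andP[ax _] := xS; rewrite ax mul1r ger0_norm// mulr_ge0 ?sqr_ge0//.
    by apply: w0; exact: SB.
  by apply: ge0_subset_integral => //; exact: measurable_eball.
(* Young's parameter m/d makes both terms d times a small quantity *)
have md0 : 0 < m / d by rewrite divr_gt0.
have [iv V] := radial_part_L1 HE HB mS SB md0 nN.
have V' : `|\int[mu]_(t in `[a, a + d]) (t * H k1 t)| <= d * (m * (C + 1)).
  rewrite -normrN -F; apply: le_trans; first by apply: le_normr_Rintegral iv.
  apply: (le_trans V).
  have := HC a d (ltW a0) d0 adR ad2.
  move=> /(ler_wpM2l (ltW md0)) => /(lerD (lexx ((m / d)^-1 * m ^+ 2))) => V2.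
  rewrite addrC; apply: (le_trans V2); rewrite le_eqVlt; apply/orP; left; apply/eqP; field.
  by rewrite !gt_eqF.
have Hc t : a <= t -> `|c - H k1 t| <= m ^+ 2.
  move=> at_; apply: (le_trans (mass_below_tail t ik1)); apply: le_trans T2.
  by apply: tail_mono => //; exact: le_trans at_.
have icst (u : R) : mu.-integrable `[a, a + d] (EFin \o cst u).
  apply: continuous_compact_integrable; first exact: segment_compact.
  by move=> t; exact: cvg_cst.
have iH : mu.-integrable `[a, a + d] (EFin \o (fun t => t * H k1 t)).
  have iH := mass_below_integrable ik1.
  have : mu.-integrable `[0, Rs] (EFin \o (fun t => t * H k1 t)).
    apply: integrableMr (iH) => //.
    exists Rs; split => [|y My t /=]; first exact: num_real.
    by rewrite in_itv/= => /andP[t0 tR]; rewrite ger0_norm// (le_trans tR)// ltW.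
  apply: integrable_itvS => t /=; rewrite !in_itv/= => /andP[at_ tb].
  by rewrite (le_trans (ltW a0) at_) (le_trans tb (ltW adR)).
have ict : mu.-integrable `[a, a + d] (EFin \o (fun t => t * c)).
  apply: continuous_compact_integrable; first exact: segment_compact.
  by apply: continuous_subspaceT => t; apply: cvgMl; exact: cvg_id.
have Ic (u : R) : \int[mu]_(t in `[a, a + d]) cst u t = u * d.
  rewrite Rintegral_cst//.
  have L : mu `[a, a + d]%classic = d%:E.
    by rewrite lebesgue_measure_itv/= lte_fin aad -EFinD addrAC subrr add0r.
  by rewrite -[d in RHS]/(fine d%:E) -L.
have iD : mu.-integrable `[a, a + d] (EFin \o (fun t => t * c - t * H k1 t)).
  by apply: eq_integrable (integrableB _ ict iH).
have V2 : `|\int[mu]_(t in `[a, a + d]) (t * c - t * H k1 t)| <= Rs * m ^+ 2 * d.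
  rewrite -Ic; apply: le_trans; first by apply: le_normr_Rintegral iD.
  apply: le_Rintegral => //; first exact: (integrable_norm iD).
  move=> t /=; rewrite in_itv/= => /andP[at_ tb].
  rewrite -mulrBr normrM; apply: ler_pM => //; last exact: Hc.
  by rewrite ger0_norm ?(le_trans (ltW a0) at_)// (le_trans tb (ltW adR)).
have V3 : `|c| * (Rs / 2) * d <= `|\int[mu]_(t in `[a, a + d]) (t * c)|.
  have it : mu.-integrable `[a, a + d] (EFin \o (fun t : R => t)).
    apply: continuous_compact_integrable; first exact: segment_compact.
    by apply: continuous_subspaceT => t; exact: cvg_id.
  have -> : \int[mu]_(t in `[a, a + d]) (t * c) = c * \int[mu]_(t in `[a, a + d]) t.
    by rewrite -RintegralZl//; apply: eq_Rintegral => t _; rewrite mulrC.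
  rewrite normrM -mulrA ler_wpM2l//; apply: le_trans (ler_norm _).
  rewrite -Ic; apply: le_Rintegral => // t /=; rewrite in_itv/= => /andP[at_ tb].
  by apply: le_trans at_; rewrite le_max lexx.
have E : \int[mu]_(t in `[a, a + d]) (t * c - t * H k1 t) =
  \int[mu]_(t in `[a, a + d]) (t * c) - \int[mu]_(t in `[a, a + d]) (t * H k1 t).
  by apply: (RintegralB _ ict iH).
rewrite -(ler_pM2r d0); apply: (le_trans V3).
rewrite -[\int[mu]_(t in _) (t * c)](subrK (\int[mu]_(t in `[a, a + d]) (t * H k1 t))) -E.
apply: (le_trans (ler_normD _ _)); rewrite mulrDl addrC; apply: lerD => //.
by rewrite mulrC.
Qed.

End MassZero.

(** * The closure of the range satisfies the formula *)
Section RadialShell.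
Context {R : realType}.
Local Notation R3 := (R * R * R)%type.
Local Notation mu := (@lebesgue_measure R).

Lemma le_norm_Rintegral_subset d (T : measurableType d) (m : {measure set T -> \bar R})
    (D E : set T) (g : T -> R) : measurable D -> measurable E -> D `<=` E ->
  m.-integrable E (EFin \o g) -> `|\int[m]_(x in D) g x| <= \int[m]_(x in E) `|g x|.
Proof.
move=> mD mE DE ig; have igD : m.-integrable D (EFin \o g) by apply: integrableS ig.
apply: le_trans; first by apply: le_normr_Rintegral igD.
apply: fine_le; [exact: integrable_fin_num (integrable_norm igD)|exact: integrable_fin_num (integrable_norm ig)|].
apply: ge0_subset_integral => //.
by apply/measurable_EFinP; apply: measurableT_comp => //; apply/measurable_EFinP; case/integrableP: ig.
Qed.

Lemma Rintegral_shell_radial (g : R -> R) (a b r : R) : 0 <= a -> b < r ->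
  measurable_fun `[0, r[ g ->
  mu3.-integrable (shell a b) (fun x => (g (enorm x))%:E) ->
  mu.-integrable `[a, b] (fun t => (t ^+ 2 * g t)%:E) /\
  \int[mu3]_(x in shell a b) g (enorm x) = sphere_const * \int[mu]_(t in `[a, b]) (t ^+ 2 * g t).
Proof.
move=> a0 br mg ig; pose G t := (a <= t <= b)%R%:R * g t.
have mG : measurable_fun `[0, r[ G.
  apply: measurable_funM => //; apply: measurable_natb.
  by apply: measurable_and; apply: measurable_fun_ler.
have Sr : shell a b `<=` eball r by move=> x /andP[_ xb]; exact: le_lt_trans br.
have iG : mu3.-integrable (eball r) (fun x => (G (enorm x))%:E).
  apply/integrable_mkcond3; first exact: measurable_eball.
  move/integrable_mkcond3: ig => /(_ (measurable_shell a b)).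
  apply: eq_integrable => // x _; rewrite !patchE.
  case: ifPn => xS; case: ifPn => xr //.
  - by rewrite inE in xS; rewrite /G; move: xS; rewrite /shell/= => ->; rewrite mul1r.
  - by rewrite inE in xS; rewrite notin_setE in xr; case: xr; exact: Sr.
  - by rewrite notin_setE in xS; rewrite /G; move/negP/negbTE: xS => ->; rewrite mul0r.
have iG1 := (integrable_radial mG).1 iG.
have sub : `[a, b]%classic `<=` `[0, r[%classic.
  by move=> t /=; rewrite !in_itv/= => /andP[at_ tb]; rewrite (le_trans a0)// (le_lt_trans tb).
have E (t : R) : t \in `[a, b]%classic -> t ^+ 2 * G t = t ^+ 2 * g t.
  by rewrite inE/= in_itv/= /G => ->; rewrite mul1r.
split.
  by apply: eq_integrable (integrable_itvS sub iG1) => // t /E ->.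
have -> : \int[mu3]_(x in shell a b) g (enorm x) = \int[mu3]_(x in eball r) G (enorm x).
  rewrite (@Rintegral_zero_off R _ _ (@mu3 R) (shell a b) (eball r) (fun x => G (enorm x)) Sr).
    by apply: eq_Rintegral => x; rewrite inE /G /shell/= => ->; rewrite mul1r.
  by move=> x _ /negP/negbTE xS; rewrite /G xS mul0r.
rewrite (Rintegral_radial mG iG1); congr (_ * _).
rewrite (@Rintegral_zero_off R _ _ mu `[a, b]%classic `[0, r[%classic (fun t => t ^+ 2 * G t) sub).
  by apply: eq_Rintegral => t /E.
by move=> t _ /=; rewrite in_itv/= => /negP/negbTE tab; rewrite /G tab mul0r mulr0.
Qed.

Lemma integrable_co_cc (r : R) (g : R -> R) : 0 < r -> mu.-integrable `[0, r[ (EFin \o g) ->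
  mu.-integrable `[0, r] (EFin \o g).
Proof.
move=> r0 ig; have mg : measurable_fun `[0, r[ g.
  by apply/measurable_EFinP; case/integrableP: ig.
have mgc : measurable_fun `[0, r] g by apply/measurable_fun_itv_bndo_bndcP.
apply/integrableP; split; first exact/measurable_EFinP.
rewrite -integral_itv_bndo_bndc; first by case/integrableP: ig.
by apply: measurableT_comp => //; exact/measurable_EFinP.
Qed.

End RadialShell.

Section ClosureNecessary.
Context {R : realType}.
Local Notation R3 := (R * R * R)%type.
Local Notation mu := (@lebesgue_measure R).
Variables (P : R -> R -> R) (gamma0 alpha0 : R) (rho0 S0 f : R -> R) (Rs : R).
Hypotheses (HP : pressure_law P gamma0 alpha0)
  (HE : equilibrium P gamma0 alpha0 rho0 S0 f Rs).
Local Notation B := (@eball R Rs).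
Local Notation H := (mass_below Rs).
Local Notation drho := (drho0 rho0 Rs).

Let Rs0 : 0 < Rs := eq_Rs HE.

Local Notation dfr := (df rho0 f).

Lemma drho_rho_continuous (a b : R) : 0 < a -> b < Rs ->
  {within `[a, b], continuous (fun t => drho t / rho0 t)}.
Proof.
move=> a0 bR; apply: within_continuous_itv => t; rewrite in_itv/= => /andP[at_ tb].
have t0 : 0 < t < Rs by rewrite (lt_le_trans a0 at_) (le_lt_trans tb).
have [d2 /(_ t t0)[D2 _]] := drho0_is_derive HE.
apply: cvgM; first exact: derive_continuous_at D2.
apply: cvgV; first by rewrite gt_eqF// (rho0_gt0 HE)//; case/andP: t0 => /ltW -> ->.
exact: derive_continuous_at (rho0_is_derive HE t0).
Qed.

Section Closure.
Variables (h1 h2 : R3 -> R).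
Hypothesis Hcl : in_closure_RanB P rho0 S0 f Rs h1 h2.

Let HX : in_X P rho0 S0 f Rs h1 h2 := Hcl.1.

Let approx (e : R) : 0 < e -> exists q k1 k2, [/\ B_graph P rho0 S0 f Rs q k1 k2,
  (normsq mu3 B (w1 P rho0 f) (fun x => (h1 x - k1 x)%R) <= (e ^+ 2)%:E)%E &
  (normsq mu3 B (w2 P rho0 S0 f) (fun x => (h2 x - k2 x)%R) <= (e ^+ 2)%:E)%E].
Proof.
move=> e0; have [_ /(_ e e0)[q [k1 [k2 [HB nX]]]]] := Hcl.
have n1 : (0 <= normsq mu3 B (w1 P rho0 f) (fun x => (h1 x - k1 x)%R))%E.
  by apply: integral_ge0 => x xB; rewrite lee_fin mulr_ge0 ?sqr_ge0// ltW// (w1_pos HE).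
have n2 : (0 <= normsq mu3 B (w2 P rho0 S0 f) (fun x => (h2 x - k2 x)%R))%E.
  by apply: integral_ge0 => x xB; rewrite lee_fin mulr_ge0 ?sqr_ge0// (w2_nonneg HP HE).
exists q, k1, k2; split => //; apply: ltW; apply: le_lt_trans nX; rewrite /normsqX.
  by rewrite leeDl.
by rewrite leeDr.
Qed.

(** The total mass is continuous for the norm of X and vanishes on the range. *)
Lemma closure_mass_zero : \int[mu3]_(x in B) h1 x = 0.
Proof.
have [A A0 HA] := X1_L1 HP HE.
have [mh1 _ ih1 _] := in_X_integrable HP HE HX.
have mB := @measurable_eball R Rs.
have key (e : R) : 0 < e -> `|\int[mu3]_(x in B) h1 x| <= e * A.
  move=> e0; have [q [k1 [k2 [HB n1 _]]]] := approx e0.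
  have [_ X _ _] := HB; have [mk1 _ ik1 _] := in_X_integrable HP HE X.
  have [id1 L1] := HA _ e (measurable_funB mh1 mk1) e0 n1.
  have -> : \int[mu3]_(x in B) h1 x = \int[mu3]_(x in B) (h1 x - k1 x).
    have -> := @RintegralB _ _ _ (@mu3 R) B _ _ mB ih1 ik1.
    by rewrite (mass_zero HP HE HB) subr0.
  apply: le_trans L1; exact: le_norm_Rintegral_subset id1.
apply/eqP; rewrite -normr_le0; apply/ler_addgt0Pr => e e0; rewrite add0r.
have A1 : 0 < A + 1 by rewrite ltr_wpDl.
apply: (le_trans (key (e / (A + 1)) _)); first by rewrite divr_gt0.
by rewrite mulrAC ler_pdivrMr// ler_pM2l// lerDl.
Qed.

(** For elements of the range this is [jump_identity] with [flux_weighted].  Both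
    sides are continuous for the norm of X: h2 is integrated away from the
    boundary only, and H is bounded by the L1 norm of h1. *)
Lemma closure_shell (a b : R) : 0 < a -> a < b -> b < Rs ->
  \int[mu3]_(x in shell a b) (h2 x - h1 x) =
  - \int[mu]_(t in `[a, b]) (drho t / rho0 t * H h1 t).
Proof.
move=> a0 ab bR.
have SB : shell a b `<=` B by move=> x /shell_sub_cball xb; exact: cball_sub_eball bR _ xb.
have mS := measurable_shell a b; have mB := @measurable_eball R Rs.
have mC := @measurable_cball R b.
have SC : shell a b `<=` [set x | enorm x <= b] := @shell_sub_cball _ a b.
have [A1 A10 HA1] := X1_L1 HP HE.
have [A2 A20 HA2] := X2_L1 HP HE bR.
have cw := drho_rho_continuous a0 bR.
have [M bM] : exists M, forall t, a <= t <= b -> `|drho t / rho0 t| <= M.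
  have cn : {within `[a, b], continuous (fun t => `|drho t / rho0 t|)}.
    by move=> t; apply: continuous_cvg; [exact: norm_continuous|exact: cw].
  have [c _ Hc] := EVT_max (ltW ab) cn; exists `|drho c / rho0 c| => t tab.
  by apply: Hc; rewrite in_itv.
have mw : measurable_fun `[a, b] (fun t => drho t / rho0 t).
  by apply: subspace_continuous_measurable_fun.
have iwH (g : R3 -> R) : mu3.-integrable B (EFin \o g) ->
    mu.-integrable `[a, b] (EFin \o (fun t => drho t / rho0 t * H g t)).
  move=> ig; have iH : mu.-integrable `[a, b] (EFin \o H g).
    apply: integrable_itvS (mass_below_integrable ig) => t /=; rewrite !in_itv/= => /andP[at_ tb].
    by rewrite (le_trans (ltW a0) at_) (le_trans tb (ltW bR)).
  apply: integrableMr (iH) => //.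
  exists M; split => [|y My t /=]; first exact: num_real.
  by rewrite in_itv/= => /bM/le_trans; apply; exact: ltW.
have aab : a <= a <= b by rewrite lexx ltW.
have M0 : 0 <= M := le_trans (normr_ge0 _) (bM a aab).
have [mh1 mh2 ih1 /(_ b bR) ih2] := in_X_integrable HP HE HX.
set D := LHS; set E := \int[mu]_(t in _) _.
pose C := A2 + A1 + M * (b - a) * A1.
have C0 : 0 <= C by rewrite !addr_ge0// !mulr_ge0// subr_ge0 ltW.
have key (e : R) : 0 < e -> `|D + E| <= e * C.
  move=> e0; have [q [k1 [k2 [HB n1 n2]]]] := approx e0.
  have [_ X _ _] := HB; have [mk1 mk2 ik1 /(_ b bR) ik2] := in_X_integrable HP HE X.
  have [id1 L1] := HA1 _ e (measurable_funB mh1 mk1) e0 n1.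
  have [id2 L2] := HA2 _ e (measurable_funB mh2 mk2) e0 n2.
  have K : \int[mu3]_(x in shell a b) (k2 x - k1 x) +
      \int[mu]_(t in `[a, b]) (drho t / rho0 t * H k1 t) = 0.
    by rewrite (jump_identity HP HE HB a0 ab bR) (flux_weighted HP HE HB a0 ab bR).2 addNr.
  have iS (g : R3 -> R) : mu3.-integrable B (EFin \o g) -> mu3.-integrable (shell a b) (EFin \o g).
    by move=> ig; apply: integrableS ig.
  have iC (g : R3 -> R) : mu3.-integrable [set x | enorm x <= b] (EFin \o g) ->
      mu3.-integrable (shell a b) (EFin \o g).
    by move=> ig; apply: integrableS ig.
  have D1 : D = \int[mu3]_(x in shell a b) h2 x - \int[mu3]_(x in shell a b) h1 x.
    exact: (@RintegralB _ _ _ (@mu3 R) _ _ _ mS (iC _ ih2) (iS _ ih1)).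
  have D2 := @RintegralB _ _ _ (@mu3 R) _ _ _ mS (iC _ ik2) (iS _ ik1).
  have D3 := @RintegralB _ _ _ (@mu3 R) _ _ _ mS (iC _ ih2) (iC _ ik2).
  have D4 := @RintegralB _ _ _ (@mu3 R) _ _ _ mS (iS _ ih1) (iS _ ik1).
  have Hsub t : H (fun x => h1 x - k1 x) t = H h1 t - H k1 t.
    rewrite /mass_below.
    have mBt : measurable (B `&` [set x | enorm x <= t]).
      by apply: measurableI => //; exact: measurable_cball.
    have iBt (g : R3 -> R) : mu3.-integrable B (EFin \o g) ->
        mu3.-integrable (B `&` [set x | enorm x <= t]) (EFin \o g).
      by move=> ig; apply: integrableS ig.
    exact: (@RintegralB _ _ _ (@mu3 R) _ _ _ mBt (iBt _ ih1) (iBt _ ik1)).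
  have D5 : \int[mu]_(t in `[a, b]) (drho t / rho0 t * H (fun x => h1 x - k1 x) t) =
     E - \int[mu]_(t in `[a, b]) (drho t / rho0 t * H k1 t).
    rewrite -(RintegralB _ (iwH _ ih1) (iwH _ ik1))//.
    by apply: eq_Rintegral => t _; rewrite Hsub mulrBr.
  have -> : D + E = \int[mu3]_(x in shell a b) (h2 x - k2 x)
     - \int[mu3]_(x in shell a b) (h1 x - k1 x)
     + \int[mu]_(t in `[a, b]) (drho t / rho0 t * H (fun x => h1 x - k1 x) t).
    rewrite D5 D4 D3 D1; move: K; rewrite D2 => K; rewrite -[LHS]subr0 -K; ring.
  have B1 := @le_norm_Rintegral_subset R _ _ (@mu3 R) _ _ _ mS mC SC id2.
  have B2 := @le_norm_Rintegral_subset R _ _ (@mu3 R) _ _ _ mS mB SB id1.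
  have B3 : `|\int[mu]_(t in `[a, b]) (drho t / rho0 t * H (fun x => h1 x - k1 x) t)| <=
      M * (b - a) * (e * A1).
    have icst : mu.-integrable `[a, b] (EFin \o cst (M * (e * A1))).
      apply: continuous_compact_integrable; first exact: segment_compact.
      by move=> t; exact: cvg_cst.
    have -> : M * (b - a) * (e * A1) = \int[mu]_(t in `[a, b]) cst (M * (e * A1)) t.
      rewrite Rintegral_cst//; have L : mu `[a, b]%classic = (b - a)%:E.
        by rewrite lebesgue_measure_itv/= lte_fin ab.
      have -> : M * (b - a) * (e * A1) = M * (e * A1) * fine (b - a)%:E by rewrite /=; ring.
      by rewrite -L.
    have iw := iwH _ id1; apply: le_trans; first by apply: le_normr_Rintegral iw.
    apply: le_Rintegral => //; first exact: (integrable_norm iw).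
    move=> t /=; rewrite in_itv/= => /bM bt; rewrite normrM; apply: ler_pM => //.
    exact: le_trans (mass_below_le t id1) L1.
  have := ler_normD (\int[mu3]_(x in shell a b) (h2 x - k2 x) - \int[mu3]_(x in shell a b) (h1 x - k1 x))
    (\int[mu]_(t in `[a, b]) (drho t / rho0 t * H (fun x => h1 x - k1 x) t)).
  move=> /le_trans; apply.
  have := ler_normB (\int[mu3]_(x in shell a b) (h2 x - k2 x)) (\int[mu3]_(x in shell a b) (h1 x - k1 x)).
  have : e * C = e * A2 + e * A1 + M * (b - a) * (e * A1) by rewrite /C; ring.
  move=> -> L; apply: lerD B3; apply: (le_trans L).
  by apply: lerD; [exact: le_trans B1 L2|exact: le_trans B2 L1].
apply/eqP; rewrite -addr_eq0 -normr_le0; apply/ler_addgt0Pr => e e0; rewrite add0r.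
have C1 : 0 < C + 1 by rewrite ltr_wpDl.
apply: (le_trans (key (e / (C + 1)) _)); first by rewrite divr_gt0.
by rewrite mulrAC ler_pdivrMr// ler_pM2l// lerDl.
Qed.

End Closure.

Variables (eta s : R -> R).
Hypotheses (meta : measurable_fun (`[0, Rs[) eta) (ms : measurable_fun `[0, Rs[ s).
Local Notation om := (omega2 rho0 f eta s).
Hypothesis HX : in_X P rho0 S0 f Rs (fun x => eta (enorm x)) (fun x => om (enorm x)).

Lemma omega2_measurable : measurable_fun `[0, Rs[ om.
Proof.
apply: measurable_funB => //; apply: measurable_funM => //.
apply: measurableT_comp; first exact: measurable_inv.
apply: (@measurable_funS _ _ _ _ `[0, Rs]%classic) => //.
  by apply: subset_itvl; rewrite bnd_simp.
by apply: subspace_continuous_measurable_fun => //; exact: (df_rho0_continuous HE).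
Qed.

Lemma eta_integrable : mu.-integrable `[0, Rs] (EFin \o (fun t => t ^+ 2 * eta t)).
Proof.
apply: integrable_co_cc => //; apply/integrable_radial => //.
by have [_ _ i _] := in_X_integrable HP HE HX.
Qed.

Lemma shell_integrable_eta (a b : R) : b < Rs ->
  mu3.-integrable (shell a b) (fun x => (eta (enorm x))%:E).
Proof.
move=> bR; have [_ _ i _] := in_X_integrable HP HE HX.
apply: integrableS i; [exact: measurable_eball|exact: measurable_shell|].
by move=> x /shell_sub_cball xb; exact: cball_sub_eball bR _ xb.
Qed.

Lemma shell_integrable_omega2 (a b : R) : b < Rs ->
  mu3.-integrable (shell a b) (fun x => (om (enorm x))%:E).
Proof.
move=> bR; have [_ _ _ /(_ b bR) i] := in_X_integrable HP HE HX.
apply: integrableS i; [exact: measurable_cball|exact: measurable_shell|].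
exact: shell_sub_cball.
Qed.

Lemma mass_below_radial (t : R) : 0 <= t < Rs ->
  H (fun x => eta (enorm x)) t = sphere_const * \int[mu]_(u in `[0, t]) (u ^+ 2 * eta u).
Proof.
move=> /andP[t0 tR].
rewrite -(Rintegral_shell_radial (lexx 0) tR meta (shell_integrable_eta 0 tR)).2.
rewrite /mass_below; congr (Rintegral _ _ _).
apply/seteqP; split => x; rewrite /shell/=; first by move=> [_ xt]; rewrite enorm_ge0.
by move=> /andP[_ xt]; split => //; exact: le_lt_trans tR.
Qed.

(** In polar coordinates the identity on shells has the primitive of t^2 eta in
    place of H, and as a and b are arbitrary it holds pointwise a.e. *)
Lemma closure_necessary :
  in_closure_RanB P rho0 S0 f Rs (fun x => eta (enorm x)) (fun x => om (enorm x)) ->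
  enclosed eta Rs = 0 /\
  {ae mu, forall r, 0 < r < Rs ->
    s r = dfr (rho0 r) * (drho r / (4 * pi * r ^+ 2 * rho0 r)) * enclosed eta r}.
Proof.
move=> Hcl; have k0 := @sphere_const_gt0 R.
split.
  have [_ _ i _] := in_X_integrable HP HE HX.
  have := closure_mass_zero Hcl; rewrite (Rintegral_radial meta ((integrable_radial meta).1 i)).
  move/eqP; rewrite mulf_eq0 gt_eqF//= => /eqP I0.
  rewrite /enclosed -Rintegral_itv_bndo_bndc ?I0 ?mulr0//.
  exact: ((integrable_radial meta).1 i).
pose N t := \int[mu]_(u in `[0, t]) (u ^+ 2 * eta u).
pose h t := t ^+ 2 * (om t - eta t) + drho t / rho0 t * N t.
have mo := omega2_measurable.
have md : measurable_fun `[0, Rs[ (fun t => om t - eta t) by exact: measurable_funB.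
have iboth (a b : R) : 0 < a -> a < b -> b < Rs ->
  [/\ mu.-integrable `[a, b] (EFin \o (fun t => t ^+ 2 * (om t - eta t))),
      mu.-integrable `[a, b] (EFin \o (fun t => drho t / rho0 t * N t)),
      \int[mu3]_(x in shell a b) (om (enorm x) - eta (enorm x)) =
        sphere_const * \int[mu]_(t in `[a, b]) (t ^+ 2 * (om t - eta t))
    & \int[mu]_(t in `[a, b]) (drho t / rho0 t * H (fun x => eta (enorm x)) t) =
        sphere_const * \int[mu]_(t in `[a, b]) (drho t / rho0 t * N t)].
  move=> a0 ab bR.
  have iD : mu3.-integrable (shell a b) (fun x => ((om (enorm x) - eta (enorm x))%R)%:E).
    exact: (@integrableB _ _ _ (@mu3 R) _ (measurable_shell a b) _ _
      (shell_integrable_omega2 a bR) (shell_integrable_eta a bR)).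
  have [i1 e1] := Rintegral_shell_radial (ltW a0) bR md iD.
  have i2 : mu.-integrable `[a, b] (EFin \o (fun t => drho t / rho0 t * N t)).
    apply: continuous_compact_integrable; first exact: segment_compact.
    move=> t; apply: cvgM; first exact: (drho_rho_continuous a0 bR).
    have cN := primitive_continuous Rs0 eta_integrable.
    apply: (@continuous_subspaceW _ _ _ `[0, Rs]%classic _ _ cN t).
    move=> u /=; rewrite !in_itv/= => /andP[au ub].
    by rewrite (le_trans (ltW a0) au) (le_trans ub (ltW bR)).
  split => //; rewrite -RintegralZl//; apply: eq_Rintegral => t; rewrite inE/= in_itv/= => /andP[at_ tb].
  rewrite mass_below_radial ?(le_trans (ltW a0) at_) ?(le_lt_trans tb)//.
  by rewrite mulrCA.
have hz : {ae mu, forall t, 0 < t < Rs -> h t = 0}.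
  apply: ae_itv_eq0 => a b a0 ab bR; have [i1 i2 e1 e2] := iboth a b a0 ab bR.
    by apply: eq_integrable (integrableD _ i1 i2).
  have -> : \int[mu]_(t in `[a, b]) h t = \int[mu]_(t in `[a, b]) (t ^+ 2 * (om t - eta t)) +
      \int[mu]_(t in `[a, b]) (drho t / rho0 t * N t) by apply: (RintegralD _ i1 i2).
  have := closure_shell Hcl a0 ab bR; rewrite e1 e2 -mulrN => /(mulfI (lt0r_neq0 k0)) ->.
  by rewrite addNr.
have hd := df_rho0_lt0_ae HP HE.
apply: filterS2 hz hd; first exact: (ae_filter_ringOfSetsType mu).
move=> t ht dt tR; have /andP[t0 tRs] := tR; have d0 := dt tR.
have := ht tR; rewrite /h /omega2 addrAC subrr sub0r /enclosed -/(N t) => E.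
have r0 : 0 < rho0 t by rewrite (rho0_gt0 HE)// (ltW t0).
have dn : df rho0 f (rho0 t) != 0 by rewrite lt_eqF.
have pi0 : (pi : R) != 0 by rewrite gt_eqF// pi_gt0.
have -> : s t = dfr (rho0 t) * t ^- 2 * (t ^+ 2 * (s t / dfr (rho0 t))).
  by field; rewrite dn gt_eqF.
move: E; rewrite mulrN => /eqP; rewrite addrC subr_eq0 => /eqP <-.
move: (pi : R) pi0 => p p0; field.
by rewrite p0 (gt_eqF r0) gt_eqF.
Qed.

End ClosureNecessary.

(** * Approximation by truncated fields *)
Section ClosureSufficient.
Context {R : realType}.
Local Notation R3 := (R * R * R)%type.
Local Notation mu := (@lebesgue_measure R).
Variables (P : R -> R -> R) (gamma0 alpha0 : R) (rho0 S0 f : R -> R) (Rs : R).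
Hypotheses (HP : pressure_law P gamma0 alpha0)
  (HE : equilibrium P gamma0 alpha0 rho0 S0 f Rs).
Local Notation B := (@eball R Rs).
Local Notation drho := (drho0 rho0 Rs).
Local Notation dfr := (df rho0 f).
Local Notation w1 := (w1 P rho0 f).
Local Notation w2 := (w2 P rho0 S0 f).

Let Rs0 : 0 < Rs := eq_Rs HE.

Lemma L2_integrable (w h : R3 -> R) : measurable_fun B w -> (forall x, B x -> 0 <= w x) ->
  measurable_fun B h ->
  mu3.-integrable B (EFin \o (fun x => w x * h x ^+ 2)) <-> (normsq mu3 B w h < +oo)%E.
Proof.
move=> mw w0 mh.
have mwh : measurable_fun B (EFin \o (fun x => w x * h x ^+ 2)).
  by apply/measurable_EFinP; apply: measurable_funM => //; exact: measurable_funX.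
have E : (\int[mu3]_(x in B) `|(EFin \o (fun x => (w x * h x ^+ 2)%R)) x| = normsq mu3 B w h)%E.
  by apply: eq_integral => x; rewrite inE => xB; rewrite /= ger0_norm// mulr_ge0 ?sqr_ge0 ?w0.
split; first by case/integrableP => _; rewrite E.
by move=> fin; apply/integrableP; split => //; rewrite E.
Qed.

Lemma integrable_le (g d : R3 -> R) : measurable_fun B g ->
  mu3.-integrable B (EFin \o d) -> (forall x, B x -> `|g x| <= d x) ->
  mu3.-integrable B (EFin \o g).
Proof.
move=> mg id gd; apply: le_integrable id.
- exact: measurable_eball.
- exact/measurable_EFinP.
- by move=> x xB; rewrite /= lee_fin (le_trans (gd x xB))// ler_norm.
Qed.

Variables (eta s : R -> R).
Hypotheses (meta : measurable_fun (`[0, Rs[) eta) (ms : measurable_fun (`[0, Rs[) s).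
Local Notation om := (omega2 rho0 f eta s).
Hypothesis HX : in_X P rho0 S0 f Rs (fun x => eta (enorm x)) (fun x => om (enorm x)).

Definition moment (t : R) : R := \int[mu]_(u in `[0, t]) (u ^+ 2 * eta u).
Local Notation N := moment.

Hypothesis N0 : N Rs = 0.

Let ig := eta_integrable HP HE meta HX.
Let cN : {within `[0, Rs], continuous N} := primitive_continuous Rs0 ig.
Let sub : `[0, Rs[%classic `<=` `[0, Rs]%classic.
Proof. by apply: subset_itvl; rewrite bnd_simp. Qed.
Let mN : measurable_fun (`[0, Rs[) N.
Proof. apply: measurable_funS sub _ => //; exact: primitive_measurable Rs0 ig. Qed.

(** The moment vanishes at 0 and at the boundary, so it is small near both ends:
    truncating its values also cuts off the radius. *)
Lemma moment_cutoff n : exists a b : R, [/\ 0 < a, a < b, b < Rs &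
  forall t, 0 <= t <= Rs -> ~~ (a < t < b) -> trunc n (N t) = 0 /\ dtrunc n (N t) = 0].
Proof.
pose e : R := n.+1%:R^-1; have e0 : 0 < e by rewrite invr_gt0.
have small y : `|y| <= e -> trunc n y = 0 /\ dtrunc n y = 0.
  move=> ye; apply: trunc_small.
  have y1 : n.+1%:R * `|y| <= 1 by rewrite mulrC -ler_pdivlMr// div1r.
  have e1 : e <= 1 by rewrite /e invf_le1// ler1n.
  rewrite -real_normK ?num_real// expr2 mulrA -[leRHS]mulr1.
  by apply: ler_pM => //; exact: le_trans e1.
have [a /andP[a0 aR] Ha] := primitive_cvg0 Rs0 ig e0.
have [_ _ /cvgrPdist_le/(_ _ e0)] := (continuous_within_itvP _ Rs0).1 cN.
rewrite N0 => -[d /= d0 Hd].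
pose a' := Num.min a (Rs / 2); pose b := Num.max (3 / 4 * Rs) (Rs - d / 2).
have R2 : 0 < Rs / 2 by rewrite divr_gt0.
have a'0 : 0 < a' by rewrite lt_min a0.
have a'R : a' <= Rs / 2 by rewrite ge_min lexx orbT.
have bR : b < Rs by rewrite gt_max; apply/andP; split; move: Rs0 => /= ?; lra.
have bR' : 3 / 4 * Rs <= b by rewrite le_max lexx.
exists a', b; split => //; first by move: Rs0 => /= ?; lra.
move=> t /andP[t0 tR]; rewrite negb_and -!leNgt => /orP[ta|bt]; apply: small.
  by apply: Ha; rewrite t0 (le_trans ta)// ge_min lexx.
move: tR; rewrite le_eqVlt => /predU1P[->|tR]; first by rewrite N0 normr0 ltW.
have := Hd t _ tR; rewrite sub0r normrN; apply.
rewrite /= gtr0_norm ?subr_gt0//.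
have : Rs - d / 2 <= t by apply: le_trans bt; rewrite le_max lexx orbT.
lra.
Qed.

Let chain n (t : R) : 0 <= t <= Rs ->
  trunc n (N t) = \int[mu]_(u in `[0, t]) (dtrunc n (N u) * (u ^+ 2 * eta u)).
Proof.
move=> /andP[]; rewrite le_eqVlt => /predU1P[<-|t0] tR.
  by rewrite set_itv1 Rintegral_set1 /N set_itv1 Rintegral_set1 /trunc mul0r.
apply: (trunc_chain t0); apply: integrable_itvS ig; exact: subset_itvl.
Qed.

(** The field -N(r) x/r^3 solves B q = (eta, om) formally, but its behaviour at the
    centre and at the boundary is uncontrolled.  Truncating N in value, and not
    the field in radius, makes the support compact in the punctured ball
    without producing any derivative of a cutoff. *)
Definition moment_field n (x : R3) : R3 := (- (trunc n (N (enorm x)) * enorm x ^- 3)) *: x.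
(** The two components of the image of [moment_field n] under B. *)
Definition comp1 n (t : R) : R := dtrunc n (N t) * eta t.
Definition comp2 n (t : R) : R := comp1 n t - drho t / (rho0 t * t ^+ 2) * trunc n (N t).

Let mtr n : measurable_fun (`[0, Rs[) (fun t => trunc n (N t)).
Proof.
by apply: measurableT_comp mN; apply: continuous_measurable_fun; exact: continuous_trunc.
Qed.

Let mdtr n : measurable_fun (`[0, Rs[) (fun t => dtrunc n (N t)).
Proof.
by apply: measurableT_comp mN; apply: continuous_measurable_fun; exact: continuous_dtrunc.
Qed.

Let mc1 n : measurable_fun (`[0, Rs[) (comp1 n).
Proof. exact: measurable_funM (mdtr n) meta. Qed.

Let mrho : measurable_fun (`[0, Rs[) rho0.
Proof.
apply: (@measurable_funS _ _ _ _ `[0, Rs]%classic) => //.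
by apply: subspace_continuous_measurable_fun => //; exact: (rho0_continuous HE).
Qed.

Let mweight : measurable_fun (`[0, Rs[) (fun t => drho t / (rho0 t * t ^+ 2)).
Proof.
apply: measurable_funM.
  apply: (@measurable_funS _ _ _ _ `[0, Rs]%classic) => //.
  by apply: subspace_continuous_measurable_fun => //; exact: (drho0_continuous HE).
apply: measurableT_comp; first exact: measurable_inv.
by apply: measurable_funM => //; exact: measurable_funX.
Qed.

Let mc2 n : measurable_fun (`[0, Rs[) (comp2 n).
Proof. exact: measurable_funB (mc1 n) (measurable_funM mweight (mtr n)). Qed.

(** Where the truncation is nonzero the radius stays in a compact part of (0,Rs),
    and all weights are bounded there. *)
Lemma moment_field_bounds n : exists2 M : R, 0 <= M & forall t, 0 <= t < Rs ->
  `|trunc n (N t) * t ^- 3| <= M /\ `|drho t / (rho0 t * t ^+ 2) * trunc n (N t)| <= M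
  /\ (rho0 t)^-1 * (trunc n (N t) * t ^- 3) ^+ 2 <= M.
Proof.
have [a [b [a0 ab bR Hab]]] := moment_cutoff n.
have [M1 M10 HM1] := primitive_bounded ig.
have [C C0 HC] := drho0_bounded HE.
have rb : 0 < rho0 b by rewrite (rho0_gt0 HE)// bR (ltW (lt_trans a0 ab)).
pose X1 := M1 * a ^- 3; pose X2 := C * ((rho0 b)^-1 * a ^- 2) * M1; pose X3 := (rho0 b)^-1 * X1 ^+ 2.
have X10 : 0 <= X1 by rewrite mulr_ge0// invr_ge0 exprn_ge0// ltW.
have X20 : 0 <= X2 by rewrite !mulr_ge0// ?invr_ge0 ?exprn_ge0// ltW.
have X30 : 0 <= X3 by apply: mulr_ge0; [rewrite invr_ge0 ltW|exact: sqr_ge0].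
exists (X1 + X2 + X3); first by rewrite !addr_ge0.
move=> t /andP[t0 tR]; have t0R : 0 <= t <= Rs by rewrite t0 ltW.
have [/andP[at_ tb]|/(Hab t t0R)[-> _]] := boolP (a < t < b); last first.
  by rewrite !mul0r !mulr0 normr0 expr0n mulr0 !addr_ge0.
have tp : 0 < t := lt_trans a0 at_.
have rt : 0 < rho0 t by rewrite (rho0_gt0 HE)// t0.
have rV : (rho0 t)^-1 <= (rho0 b)^-1.
  by rewrite lef_pV2 ?posrE//; apply: ltW; apply: (rho0_lt HE) => //; exact: ltW.
have tN : `|trunc n (N t)| <= M1 by apply: le_trans (trunc_le _ _) _; exact: HM1.
have tV k : t ^- k <= a ^- k.
  by rewrite lef_pV2 ?posrE ?exprn_gt0// lerXn2r ?nnegrE ?ltW.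
have tV0 k : 0 <= t ^- k by rewrite invr_ge0 exprn_ge0// ltW.
have b1 : `|trunc n (N t) * t ^- 3| <= X1.
  by rewrite normrM (ger0_norm (tV0 3%N)); apply: ler_pM.
split; last split.
- by apply: (le_trans b1); rewrite -addrA lerDl addr_ge0.
- have : `|drho t / (rho0 t * t ^+ 2) * trunc n (N t)| <= X2.
    rewrite normrM; apply: ler_pM => //; rewrite normrM; apply: ler_pM => //; first exact: HC.
    rewrite invfM ger0_norm ?mulr_ge0 ?invr_ge0 ?(ltW rt) ?sqr_ge0//.
    by apply: ler_pM => //; rewrite ?invr_ge0 ?(ltW rt)// -/(t ^- 2).
  by move=> /le_trans; apply; rewrite addrAC lerDr addr_ge0.
- apply: (@le_trans _ _ X3); last by rewrite lerDr addr_ge0.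
  apply: ler_pM; [by rewrite invr_ge0 ltW|exact: sqr_ge0|exact: rV|].
  by rewrite -[leLHS]real_normK ?num_real// lerXn2r ?nnegrE.
Qed.

Let moment0 : N 0 = 0.
Proof. by rewrite /N set_itv1 Rintegral_set1. Qed.

Let at0 n : trunc n (N 0) = 0 /\ dtrunc n (N 0) = 0.
Proof. by rewrite moment0; apply: trunc_small; rewrite expr0n mulr0. Qed.

Let mB := @measurable_eball R Rs.
Let mw1 := w1_measurable HP HE.
Let mw2 := w2_measurable HP HE.
Let w1_0 x : B x -> 0 <= w1 x.
Proof. by move=> xB; rewrite ltW// (w1_pos HE). Qed.
Let w2_0 x : B x -> 0 <= w2 x.
Proof. exact: (w2_nonneg HP HE). Qed.

Let rad (h : R -> R) : measurable_fun (`[0, Rs[) h -> measurable_fun B (fun x => h (enorm x)).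
Proof. exact: measurable_radial. Qed.

Let inR x : B x -> 0 <= enorm x < Rs.
Proof. by move=> xB; rewrite enorm_ge0. Qed.

Let iw1eta : mu3.-integrable B (EFin \o (fun x => w1 x * eta (enorm x) ^+ 2)).
Proof.
by apply/(L2_integrable mw1 w1_0 (rad meta)); have [[_ ?] _] := HX.
Qed.

Let iZ (c : R) (g : R3 -> R) : mu3.-integrable B (EFin \o g) ->
  mu3.-integrable B (EFin \o (fun x => c * g x)).
Proof. move=> i; exact: (@integrableZl _ _ _ (@mu3 R) B mB c _ i). Qed.

Let iD (g h : R3 -> R) : mu3.-integrable B (EFin \o g) -> mu3.-integrable B (EFin \o h) ->
  mu3.-integrable B (EFin \o (fun x => g x + h x)).
Proof. move=> i j; exact: (@integrableD _ _ _ (@mu3 R) B mB _ _ i j). Qed.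

Let msq (w : R3 -> R) (h : R -> R) : measurable_fun B w -> measurable_fun (`[0, Rs[) h ->
  measurable_fun B (fun x => w x * h (enorm x) ^+ 2).
Proof.
move=> mw mh; apply: measurable_funM => //.
by apply: measurable_funX; exact: rad.
Qed.

Let iw2eta : mu3.-integrable B (EFin \o (fun x => w2 x * eta (enorm x) ^+ 2)).
Proof.
have [C C0 HC] := schwarzschild_le_w1 HP HE.
apply: integrable_le (msq mw2 meta) (iZ C iw1eta) _ => x xB.
rewrite (ger0_norm (mulr_ge0 (w2_0 xB) (sqr_ge0 _))) mulrA.
by apply: ler_wpM2r; [exact: sqr_ge0|apply: HC; exact: inR].
Qed.

Let mom := omega2_measurable HE meta ms.

Let iw2om : mu3.-integrable B (EFin \o (fun x => w2 x * om (enorm x) ^+ 2)).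
Proof.
by apply/(L2_integrable mw2 w2_0 (rad mom)); have [_ [_ ?]] := HX.
Qed.

Let transport (t : R) : R := drho t / (rho0 t * t ^+ 2) * N t.
Local Notation u := transport.
Let mu_ : measurable_fun (`[0, Rs[) u.
Proof. exact: measurable_funM. Qed.

Hypothesis Hs : {ae mu, forall t, 0 < t < Rs -> om t = eta t - u t}.

Let HsB : {ae @mu3 R, forall x, B x -> x != 0 -> om (enorm x) = eta (enorm x) - u (enorm x)}.
Proof. exact: ae_radial Hs. Qed.

Let not0 : {ae @mu3 R, forall x, x != 0}.
Proof.
exists [set 0]; split; [exact: measurable_set0|exact: mu3_set0|].
by move=> x /= /negP; rewrite negbK => /eqP.
Qed.

Let ae2 (p q r : R3 -> Prop) : {ae @mu3 R, forall x, p x} -> {ae @mu3 R, forall x, q x} ->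
  (forall x, p x -> q x -> r x) -> {ae @mu3 R, forall x, r x}.
Proof.
move=> hp hq pqr; exact: (@filterS2 _ _ (ae_filter_ringOfSetsType (@mu3 R)) p q r pqr hp hq).
Qed.

Let iw2u : mu3.-integrable B (EFin \o (fun x => w2 x * u (enorm x) ^+ 2)).
Proof.
have i1 : mu3.-integrable B (EFin \o (fun x => 2 * (w2 x * om (enorm x) ^+ 2) + 2 * (w2 x * eta (enorm x) ^+ 2))).
  exact: iD (iZ 2 iw2om) (iZ 2 iw2eta).
have mm := msq mw2 mu_.
apply/integrableP; split; first exact/measurable_EFinP.
case/integrableP: (i1) => mi fin.
apply: le_lt_trans fin; apply: ae_ge0_le_integral => //.
- by apply: measurableT_comp => //; exact/measurable_EFinP.
- exact: measurableT_comp.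
apply: ae2 HsB not0 _ => x Hx x0 xB; rewrite /= lee_fin.
have w0 := w2_0 xB.
have n1 (y : R) : 0 <= w2 x * y ^+ 2 := mulr_ge0 w0 (sqr_ge0 y).
rewrite ger0_norm// ger0_norm; last by rewrite addr_ge0// mulr_ge0.
rewrite Hx// -!mulrDr [leRHS]mulrCA; apply: ler_wpM2l => //.
by move: (eta _) (u _) => y z; rewrite -subr_ge0 (_ : _ - _ = (2 * y - z) ^+ 2) ?sqr_ge0//; ring.
Qed.

Lemma comp1_in_L2 n : mu3.-integrable B (EFin \o (fun x => w1 x * comp1 n (enorm x) ^+ 2)).
Proof.
apply: integrable_le (msq mw1 (mc1 n)) (iZ 49 iw1eta) _ => x xB.
rewrite (ger0_norm (mulr_ge0 (w1_0 xB) (sqr_ge0 _))) [leRHS]mulrCA; apply: ler_wpM2l; first exact: w1_0.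
rewrite /comp1 exprMn; apply: ler_wpM2r; first exact: sqr_ge0.
rewrite -[leLHS]real_normK ?num_real// (_ : 49 = 7 ^+ 2 :> R); last by ring.
by rewrite lerXn2r ?nnegrE// dtrunc_le.
Qed.

Let comp2_le n t : 0 <= t < Rs -> `|comp2 n t| <= 7 * `|eta t| + `|u t|.
Proof.
move=> tR; rewrite /comp2; apply: (le_trans (ler_normB _ _)); apply: lerD.
  by rewrite /comp1 normrM; apply: ler_wpM2r => //; exact: dtrunc_le.
by rewrite /transport [leLHS]normrM [leRHS]normrM; apply: ler_wpM2l => //; exact: trunc_le.
Qed.

Let sq3 (a b c y : R) : `|y| <= a + b + c -> y ^+ 2 <= 3 * (a ^+ 2 + b ^+ 2 + c ^+ 2).
Proof.
move=> H; have s0 : 0 <= a + b + c := le_trans (normr_ge0 _) H.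
apply: (@le_trans _ _ ((a + b + c) ^+ 2)).
  by rewrite -[leLHS]real_normK ?num_real// lerXn2r ?nnegrE.
rewrite -subr_ge0 (_ : _ - _ = (a - b) ^+ 2 + (a - c) ^+ 2 + (b - c) ^+ 2); last by ring.
by rewrite !addr_ge0// sqr_ge0.
Qed.

Lemma comp2_in_L2 n : mu3.-integrable B (EFin \o (fun x => w2 x * comp2 n (enorm x) ^+ 2)).
Proof.
have i : mu3.-integrable B (EFin \o (fun x => 147 * (w2 x * eta (enorm x) ^+ 2) + 3 * (w2 x * u (enorm x) ^+ 2))).
  exact: iD (iZ 147 iw2eta) (iZ 3 iw2u).
apply: integrable_le (msq mw2 (mc2 n)) i _ => x xB.
rewrite (ger0_norm (mulr_ge0 (w2_0 xB) (sqr_ge0 _))).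
rewrite (mulrCA 147) (mulrCA 3) -mulrDr; apply: ler_wpM2l; first exact: w2_0.
have := @sq3 (7 * `|eta (enorm x)|) `|u (enorm x)| 0 (comp2 n (enorm x)).
rewrite addr0 => /(_ (comp2_le n (inR xB)))/le_trans; apply.
rewrite expr0n addr0 exprMn !real_normK ?num_real//.
by rewrite le_eqVlt; apply/orP; left; apply/eqP; ring.
Qed.

Lemma comp1_integrable n : mu3.-integrable B (EFin \o (fun x => comp1 n (enorm x))).
Proof.
have [_ _ i _] := in_X_integrable HP HE HX.
have i7 := iZ 7 (integrable_norm i).
apply: integrable_le (rad (mc1 n)) i7 _ => x xB.
by rewrite /comp1 normrM; apply: ler_wpM2r => //; exact: dtrunc_le.
Qed.

Lemma bounded_integrable (g : R3 -> R) (M : R) : measurable_fun B g ->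
  (forall x, B x -> `|g x| <= M) -> mu3.-integrable B (EFin \o g).
Proof.
move=> mg gM; apply: integrable_le mg _ gM.
apply/integrableP; split; first by apply/measurable_EFinP; exact: measurable_cst.
rewrite -[X in (X < _)%E]/(\int[mu3]_(x in B) cst `|M|%:E x)%E.
by rewrite integral_cst//= lte_mul_pinfty//; exact: mu3_eball_fin.
Qed.

Let correction n (t : R) : R := drho t / (rho0 t * t ^+ 2) * trunc n (N t).

Lemma correction_integrable n : mu3.-integrable B (EFin \o (fun x => correction n (enorm x))).
Proof.
have [M M0 HM] := moment_field_bounds n.
apply: (@bounded_integrable _ M); first exact: rad (measurable_funM mweight (mtr n)).
by move=> x /inR/HM[_ []].
Qed.

Lemma comp2_integrable n : mu3.-integrable B (EFin \o (fun x => comp2 n (enorm x))).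
Proof.
exact: (@integrableB _ _ _ (@mu3 R) B mB _ _ (comp1_integrable n) (correction_integrable n)).
Qed.

Lemma dot_moment_field n (x y : R3) : dot (moment_field n x) y = - (trunc n (N (enorm x)) * enorm x ^- 3) * dot x y.
Proof. by rewrite dotC dotZr dotC. Qed.

Lemma moment_field_L2vec n : L2vec mu3 B (fun x => (rho0 (enorm x))^-1) (moment_field n).
Proof.
have mprof : measurable_fun B (fun x => - (trunc n (N (enorm x)) * enorm x ^- 3)).
  apply: measurableT_comp => //; apply: (rad (h := fun t => trunc n (N t) * t ^- 3)).
  apply: measurable_funM => //; apply: measurableT_comp; first exact: measurable_inv.
  exact: measurable_funX.
split.
- by apply: measurable_funM => //; apply: measurable_funTS; apply: continuous_measurable3; exact: continuous_X1.
- by apply: measurable_funM => //; apply: measurable_funTS; apply: continuous_measurable3; exact: continuous_X2.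
- by apply: measurable_funM => //; apply: measurable_funTS; apply: continuous_measurable3; exact: continuous_X3.
have [M M0 HM] := moment_field_bounds n.
pose p t := (rho0 t)^-1 * (trunc n (N t) * t ^- 3) ^+ 2 * t ^+ 2.
have E x : (rho0 (enorm x))^-1 * dot (moment_field n x) (moment_field n x) = p (enorm x).
  by rewrite dot_moment_field dotC dot_moment_field -enorm_sqr /p; ring.
have mp : measurable_fun (`[0, Rs[) p.
  apply: measurable_funM; last exact: measurable_funX.
  apply: measurable_funM; first by apply: measurableT_comp mrho; exact: measurable_inv.
  apply: measurable_funX; apply: measurable_funM => //.
  apply: measurableT_comp; first exact: measurable_inv.
  exact: measurable_funX.
have ip : mu3.-integrable B (EFin \o (fun x => p (enorm x))).
  apply: (@bounded_integrable _ (M * Rs ^+ 2)); first exact: rad.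
  move=> x xB; have [_ [_ H3]] := HM _ (inR xB).
  have /andP[e0 eR] := inR xB.
  have r0 : 0 <= (rho0 (enorm x))^-1 by rewrite invr_ge0 ltW// (rho0_gt0 HE)// inR.
  have p0 : 0 <= p (enorm x) by exact: mulr_ge0 (mulr_ge0 r0 (sqr_ge0 _)) (sqr_ge0 _).
  rewrite ger0_norm// /p; apply: ler_pM => //.
  - by rewrite mulr_ge0 ?sqr_ge0.
  - exact: sqr_ge0.
  - by rewrite lerXn2r ?nnegrE ?(ltW eR) ?(ltW Rs0).
case/integrableP: (ip) => _; apply: le_lt_trans.
apply: ge0_le_integral => //.
- by move=> x xB; rewrite lee_fin mulr_ge0 ?dot_ge0// invr_ge0 ltW// (rho0_gt0 HE)// inR.
- by apply/measurable_EFinP; under eq_fun do rewrite E; exact: rad.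
- by apply: measurableT_comp => //; apply/measurable_EFinP; exact: rad.
- by move=> x xB; rewrite lee_fin E /= ler_norm.
Qed.

Let integrable_test (g phi : R3 -> R) : test_fun B phi -> mu3.-integrable B (EFin \o g) ->
  mu3.-integrable B (EFin \o (fun x => g x * phi x)).
Proof.
move=> /test_fun_bounded[cphi [M HM]] ig'.
have : mu3.-integrable B (EFin \o (fun x => phi x * g x)).
  apply: integrableMr (ig') => //.
    by apply: measurable_funTS; exact: continuous_measurable3.
  exists M; split => [|y My x _]; first exact: num_real.
  exact: le_trans (HM x) (ltW My).
by apply: eq_integrable => // x _ /=; rewrite mulrC.
Qed.

Let L1loc_of (g : R3 -> R) : mu3.-integrable B (EFin \o g) -> L1loc B g.
Proof.
move=> ig' K cK KB; apply: integrableS ig' => //.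
rewrite -[K]setCK; apply: measurableC; apply: open_measurable3; apply: closed_openC.
by apply: compact_closed cK; exact: norm_hausdorff.
Qed.

(** Chain rule for the truncated moment, then [radial_divergence_L1]. *)
Lemma moment_field_weak_divergence n (phi : R3 -> R) : test_fun B phi ->
  B1 Rs (moment_field n) phi = \int[mu3]_(x in B) (comp1 n (enorm x) * phi x).
Proof.
move=> tphi; have [a [b [a0 ab bR Hab]]] := moment_cutoff n.
pose g t := dtrunc n (N t) * (t ^+ 2 * eta t).
have iG : mu.-integrable `[0, Rs] (EFin \o g).
  apply: integrableMr (ig) => //.
    apply: measurableT_comp (primitive_measurable Rs0 ig).
    by apply: continuous_measurable_fun; exact: continuous_dtrunc.
  exists 7; split => [|y My x _]; first exact: num_real.
  exact: le_trans (dtrunc_le _ _) (ltW My).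
have g0 t : 0 <= t <= a -> g t = 0.
  move=> /andP[t0 ta]; rewrite /g (Hab t _ _).2 ?mul0r//; last by rewrite ltNge ta.
  by rewrite t0 (le_trans ta)// ltW// (lt_trans ab).
have := radial_divergence_L1 a0 Rs0 iG g0 tphi.
have -> : \int[mu3]_(x in B) ((\int[mu]_(s in `[0, enorm x]) g s) * enorm x ^- 3 * dot x (grad phi x)) =
    \int[mu3]_(x in B) (- dot (moment_field n x) (grad phi x)).
  apply: eq_Rintegral => x; rewrite inE => /inR/andP[x0 xR].
  by rewrite -chain ?x0 ?(ltW xR)// dot_moment_field mulNr opprK.
have -> : \int[mu3]_(x in B) (g (enorm x) * enorm x ^- 2 * phi x) =
    \int[mu3]_(x in B) (comp1 n (enorm x) * phi x).
  apply: eq_Rintegral => x _; congr (_ * _); rewrite /g /comp1.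
  have [->|x0] := eqVneq (enorm x) 0; first by rewrite (at0 n).2 !mul0r.
  by field.
move=> E; apply: oppr_inj; rewrite -E /B1.
have mq : mu3.-integrable B (EFin \o (fun x => dot (moment_field n x) (grad phi x))).
  have [cpsi [M2 HM2]] := test_fun_radial_derivative tphi.
  have [M M0 HM] := moment_field_bounds n.
  have mp : measurable_fun B (fun x => - (trunc n (N (enorm x)) * enorm x ^- 3)).
    apply: measurableT_comp => //; apply: (rad (h := fun t => trunc n (N t) * t ^- 3)).
    apply: measurable_funM => //; apply: measurableT_comp; first exact: measurable_inv.
    exact: measurable_funX.
  apply: (@bounded_integrable _ (M * M2)).
    under eq_fun do rewrite dot_moment_field.
    apply: measurable_funM => //; apply: measurable_funTS; exact: continuous_measurable3.
  move=> x /inR/HM[Hx _]; rewrite dot_moment_field normrM normrN; exact: ler_pM.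
rewrite -mulN1r -(@RintegralZl _ _ _ (@mu3 R) B _ _ mB mq).
by apply: eq_Rintegral => x _; rewrite mulN1r.
Qed.

Lemma moment_field_graph n : B_graph P rho0 S0 f Rs (moment_field n)
  (fun x => comp1 n (enorm x)) (fun x => comp2 n (enorm x)).
Proof.
split.
- exact: moment_field_L2vec.
- split; split; try exact: rad.
  + by apply/(L2_integrable mw1 w1_0 (rad (mc1 n))); exact: comp1_in_L2.
  + by apply/(L2_integrable mw2 w2_0 (rad (mc2 n))); exact: comp2_in_L2.
- split; first exact: L1loc_of (comp1_integrable n).
  exact: moment_field_weak_divergence.
- split; first exact: L1loc_of (comp2_integrable n).
  move=> phi tphi; rewrite /B2 moment_field_weak_divergence//.
  have i1 := integrable_test tphi (comp1_integrable n).
  have i2 := integrable_test tphi (correction_integrable n).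
  have -> : \int[mu3]_(x in B) (dot (a0 rho0 x) (moment_field n x) * phi x) =
      \int[mu3]_(x in B) (- 1 * (correction n (enorm x) * phi x)).
    apply: eq_Rintegral => x; rewrite inE => xB.
    rewrite mulN1r -mulNr; congr (_ * _).
    have [x0|x0] := eqVneq x 0.
      rewrite x0 dotC dot_moment_field /correction.
      have e0 : enorm (0 : R3) = 0 by rewrite /enorm /dot/= !mulr0 !addr0 sqrtr0.
      by rewrite e0 (at0 n).1 !mul0r oppr0 mul0r mulr0 oppr0.
    have ex0 : enorm x != 0 by apply: contra_neq x0; exact: enorm_eq0.
    have r0 : rho0 (enorm x) != 0 by rewrite gt_eqF// (rho0_gt0 HE)// inR.
    rewrite (dot_a0 HE)// /moment_field dotZr -enorm_sqr /correction; field.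
    by rewrite r0 ex0.
  rewrite (@RintegralZl _ _ _ (@mu3 R) B _ _ mB i2) mulN1r.
  rewrite -(@RintegralB _ _ _ (@mu3 R) B _ _ mB i1 i2).
  by apply: eq_Rintegral => x _; rewrite /comp2 -/(correction n (enorm x)) mulrBl.
Qed.

(** By [primitive_zero_ae]: without it the limit of [comp1] would be eta only
    where the moment is nonzero. *)
Let HzB : {ae @mu3 R, forall x, B x -> x != 0 -> N (enorm x) = 0 -> eta (enorm x) = 0}.
Proof.
apply: (@ae_radial R Rs (fun t => N t = 0 -> eta t = 0)); apply: (@ae_impl _ _ _ mu _ _ (primitive_zero_ae Rs0 ig)) => t Ht tR N_0.
have /eqP := Ht tR N_0; rewrite mulf_eq0 sqrf_eq0 => /orP[/eqP t0|/eqP//].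
by move: tR; rewrite t0 ltxx.
Qed.

Let comp1_cvg (x : R3) : (N (enorm x) = 0 -> eta (enorm x) = 0) ->
  eta (enorm x) - comp1 n (enorm x) @[n --> \oo] --> (0 : R).
Proof.
move=> Hx; rewrite -[X in _ --> X](subrr (eta (enorm x))); apply: cvgB; first exact: cvg_cst.
have -> : nbhs (eta (enorm x)) = nbhs ((N (enorm x) != 0)%:R * eta (enorm x)).
  by congr nbhs; have [/Hx ->|_] := eqVneq (N (enorm x)) 0; rewrite ?mulr0 ?mul1r.
by apply: cvgMl; exact: dtrunc_cvg.
Qed.

Let normsq_fine (w : R3 -> R) (h : R3 -> R) :
  mu3.-integrable B (EFin \o (fun x => w x * h x ^+ 2)) ->
  normsq mu3 B w h = (\int[mu3]_(x in B) (w x * h x ^+ 2))%:E.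
Proof. by move=> i; rewrite /Rintegral fineK//; exact: integrable_fin_num i. Qed.

Lemma comp1_close : (forall n, mu3.-integrable B
    (EFin \o (fun x => w1 x * (eta (enorm x) - comp1 n (enorm x)) ^+ 2))) /\
  \int[mu3]_(x in B) (w1 x * (eta (enorm x) - comp1 n (enorm x)) ^+ 2) @[n --> \oo] --> (0 : R).
Proof.
pose g n x := w1 x * (eta (enorm x) - comp1 n (enorm x)) ^+ 2.
have mg n : measurable_fun B (g n).
  exact: (msq (h := fun t => eta t - comp1 n t) mw1 (measurable_funB meta (mc1 n))).
have bg n x : B x -> `|g n x| <= 64 * (w1 x * eta (enorm x) ^+ 2).
  move=> xB; rewrite (ger0_norm (mulr_ge0 (w1_0 xB) (sqr_ge0 _))) [leRHS]mulrCA.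
  apply: ler_wpM2l; first exact: w1_0.
  have : `|eta (enorm x) - comp1 n (enorm x)| <= 8 * `|eta (enorm x)|.
    apply: (le_trans (ler_normB _ _)); rewrite (_ : 8 = 1 + 7 :> R); last by ring.
    rewrite mulrDl mul1r; apply: lerD => //; rewrite /comp1 normrM.
    by apply: ler_wpM2r => //; exact: dtrunc_le.
  move=> H; apply: (@le_trans _ _ ((8 * `|eta (enorm x)|) ^+ 2)).
    by rewrite -[leLHS]real_normK ?num_real// lerXn2r ?nnegrE ?mulr_ge0.
  rewrite exprMn real_normK ?num_real// le_eqVlt; apply/orP; left; apply/eqP; ring.
have id := iZ 64 iw1eta.
split; first by move=> n; exact: integrable_le (mg n) id (bg n).
have [_] : mu3.-integrable B (EFin \o (fun=> 0 : R)) /\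
    \int[mu3]_(x in B) g n x @[n --> \oo] --> \int[mu3]_(x in B) (0 : R).
  apply: (@Rintegral_dominated R _ _ (@mu3 R) B g (fun=> 0) _ mB mg _ _ id bg) => //.
  apply: ae2 HzB not0 _ => x Hx x0 xB; rewrite /g -(mulr0 (w1 x)); apply: cvgMr.
  have c := comp1_cvg (Hx xB x0).
  by have := cvgM c c; rewrite mulr0 => H; exact: H.
by rewrite Rintegral_cst// mul0r.
Qed.

(** Dominated convergence: w2 <= C w1 controls the multiples of eta, and the other
    term is dominated by eta - om, which has finite w2-norm. *)
Lemma comp2_close : (forall n, mu3.-integrable B
    (EFin \o (fun x => w2 x * (om (enorm x) - comp2 n (enorm x)) ^+ 2))) /\
  \int[mu3]_(x in B) (w2 x * (om (enorm x) - comp2 n (enorm x)) ^+ 2) @[n --> \oo] --> (0 : R).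
Proof.
pose g n x := w2 x * (om (enorm x) - comp2 n (enorm x)) ^+ 2.
have mg n : measurable_fun B (g n).
  exact: (msq (h := fun t => om t - comp2 n t) mw2 (measurable_funB mom (mc2 n))).
pose dom x := 3 * (w2 x * om (enorm x) ^+ 2) +
  (147 * (w2 x * eta (enorm x) ^+ 2) + 3 * (w2 x * u (enorm x) ^+ 2)).
have id : mu3.-integrable B (EFin \o dom).
  exact: iD (iZ 3 iw2om) (iD (iZ 147 iw2eta) (iZ 3 iw2u)).
have bg n x : B x -> `|g n x| <= dom x.
  move=> xB; rewrite (ger0_norm (mulr_ge0 (w2_0 xB) (sqr_ge0 _))).
  have -> : dom x = w2 x * (3 * (om (enorm x) ^+ 2 + 49 * eta (enorm x) ^+ 2 + u (enorm x) ^+ 2)).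
    by rewrite /dom; ring.
  apply: ler_wpM2l; first exact: w2_0.
  have := @sq3 `|om (enorm x)| (7 * `|eta (enorm x)|) `|u (enorm x)| (om (enorm x) - comp2 n (enorm x)).
  have H : `|om (enorm x) - comp2 n (enorm x)| <=
      `|om (enorm x)| + 7 * `|eta (enorm x)| + `|u (enorm x)|.
    apply: (le_trans (ler_normB _ _)); rewrite -addrA; apply: lerD => //.
    by apply: comp2_le; exact: inR.
  move=> /(_ H)/le_trans; apply.
  rewrite exprMn !real_normK ?num_real//.
  by rewrite le_eqVlt; apply/orP; left; apply/eqP; ring.
split; first by move=> n; exact: integrable_le (mg n) id (bg n).
have [_] : mu3.-integrable B (EFin \o (fun=> 0 : R)) /\
    \int[mu3]_(x in B) g n x @[n --> \oo] --> \int[mu3]_(x in B) (0 : R).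
  apply: (@Rintegral_dominated R _ _ (@mu3 R) B g (fun=> 0) _ mB mg _ _ id bg) => //.
  apply: ae2 HzB (ae2 HsB not0 (fun x p q => conj p q)) _ => x Hx [Hs' x0] xB.
  rewrite /g -(mulr0 (w2 x)); apply: cvgMr.
  have c : om (enorm x) - comp2 n (enorm x) @[n --> \oo] --> (0 : R).
    have E n : om (enorm x) - comp2 n (enorm x) = (eta (enorm x) - comp1 n (enorm x)) +
       (drho (enorm x) / (rho0 (enorm x) * enorm x ^+ 2) * trunc n (N (enorm x)) - u (enorm x)).
      by rewrite (Hs' xB x0) /comp2; ring.
    rewrite (funext E) -[X in _ --> X](addr0 0); apply: cvgD.
      by apply: comp1_cvg; exact: Hx.
    rewrite -[X in _ --> X](subrr (u (enorm x))); apply: cvgB; last exact: cvg_cst.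
    by apply: cvgMr; exact: trunc_cvg.
  by have := cvgM c c; rewrite mulr0 => H; exact: H.
by rewrite Rintegral_cst// mul0r.
Qed.

Lemma closure_sufficient :
  in_closure_RanB P rho0 S0 f Rs (fun x => eta (enorm x)) (fun x => om (enorm x)).
Proof.
split => // e e0; have [i1 c1] := comp1_close; have [i2 c2] := comp2_close.
have e2 : 0 < e ^+ 2 / 2 by rewrite divr_gt0// exprn_gt0.
have /cvgr0Pnorm_lt/(_ _ e2)[n1 _ H1] := c1.
have /cvgr0Pnorm_lt/(_ _ e2)[n2 _ H2] := c2.
pose n := maxn n1 n2.
exists (moment_field n), (fun x => comp1 n (enorm x)), (fun x => comp2 n (enorm x)).
split; first exact: moment_field_graph.
rewrite /normsqX (normsq_fine (i1 n)) (normsq_fine (i2 n)) -EFinD lte_fin.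
have := H1 n (leq_maxl _ _); have := H2 n (leq_maxr _ _) => /= h2 h1.
have := ler_norm (\int[mu3]_(x in B) (w1 x * (eta (enorm x) - comp1 n (enorm x)) ^+ 2)).
have := ler_norm (\int[mu3]_(x in B) (w2 x * (om (enorm x) - comp2 n (enorm x)) ^+ 2)).
move: h1 h2; move: (Rintegral _ _ _) (Rintegral _ _ _) => y z.
by lra.
Qed.

End ClosureSufficient.

(** * Linearized Casimirs *)
Lemma integrable_ae_eq d (T : measurableType d) (R : realType)
    (m : {measure set T -> \bar R}) (D : set T) (g h : T -> R) :
  measurable D -> measurable_fun D g -> m.-integrable D (EFin \o h) ->
  {ae m, forall x, D x -> g x = h x} ->
  m.-integrable D (EFin \o g) /\ \int[m]_(x in D) g x = \int[m]_(x in D) h x.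
Proof.
move=> mD mg ih gh; have mh : measurable_fun D h by apply/measurable_EFinP; case/integrableP: ih.
split; last first.
  rewrite /Rintegral; congr fine; apply: ae_eq_integral => //; try exact/measurable_EFinP.
  by apply: (@ae_impl _ _ _ m _ _ gh) => x H /H ->.
apply/integrableP; split; first exact/measurable_EFinP.
rewrite (@ae_eq_integral _ _ _ m D (fun x => `|(h x)%:E|)%E)//; first by case/integrableP: ih.
- by apply/measurable_EFinP; exact: measurableT_comp.
- by apply/measurable_EFinP; exact: measurableT_comp.
by apply: (@ae_impl _ _ _ m _ _ gh) => x H /H /= ->.
Qed.

Section Casimirs.
Context {R : realType}.
Local Notation R3 := (R * R * R)%type.
Local Notation mu := (@lebesgue_measure R).
Variables (P : R -> R -> R) (gamma0 alpha0 : R) (rho0 S0 f : R -> R) (Rs : R).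
Hypotheses (HP : pressure_law P gamma0 alpha0)
  (HE : equilibrium P gamma0 alpha0 rho0 S0 f Rs).
Local Notation B := (@eball R Rs).
Local Notation drho := (drho0 rho0 Rs).
Local Notation dfr := (df rho0 f).

Let Rs0 : 0 < Rs := eq_Rs HE.

Lemma S0_itv_J0 (a b : R) : 0 < a -> a < b -> b < Rs ->
  `[S0 a, S0 b]%classic `<=` J0 S0 Rs.
Proof.
move=> a0 ab bR y; rewrite /= in_itv/= => /andP[ay yb].
have c : {within `[a, b], continuous S0}.
  apply: continuous_subspaceW (S0_continuous HE) => t /=; rewrite !in_itv/= => /andP[at_ tb].
  by rewrite (le_trans (ltW a0))// (le_lt_trans tb).
have Sab := S0_lt HP HE a0 ab bR.
have [|t] := @IVT _ S0 a b y (ltW ab) c; first by rewrite ge_min ay le_max yb orbT.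
rewrite in_itv/= => /andP[at_ tb] <-; exists t => //=.
by rewrite in_itv/= (lt_le_trans a0 at_) (le_lt_trans tb bR).
Qed.

(** The support of g' on the range of S0 is compact in that range, so its smallest
    and largest points are values of S0 at interior radii. *)
Lemma casimir_support (g : R -> R) : casimir_class S0 Rs g -> exists a b : R,
  [/\ 0 < a, a < b, b < Rs &
      forall t, 0 < t < Rs -> ~~ (a <= t <= b) -> derive1 g (S0 t) = 0].
Proof.
have [R3 R32 R2] : [/\ 0 < Rs / 3, Rs / 3 < Rs / 2 & Rs / 2 < Rs].
  by move: Rs0 => /= ?; split; lra.
move=> [_ _ cC CJ]; set A := [set t | J0 S0 Rs t /\ derive1 g t != 0] in cC CJ.
have AC : A `<=` closure A := @subset_closure _ A.
have inA t : 0 < t < Rs -> derive1 g (S0 t) != 0 -> closure A (S0 t).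
  by move=> tR d0; apply: AC; split => //; exists t => //=; rewrite in_itv.
(* when g' vanishes on the range of S0, any a < b will do *)
have [A0|/set0P[y Cy]] := eqVneq (closure A) set0.
  exists (Rs / 3), (Rs / 2); split => // t tR _; apply/eqP; apply/negPn/negP => d0.
  by have := inA t tR d0; rewrite A0.
have cid : {within closure A, continuous (fun t : R => t)}.
  by apply: continuous_subspaceT => t; exact: cvg_id.
have nC : closure A !=set0 by exists y.
have [m Cm Hm] := compact_EVT_min nC cC cid.
have [M CM HM] := compact_EVT_max nC cC cid.
rewrite inE in Cm; rewrite inE in CM.
have [r1 + E1] := CJ _ Cm; have [r2 + E2] := CJ _ CM.
rewrite /= !in_itv/= => /andP[r20 r2R] /andP[r10 r1R].
(* strictly beyond the extreme radii r1 and r2 of the support *)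
exists (Num.min r1 r2 / 2), ((Num.max r1 r2 + Rs) / 2).
have mm : Num.min r1 r2 <= Num.max r1 r2 by rewrite le_max ge_min lexx.
have m0 : 0 < Num.min r1 r2 by rewrite lt_min r10.
have MR : Num.max r1 r2 < Rs by rewrite gt_max r1R.
split; try by lra.
move=> t tR; have /andP[t0 tRs] := tR; rewrite negb_and -!ltNge => tab.
apply/eqP; apply/negPn/negP => d0; have Ct := inA t tR d0.
case/orP: tab => tab.
  have tr1 : t < r1.
    by apply: (lt_le_trans tab); apply: (@le_trans _ _ (Num.min r1 r2)); [lra|rewrite ge_min lexx].
  have := S0_lt HP HE t0 tr1 r1R; rewrite E1 ltNge => /negP; apply.
  by apply: Hm; rewrite inE.
have tr2 : r2 < t.
  by apply: le_lt_trans tab; apply: (@le_trans _ _ (Num.max r1 r2)); [rewrite le_max lexx orbT|lra].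
have := S0_lt HP HE r20 tr2 tRs; rewrite E2 ltNge => /negP; apply.
by apply: HM; rewrite inE.
Qed.

Variables (eta s : R -> R).
Hypotheses (meta : measurable_fun (`[0, Rs[) eta) (ms : measurable_fun (`[0, Rs[) s).
Local Notation om := (omega2 rho0 f eta s).
Hypothesis HX : in_X P rho0 S0 f Rs (fun x => eta (enorm x)) (fun x => om (enorm x)).
Local Notation N := (moment eta).

(** The factor of g'(S0) in the linearized Casimir: s = f'(rho0) (eta - om)
    contributes the first term, and integration by parts of g(S0) against eta,
    with S0' = f'(rho0) rho0', the second. *)
Definition defect (t : R) : R :=
  dfr (rho0 t) * (t ^+ 2 * rho0 t * (eta t - om t) - drho t * N t).

Let cint (a b : R) (h : R -> R) : 0 < a -> b < Rs -> {within `[0, Rs], continuous h} ->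
  {within `[a, b], continuous h}.
Proof.
move=> a0 bR; apply: continuous_subspaceW => t /=; rewrite !in_itv/= => /andP[at_ tb].
by rewrite (le_trans (ltW a0) at_) (le_trans tb (ltW bR)).
Qed.

Let itb (a b : R) (h g : R -> R) : {within `[a, b], continuous h} ->
  mu.-integrable `[a, b] (EFin \o g) -> mu.-integrable `[a, b] (EFin \o (fun t => h t * g t)).
Proof.
move=> ch ig; have [ab|ba] := leP a b; last first.
  by rewrite set_itv_ge ?bnd_simp -?ltNge//; exact: integrable_set0.
have cn : {within `[a, b], continuous (fun t => `|h t|)}.
  by move=> t; apply: continuous_cvg; [exact: norm_continuous|exact: ch].
have [c _ Hc] := EVT_max ab cn.
apply: integrableMr (ig) => //; first exact: subspace_continuous_measurable_fun.
exists `|h c|; split => [|y My t tab]; first exact: num_real.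
exact: le_trans (Hc t tab) (ltW My).
Qed.

Lemma moment_integrable_om (a b : R) : 0 < a -> b < Rs ->
  mu.-integrable `[a, b] (EFin \o (fun t => t ^+ 2 * (eta t - om t))).
Proof.
move=> a0 bR; have md : measurable_fun (`[0, Rs[) (fun t => eta t - om t).
  apply: measurable_funB => //; exact: (omega2_measurable HE meta ms).
have iD : mu3.-integrable (shell a b) (fun x => ((eta (enorm x) - om (enorm x))%R)%:E).
  exact: (@integrableB _ _ _ (@mu3 R) _ (measurable_shell a b) _ _
    (shell_integrable_eta HP HE HX a bR) (shell_integrable_omega2 HP HE HX a bR)).
exact: (Rintegral_shell_radial (ltW a0) bR md iD).1.
Qed.

Let cN : {within `[0, Rs], continuous N} :=
  primitive_continuous Rs0 (eta_integrable HP HE meta HX).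

Lemma defect_integrable (a b : R) : 0 < a -> b < Rs ->
  mu.-integrable `[a, b] (EFin \o defect).
Proof.
move=> a0 bR.
have i1 := itb (cint a0 bR (rho0_continuous HE)) (moment_integrable_om a0 bR).
have i2 : mu.-integrable `[a, b] (EFin \o (fun t => drho t * N t)).
  apply: continuous_compact_integrable; first exact: segment_compact.
  by move=> t; apply: cvgM; [exact: cint (drho0_continuous HE) t|exact: cint cN t].
have i3 : mu.-integrable `[a, b] (EFin \o (fun t => rho0 t * (t ^+ 2 * (eta t - om t)) - drho t * N t)).
  by apply: eq_integrable (integrableB _ i1 i2).
apply: eq_integrable (itb (cint a0 bR (df_rho0_continuous HE)) i3) => // t _ /=.
by rewrite /defect; congr (_ * _)%:E; ring.
Qed.

Let indic_integrable (a b : R) (h : R -> R) : 0 <= a -> b <= Rs ->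
  mu.-integrable `[a, b] (EFin \o h) ->
  mu.-integrable `[0, Rs] (EFin \o (fun t => (a <= t <= b)%R%:R * h t)).
Proof.
move=> a0 bR ih; apply/integrable_itv_mkcond; move/integrable_itv_mkcond: ih.
apply: eq_integrable => // t _; rewrite !patchE !mem_setE !in_itv/=.
case: (boolP (a <= t <= b)) => [/andP[at_ tb]|_].
  by rewrite (le_trans a0 at_) (le_trans tb bR)/= mul1r.
by case: ifP => //; rewrite mul0r.
Qed.

(** Since g(S0) is constant between b and the boundary, the layer formula for the
    density t^2 eta and K = g(S0) produces the boundary term at b and the moment
    N under the integral. *)
Lemma dcasimirE (g : R -> R) (a b : R) : casimir_class S0 Rs g ->
  0 < a -> a < b -> b < Rs ->
  (forall t, 0 < t < Rs -> ~~ (a <= t <= b) -> derive1 g (S0 t) = 0) ->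
  dcasimir rho0 S0 Rs g eta s = sphere_const *
    (g (S0 b) * N Rs + \int[mu]_(t in `[a, b]) (derive1 g (S0 t) * defect t)).
Proof.
move=> [dg cg' _ _] a0 ab bR Hg; have mB := @measurable_eball R Rs.
have inR (t : R) : a <= t <= b -> 0 < t < Rs.
  by move=> /andP[at_ tb]; rewrite (lt_le_trans a0 at_) (le_lt_trans tb bR).
have Dg (x : R) : is_derive x (1 : R) g (derive1 g x).
  by rewrite derive1E; exact: derivableP.
have cg : continuous g by move=> x; exact: derive_continuous_at (Dg x).
pose kk t := derive1 g (S0 t) * (dfr (rho0 t) * drho t).
have Dk (t : R) : 0 < t < Rs -> is_derive t (1 : R) (g \o S0) (kk t).
  by move=> tR; exact: is_derive1_comp (Dg _) (S0_is_derive HE tR).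
have cS (c d : R) : 0 < c -> d < Rs -> {within `[c, d], continuous S0}.
  move=> c0 dR; apply: continuous_subspaceW (S0_continuous HE) => t /=.
  by rewrite !in_itv/= => /andP[ct td]; rewrite (le_trans (ltW c0) ct) (le_lt_trans td dR).
have cgS (c d : R) : 0 < c -> d < Rs -> {within `[c, d], continuous (fun t => derive1 g (S0 t))}.
  by move=> c0 dR t; apply: continuous_cvg; [exact: cg'|exact: cS].
have cgS0 (c d : R) : 0 < c -> d < Rs -> {within `[c, d], continuous (g \o S0)}.
  by move=> c0 dR t; apply: continuous_cvg; [exact: cg|exact: cS].
have ckk (c d : R) : 0 < c -> d < Rs -> {within `[c, d], continuous kk}.
  move=> c0 dR t; apply: cvgM; first exact: cgS.
  by apply: cvgM; [exact: cint (df_rho0_continuous HE) t|exact: cint (drho0_continuous HE) t].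
pose k t := (a <= t <= b)%R%:R * kk t.
have ikk : mu.-integrable `[a, b] (EFin \o kk).
  by apply: continuous_compact_integrable; [exact: segment_compact|exact: ckk].
have ik : mu.-integrable `[0, Rs] (EFin \o k) by apply: indic_integrable => //; exact: ltW.
pose K t := g (S0 b) - \int[mu]_(u in `[t, Rs]) k u.
have KRs : K Rs = g (S0 b) by rewrite /K set_itv1 Rintegral_set1 subr0.
have KE (t : R) : 0 <= t <= Rs -> K Rs - K t = \int[mu]_(u in `[t, Rs]) k u.
  by move=> _; rewrite KRs /K; ring.
have Kval (t : R) : 0 < t < Rs -> K t = g (S0 t).
  move=> /andP[t0 tR]; rewrite /K; have [tb|bt] := leP t b.
    have stb : `[t, b]%classic `<=` `[t, Rs]%classic by apply: subset_itvl; rewrite bnd_simp ltW.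
    rewrite (@Rintegral_zero_off _ _ _ mu _ _ k stb); last first.
      move=> u /=; rewrite !in_itv/= => /andP[tu _] /negP; rewrite tu/= -ltNge => bu.
      by rewrite /k [u <= b]leNgt bu andbF mul0r.
    have -> : \int[mu]_(u in `[t, b]) k u = \int[mu]_(u in `[t, b]) kk u.
      apply: eq_Rintegral => u; rewrite inE/= in_itv/= => /andP[tu ub]; rewrite /k ub andbT.
      have [au|ua] := leP a u; first by rewrite mul1r.
      rewrite mul0r /kk Hg ?mul0r//; last by rewrite leNgt ua.
      by rewrite (lt_le_trans t0 tu) (le_lt_trans ub bR).
    have D (x : R) : t < x < b -> is_derive x (1 : R) (g \o S0) (kk x).
      by move=> /andP[tx xb]; apply: Dk; rewrite (lt_trans t0 tx) (lt_trans xb bR).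
    by rewrite (Rintegral_derive_oo tb D (cgS0 t b t0 bR) (ckk t b t0 bR)) /= opprB addrC subrK.
  rewrite (@eq_Rintegral _ _ _ mu _ (cst 0)); last first.
    move=> u; rewrite inE/= in_itv/= => /andP[tu _].
    by rewrite /k [u <= b]leNgt (lt_le_trans bt tu) andbF mul0r.
  rewrite Rintegral_cst// mul0r subr0; apply/esym/eqP; rewrite -subr_eq0; apply/eqP.
  have b0 := lt_trans a0 ab.
  have [|c /andP[bc ct] E] := mvt_is_derive (f := g \o S0) (df := kk) bt _ (cgS0 b t b0 tR).
    by move=> x /andP[bx xt]; apply: Dk; rewrite (lt_trans b0 bx) (lt_trans xt tR).
  rewrite -[LHS]/((g \o S0) t - (g \o S0) b) E /kk Hg ?mul0r//.
    by rewrite (lt_trans b0 bc) (lt_trans ct tR).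
  by rewrite negb_and -!ltNge bc orbT.
have [_ _ ieta _] := in_X_integrable HP HE HX.
pose T := `[0, Rs[%classic.
have ieta1 := (integrable_radial meta).1 ieta.
have mT : measurable T by exact: measurable_itv.
have tR (t : R) : T t -> 0 <= t <= Rs by rewrite /T/= in_itv/= => /andP[-> /ltW].
have [iK _ E1] := @integral_layer R _ _ mu T (fun t => t ^+ 2 * eta t) id k K 0 Rs
  mT ieta1 (@measurable_id _ _ _) tR ik KE.
pose Z t := (a <= t <= b)%R%:R * (derive1 g (S0 t) * rho0 t * dfr (rho0 t) * (t ^+ 2 * (eta t - om t))).
have cV : {within `[a, b], continuous (fun t => derive1 g (S0 t) * rho0 t * dfr (rho0 t))}.
  move=> t; apply: cvgM; last exact: cint (df_rho0_continuous HE) t.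
  by apply: cvgM; [exact: cgS|exact: cint (rho0_continuous HE) t].
have iV := itb cV (moment_integrable_om a0 bR).
have iZ0 : mu.-integrable `[0, Rs] (EFin \o Z) by apply: indic_integrable iV => //; exact: ltW.
have iZ : mu.-integrable T (EFin \o Z).
  by apply: integrable_itvS iZ0; apply: subset_itvl; rewrite bnd_simp.
pose phi t := g (S0 t) * eta t + rho0 t * derive1 g (S0 t) * s t.
have mS0 : measurable_fun T S0 by apply: subspace_continuous_measurable_fun => //; exact: S0_continuous HE.
have mphi : measurable_fun T phi.
  apply: measurable_funD.
    apply: measurable_funM => //; apply: measurableT_comp mS0.
    exact: continuous_measurable_fun.
  apply: measurable_funM => //; apply: measurable_funM.
    apply: (@measurable_funS _ _ _ _ `[0, Rs]%classic) => //.
    by apply: subspace_continuous_measurable_fun => //; exact: rho0_continuous HE.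
  by apply: measurableT_comp mS0; exact: continuous_measurable_fun.
(* at t = 0, where nothing is assumed on df, both sides vanish *)
have AE : {ae mu, forall t, T t -> t ^+ 2 * phi t = t ^+ 2 * eta t * K t + Z t}.
  apply: (@ae_impl _ _ _ mu _ _ (df_rho0_lt0_ae HP HE)) => t dt; rewrite /T/= in_itv/= => /andP[t0 tR'].
  have [->|tn0] := eqVneq t 0.
    by rewrite /Z leNgt a0 /= !expr0n/= !mul0r add0r.
  have t1 : 0 < t < Rs by rewrite lt_neqAle eq_sym tn0 t0.
  have d0 : dfr (rho0 t) != 0 by rewrite lt_eqF// dt.
  rewrite Kval// /phi /Z; case: (boolP (a <= t <= b)) => tab.
    rewrite mul1r /omega2; move: (derive1 g (S0 t)) => y; move: (dfr (rho0 t)) d0 => d d0; field.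
    exact: d0.
  by rewrite (Hg t t1 tab) mulr0 !mul0r !addr0; ring.
have isum : mu.-integrable T (EFin \o (fun t => t ^+ 2 * eta t * K t + Z t)).
  by apply: eq_integrable (integrableD _ iK iZ).
have [iphi Ephi] : mu.-integrable T (EFin \o (fun t => t ^+ 2 * phi t)) /\
    \int[mu]_(t in T) (t ^+ 2 * phi t) = \int[mu]_(t in T) (t ^+ 2 * eta t * K t + Z t).
  apply: integrable_ae_eq => //; exact: measurable_funM.
rewrite /dcasimir (_ : \int[mu3]_(x in B) _ = \int[mu3]_(x in B) phi (enorm x))//.
rewrite (Rintegral_radial mphi iphi); congr (_ * _); rewrite -/T Ephi.
rewrite (RintegralD _ iK iZ)// E1 KRs.
have -> : \int[mu]_(t in T) (t ^+ 2 * eta t) = N Rs by exact: Rintegral_itv_bndo_bndc.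
have sub : `[a, b]%classic `<=` T.
  by move=> t; rewrite /T/= !in_itv/= => /andP[at_ tb]; rewrite (le_trans (ltW a0) at_) (le_lt_trans tb).
have sub2 : `[a, b]%classic `<=` `[0, Rs]%classic.
  by apply: (subset_trans sub); apply: subset_itvl; rewrite bnd_simp.
rewrite (@Rintegral_zero_off _ _ _ mu _ _ Z sub); last first.
  by move=> t _ /=; rewrite in_itv/= => /negP/negbTE tab; rewrite /Z tab mul0r.
have iM := itb (ckk a b a0 bR) (continuous_compact_integrable (@segment_compact _ a b) (cint a0 bR cN)).
rewrite (@Rintegral_zero_off _ _ _ mu _ _ (fun t => k t * \int[mu]_(x in T `&` [set x | x <= t]) (x ^+ 2 * eta x)) sub2); last first.
  by move=> t _ /=; rewrite in_itv/= => /negP/negbTE tab; rewrite /k tab !mul0r.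
have -> : \int[mu]_(t in `[a, b]) (k t * \int[mu]_(x in T `&` [set x | x <= t]) (x ^+ 2 * eta x)) =
    \int[mu]_(t in `[a, b]) (kk t * N t).
  apply: eq_Rintegral => t; rewrite inE/= in_itv/= => tab; rewrite /k tab mul1r.
  congr (_ * Rintegral _ _ _); apply/seteqP; split => x; rewrite /T/= !in_itv/=.
    by move=> [/andP[-> _] ->].
  by move=> /andP[x0 xt]; rewrite x0 (le_lt_trans xt) ?(inR _ tab)//; case/andP: (inR _ tab).
have -> : \int[mu]_(t in `[a, b]) Z t =
    \int[mu]_(t in `[a, b]) (derive1 g (S0 t) * rho0 t * dfr (rho0 t) * (t ^+ 2 * (eta t - om t))).
  by apply: eq_Rintegral => t; rewrite inE/= in_itv/= /Z => ->; rewrite mul1r.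
rewrite -addrA; congr (_ + _); rewrite addrC -(RintegralB _ iV iM)//.
by apply: eq_Rintegral => t _; rewrite /defect /kk; ring.
Qed.

End Casimirs.

Lemma ae_point_neq {R : realType} (a : R) : {ae @lebesgue_measure R, forall t, t != a}.
Proof.
exists [set a]; split; [exact: measurable_set1|exact: lebesgue_measure_set1|].
by move=> t /= /negP; rewrite negbK => /eqP.
Qed.

Section CasimirCriterion.
Context {R : realType}.
Local Notation mu := (@lebesgue_measure R).
Variables (P : R -> R -> R) (gamma0 alpha0 : R) (rho0 S0 f : R -> R) (Rs : R).
Hypotheses (HP : pressure_law P gamma0 alpha0)
  (HE : equilibrium P gamma0 alpha0 rho0 S0 f Rs).
Local Notation drho := (drho0 rho0 Rs).
Local Notation dfr := (df rho0 f).

Let Rs0 : 0 < Rs := eq_Rs HE.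

Variables (eta s : R -> R).
Hypotheses (meta : measurable_fun (`[0, Rs[) eta) (ms : measurable_fun (`[0, Rs[) s).
Local Notation om := (omega2 rho0 f eta s).
Hypothesis HX : in_X P rho0 S0 f Rs (fun x => eta (enorm x)) (fun x => om (enorm x)).
Local Notation N := (moment eta).
Local Notation defect := (defect rho0 f Rs eta s).

Let formula (r : R) : Prop :=
  s r = dfr (rho0 r) * (drho r / (4 * pi * r ^+ 2 * rho0 r)) * enclosed eta r.

Lemma formula_defect (t : R) : 0 < t < Rs -> dfr (rho0 t) < 0 ->
  formula t <-> defect t = 0.
Proof.
move=> tR dt; have /andP[t0 tRs] := tR; rewrite /formula /defect /omega2 /enclosed -/(N t).
have d0 : dfr (rho0 t) != 0 by rewrite lt_eqF.
have r0 : rho0 t != 0 by rewrite gt_eqF// (rho0_gt0 HE)// (ltW t0).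
have tn0 : t != 0 by rewrite gt_eqF.
have p0 : (pi : R) != 0 by rewrite gt_eqF// pi_gt0.
move: (pi : R) p0 (dfr (rho0 t)) d0 => p p0 d d0.
move: (rho0 t) r0 (N t) (drho t) (s t) (eta t) => r r0 n dr st et.
have -> : d * (t ^+ 2 * r * (et - (et - st / d)) - dr * n) = t ^+ 2 * r * (st - d * (dr / (4 * p * t ^+ 2 * r)) * (4 * p * n)).
  by field; rewrite d0 r0 tn0 p0.
split; first by move=> ->; rewrite subrr mulr0.
move/eqP; by rewrite !mulf_eq0 (negbTE tn0) (negbTE r0)/= => /eqP/subr0_eq.
Qed.

Lemma formula_omega2 (t : R) : 0 < t < Rs -> dfr (rho0 t) < 0 -> formula t ->
  om t = eta t - drho t / (rho0 t * t ^+ 2) * N t.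
Proof.
move=> tR dt; have /andP[t0 tRs] := tR; rewrite /formula /omega2 /enclosed -/(N t) => ->.
have d0 : dfr (rho0 t) != 0 by rewrite lt_eqF.
have r0 : rho0 t != 0 by rewrite gt_eqF// (rho0_gt0 HE)// (ltW t0).
have tn0 : t != 0 by rewrite gt_eqF.
have p0 : (pi : R) != 0 by rewrite gt_eqF// pi_gt0.
move: (pi : R) p0 (dfr (rho0 t)) d0 => p p0 d d0.
move: (rho0 t) r0 (N t) (drho t) (eta t) => r r0 n dr et.
by field; rewrite d0 r0 tn0 p0.
Qed.

Lemma enclosed_eq0 : enclosed eta Rs = 0 <-> N Rs = 0.
Proof.
have p0 : (4 * pi : R) != 0 by rewrite mulf_neq0 ?gt_eqF// pi_gt0.
rewrite /enclosed -/(N Rs); split => [/eqP|->]; last by rewrite mulr0.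
by rewrite mulf_eq0 (negbTE p0) => /eqP.
Qed.

Lemma casimirs_sufficient : N Rs = 0 -> {ae mu, forall t, 0 < t < Rs -> defect t = 0} ->
  forall g, casimir_class S0 Rs g -> dcasimir rho0 S0 Rs g eta s = 0.
Proof.
move=> N0 D0 g Hg; have [a [b [a0 ab bR H0]]] := casimir_support HP HE Hg.
rewrite (dcasimirE HP HE meta ms HX Hg a0 ab bR H0) N0 mulr0 add0r.
suff -> : \int[mu]_(t in `[a, b]) (derive1 g (S0 t) * defect t) = 0 by rewrite mulr0.
have z0 : {ae mu, forall t, `[a, b]%classic t -> derive1 g (S0 t) * defect t = 0}.
  apply: (@ae_impl _ _ _ mu _ _ D0) => t Dt; rewrite /= in_itv/= => /andP[at_ tb].
  by rewrite Dt ?mulr0// (lt_le_trans a0 at_) (le_lt_trans tb bR).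
have [dg cg _ _] := Hg.
have cgS : {within `[a, b], continuous (fun t => derive1 g (S0 t))}.
  have cS : {within `[a, b], continuous S0}.
    apply: continuous_subspaceW (S0_continuous HE) => t /=.
    by rewrite !in_itv/= => /andP[at_ tb]; rewrite (le_trans (ltW a0) at_) (le_lt_trans tb bR).
  by move=> t; apply: continuous_cvg; [exact: cg|exact: cS].
have md : measurable_fun `[a, b] (fun t => derive1 g (S0 t) * defect t).
  apply: measurable_funM; first exact: subspace_continuous_measurable_fun.
  by apply/measurable_EFinP; case/integrableP: (defect_integrable HP HE meta ms HX a0 bR).
have i0 : mu.-integrable `[a, b] (EFin \o cst (0 : R)).
  by apply: continuous_compact_integrable; [exact: segment_compact|move=> t; exact: cvg_cst].
have [|_ ->] := @integrable_ae_eq _ _ R mu `[a, b]%classic _ _ _ md i0 z0; first by [].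
by rewrite Rintegral_cst// mul0r.
Qed.

Lemma casimir_bump (a b : R) (n : nat) : 0 < a -> a < b -> b < Rs ->
  exists2 g, casimir_class S0 Rs g & derive1 g = bump (S0 a) (S0 b) n.
Proof.
move=> a0 ab bR; have Sab := S0_lt HP HE a0 ab bR.
have cb : continuous (bump (S0 a) (S0 b) n) by exact: smooth1_continuous (smooth1_bump _ _ _).
have [|t ta|t bt|g dg _] := @compact_primitive R (bump (S0 a) (S0 b) n) (S0 a) (S0 b).
- exact: cb.
- by apply: bump_eq0; [exact: ltW|rewrite negb_and -!leNgt ta].
- by apply: bump_eq0; [exact: ltW|rewrite negb_and -!leNgt bt orbT].
have E : derive1 g = bump (S0 a) (S0 b) n.
  by apply/funext => t; rewrite derive1E; have D := dg t; exact: derive_val.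
have sub : closure [set t | J0 S0 Rs t /\ bump (S0 a) (S0 b) n t != 0] `<=` `[S0 a, S0 b]%classic.
  rewrite closureE => t /(_ `[S0 a, S0 b]%classic); apply; split; first exact: interval_closed.
  move=> u [_]; apply: contra_neqP => /negP; rewrite in_itv/= => uab.
  apply: bump_eq0; first exact: ltW.
  by apply: contraNN uab => /andP[/ltW -> /ltW ->].
exists g => //; split; rewrite ?E//.
- by apply: subclosed_compact sub; [exact: closed_closure|exact: segment_compact].
- exact: subset_trans sub (S0_itv_J0 HP HE a0 ab bR).
Qed.

(** Constants give N(Rs) = 0.  For g' a bump between S0(a) and S0(b) the limit
    is the integral of the defect over [a,b], because S0 is strictly
    increasing. *)
Lemma casimirs_necessary :
  (forall g, casimir_class S0 Rs g -> dcasimir rho0 S0 Rs g eta s = 0) ->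
  N Rs = 0 /\ {ae mu, forall t, 0 < t < Rs -> defect t = 0}.
Proof.
move=> Hg; have k0 : sphere_const != 0 :> R by rewrite gt_eqF// sphere_const_gt0.
have [R2 R32 R3] : [/\ 0 < Rs / 3, Rs / 3 < Rs / 2 & Rs / 2 < Rs].
  by move: Rs0 => /= ?; split; lra.
have N0 : N Rs = 0.
  have d1 t : derive1 (cst (1 : R)) t = 0 by rewrite derive1_cst.
  have c1 : casimir_class S0 Rs (cst 1).
    have E : [set t | J0 S0 Rs t /\ cst (0 : R) t != 0] = set0.
      by apply/seteqP; split => t //= [_]; rewrite eqxx.
    split; first by move=> t; exact: derivable_cst.
    - by rewrite (funext d1) => t; exact: cvg_cst.
    - by rewrite (funext d1) E closure0; exact: compact0.
    - by rewrite (funext d1) E closure0.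
  have := Hg _ c1; rewrite (dcasimirE HP HE meta ms HX c1 R2 R32 R3)//.
  move/eqP; rewrite mulf_eq0 (negbTE k0)/= mul1r (@eq_Rintegral _ _ _ mu _ (cst 0)).
    by rewrite Rintegral_cst// mul0r addr0 => /eqP.
  by move=> t _; rewrite d1 mul0r.
split => //; apply: ae_itv_eq0 => a b a0 ab bR; first by apply: eq_integrable (defect_integrable HP HE meta ms HX a0 bR).
have iD := defect_integrable HP HE meta ms HX a0 bR.
have Sab := S0_lt HP HE a0 ab bR.
pose B n t := bump (S0 a) (S0 b) n (S0 t).
have B0 n : \int[mu]_(t in `[a, b]) (B n t * defect t) = 0.
  have [g cg dg] := casimir_bump n a0 ab bR.
  have H0 t : 0 < t < Rs -> ~~ (a <= t <= b) -> derive1 g (S0 t) = 0.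
    move=> /andP[t0 tR]; rewrite negb_and -!ltNge dg => tab.
    apply: bump_eq0; rewrite ?(ltW Sab)// negb_and -!leNgt.
    case/orP: tab => tab; first by rewrite (ltW (S0_lt HP HE t0 tab (lt_trans ab bR))).
    by rewrite (ltW (S0_lt HP HE (lt_trans a0 ab) tab tR)) orbT.
  have := Hg _ cg; rewrite (dcasimirE HP HE meta ms HX cg a0 ab bR H0) N0 mulr0 add0r dg => /eqP.
  by rewrite mulf_eq0 (negbTE k0) => /eqP.
have cS : {within `[a, b], continuous S0}.
  apply: continuous_subspaceW (S0_continuous HE) => t /=.
  by rewrite !in_itv/= => /andP[at_ tb]; rewrite (le_trans (ltW a0) at_) (le_lt_trans tb bR).
have mD : measurable_fun `[a, b] defect by apply/measurable_EFinP; case/integrableP: (iD).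
have mB n : measurable_fun `[a, b] (fun t => B n t * defect t).
  apply: measurable_funM => //; apply: subspace_continuous_measurable_fun => // t.
  by apply: continuous_cvg; [exact: smooth1_continuous (smooth1_bump _ _ _) _|exact: cS].
have cB : {ae mu, forall t, `[a, b]%classic t -> B n t * defect t @[n --> \oo] --> defect t}.
  apply: (@filterS2 _ _ (ae_filter_ringOfSetsType mu) _ _ _ _ (ae_point_neq a) (ae_point_neq b)) => t ta tb.
  rewrite /= in_itv/= => /andP[at_ tb_].
  have {}at_ : a < t by rewrite lt_neqAle eq_sym ta.
  have {}tb_ : t < b by rewrite lt_neqAle tb.
  rewrite -[X in _ --> X]mul1r; apply: cvgMl.
  have := @bump_cvg R (S0 a) (S0 b) (S0 t) (ltW Sab).
  by rewrite (S0_lt HP HE a0 at_ (lt_trans tb_ bR)) (S0_lt HP HE (lt_trans a0 at_) tb_ bR).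
have bB n t : `[a, b]%classic t -> `|B n t * defect t| <= `|defect t|.
  by move=> _; rewrite normrM ler_piMl// ger0_norm ?bump_ge0// bump_le1.
have [_ c] : mu.-integrable `[a, b] (EFin \o defect) /\
    \int[mu]_(t in `[a, b]) (B n t * defect t) @[n --> \oo] --> \int[mu]_(t in `[a, b]) defect t.
  apply: (@Rintegral_dominated R _ _ mu _ _ _ (fun t => `|defect t|)) => //.
  exact: integrable_norm iD.
move: c; under eq_cvg do rewrite B0.
by move=> c; apply: (@cvg_unique _ (@norm_hausdorff _ R) _ _ _ _ c (cvg_cst _)).
Qed.

End CasimirCriterion.

(** * The three conditions *)
Theorem proposition5p4 (R : realType) (P : R -> R -> R) (gamma0 alpha0 : R)
    (rho0 S0 f : R -> R) (Rs : R)
    (HP : pressure_law P gamma0 alpha0)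
    (HE : equilibrium P gamma0 alpha0 rho0 S0 f Rs)
    (eta s : R -> R)
    (meta : measurable_fun (`[0, Rs[) eta) (ms : measurable_fun (`[0, Rs[) s)
    (HX : in_X P rho0 S0 f Rs
            (fun x => eta (enorm x))
            (fun x => omega2 rho0 f eta s (enorm x))) :
  let cond_i :=
    in_closure_RanB P rho0 S0 f Rs
      (fun x => eta (enorm x)) (fun x => omega2 rho0 f eta s (enorm x)) in
  let cond_ii :=
    enclosed eta Rs = 0 /\
    {ae lebesgue_measure, forall r : R, 0 < r < Rs ->
      s r = df rho0 f (rho0 r)
            * (drho0 rho0 Rs r / (4 * pi * r ^+ 2 * rho0 r))
            * enclosed eta r} in
  let cond_iii :=
    forall g : R -> R, casimir_class S0 Rs g ->
      dcasimir rho0 S0 Rs g eta s = 0 in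
  (cond_i <-> cond_ii) /\ (cond_ii <-> cond_iii).
Proof.
have df0 := df_rho0_lt0_ae HP HE.
have ae2 (p q r : R -> Prop) : (forall t, p t -> q t -> r t) ->
    {ae @lebesgue_measure R, forall t, p t} -> {ae @lebesgue_measure R, forall t, q t} ->
    {ae @lebesgue_measure R, forall t, r t}.
  by move=> pqr; apply: (@filterS2 _ _ (ae_filter_ringOfSetsType (@lebesgue_measure R)) p q r pqr).
split; split.
- by move=> C; exact: (closure_necessary HP HE meta ms HX C).
- move=> [/enclosed_eq0 N0 Hs]; apply: (closure_sufficient HP HE meta ms HX N0).
  apply: ae2 df0 Hs => t dt st tR.
  by apply: (formula_omega2 HE tR (dt tR)); exact: st.
- move=> [/enclosed_eq0 N0 Hs]; apply: (casimirs_sufficient HP HE meta ms HX N0).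
  apply: ae2 df0 Hs => t dt st tR.
  by apply: (formula_defect HE eta s tR (dt tR)).1; exact: st.
move=> /(casimirs_necessary HP HE meta ms HX)[/enclosed_eq0 N0 D0]; split => //.
apply: ae2 df0 D0 => t dt Dt tR.
exact: (formula_defect HE eta s tR (dt tR)).2 (Dt tR).
Qed.
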